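(* If $p>2$ and $C>C_0(p)$, then $\boldsymbol{b}_{p,C}(x)=b_{p,C}(x)$ for all $x\in\Omega_C$, where $\boldsymbol{b}_{p,C}$ is the lower Bellman function (defined as an infimum over test functions) and $b_{p,C}$ is the explicit Bellman candidate.
   Context: **Bellman function.** For a finite interval $J$, $\langle\varphi\rangle_J=\frac1{|J|}\int_J\varphi$. For an interval $Q$ and a weight $w>0$ a.e. on $Q$ with $w,\log w\in L^1(Q)$, $[w]_{A_\infty(Q)}=\sup_{\text{intervals }J\subset Q}\langle w\rangle_Je^{-\langle\log w\rangle_J}$. For $R>0$ let $\Gamma_R=\{x\in\mathbb R^2:x_2=Re^{x_1}\}$, and for $C\ge1$ let $\Omega_C=\{x\in\mathbb{R}^2: e^{x_1}\le x_2\le C e^{x_1}\}$. For $x\in\Omega_C$ and an interval $Q$, $$E_{x,C,Q}=\{\varphi\in L^1(Q):\langle\varphi\rangle_Q=x_1,\ \langle e^\varphi\rangle_Q=x_2,\ [e^\varphi]_{A_\infty(Q)}\le C\},\qquad \boldsymbol b_{p,C}(x)=\inf\{\langle|\varphi|^p\rangle_Q:\varphi\in E_{x,C,Q}\}$$ (independent of the choice of $Q$). **Parameters.** $\xi_0(p)=1-\frac1{3^{p+2}\Gamma(p)}$, $C_0(p)=\frac{e^{-\xi_0(p)}}{1-\xi_0(p)}$. For $C\ge1$, $\xi=\xi(C)\in[0,1)$ is the unique non-negative solution of $e^{-\xi}=C(1-\xi)$. Let $k(z)=\frac{e^z}{1-\xi}$. For $x\in\Omega_C$, $u=u(x)$ is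 defined by $x_2=k(u)(x_1-u)+e^u$ with $u\le x_1\le u+\xi$ (geometrically: the one-sided tangent to $\Gamma_C$ through $x$ with point of tangency $(u+\xi,Ce^{u+\xi})$ to the right of $x$ meets $\Gamma_1$ at $(u,e^u)$). **Auxiliary functions.** For $v<0<w$ let $$r(v,w)=\frac{e^w-e^v}{w-v},\qquad q(v,w)=\frac{w^p-(-v)^p}{w-v},$$ $$F(v,w)=(e^w-e^v)\big(w^p-(-v)^p-pw^{p-1}-p(-v)^{p-1}\big)+p(w-v)\big(w^{p-1}e^v+(-v)^{p-1}e^w\big).$$ For each $w\in(0,\frac{p-2}{3p})$ there is a unique $v\in(-w,-w\frac{p-1}p)$ with $F(v,w)=0$; for this $v$ put $D(w)=p\,\frac{w^{p-1}+(-v)^{p-1}}{e^w-e^v}$. **The numbers $\bar w,\bar v$.** Let $c_1=\xi[e(1-\xi)\Gamma(p-1)]^{1/(p-2)}$ and $c_2=\xi[2e(1-\xi)\Gamma(p)]^{1/(p-2)}$ (for $C>C_0(p)$ one has $c_1<c_2<\frac{p-2}{3p}$). Let $w_*$ be the unique solution in $(0,c_1)$ of $\big(\frac1\xi-1\big)\int_w^\infty s^{p-2}e^{-s/\xi}ds-w^{p-2}e^{-w/\xi}=0$, and let $\bar w$ be the unique solution in $(w_*,c_2)$ of $$\Big(\frac1\xi-1\Big)p(p-1)e^{w(1/\xi-1)}\int_w^\infty s^{p-2}e^{-s/\xi}ds=D(w).$$ Let $\bar v$ be the unique solution of $F(\bar v,\bar w)=0$ in $(-\bar w,-\bar w\frac{p-1}p)$.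 **Subdomains** ($\Omega_C=R_1\cup R_2\cup R_3\cup R_4$): $R_1=\{x\in\Omega_C: x_2\le k(\bar w)(x_1-\bar w)+e^{\bar w}\}\cup\{x\in\Omega_C:x_1\ge\bar w+\xi\}$; $R_2=\{x\in\Omega_C: x_2\le k(\bar v)(x_1-\bar v)+e^{\bar v},\ x_2\ge r(\bar v,\bar w)(x_1-\bar w)+e^{\bar w},\ x_2\ge k(\bar w)(x_1-\bar w)+e^{\bar w}\}\cup\{x\in\Omega_C:\bar v+\xi\le x_1\le\bar w+\xi,\ x_2\ge k(\bar v)(x_1-\bar v)+e^{\bar v},\ x_2\ge k(\bar w)(x_1-\bar w)+e^{\bar w}\}$; $R_3=\{x\in\Omega_C:x_1\le\bar v+\xi,\ x_2\ge k(\bar v)(x_1-\bar v)+e^{\bar v}\}$; $R_4=\{x\in\Omega_C:x_2\le r(\bar v,\bar w)(x_1-\bar w)+e^{\bar w}\}$. **Functions $m_1,m_3$.** For $z\in\mathbb R$, $m_1(z)=\frac p\xi e^{z/\xi}\int_z^\infty s|s|^{p-2}e^{-s/\xi}ds$; for $z\le\bar v$, $$m_3(z)=-\frac p\xi e^{z/\xi}\int_z^{\bar v}(-s)^{p-1}e^{-s/\xi}ds+e^{(z-\bar v)/\xi}\Big(e^{\bar v-\bar w}\big(m_1(\bar w)-p\bar w^{p-1}\big)-p(-\bar v)^{p-1}\Big).$$ **Functions $v(x),w(x)$ on $R_4$.** For each $x\in R_4$, $x\neq(0,1)$, there is a unique pair $v=v(x),w=w(x)$ with $w\in(0,\frac{p-2}{3p})$,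 $v\in(-w,-w\frac{p-1}p)$, $F(v,w)=0$, such that the segment joining $(v,e^v)$ and $(w,e^w)$ passes through $x$; at $x=(0,1)$ put $v=w=0$. **Candidate.** $$b_{p,C}(x)=\begin{cases}m_1(u)(x_1-u)+u^p,&x\in R_1,\\ q(\bar v,\bar w)(x_1-\bar w)+\bar w^p+\frac{m_1(\bar w)-q(\bar v,\bar w)}{k(\bar w)-r(\bar v,\bar w)}\big(x_2-r(\bar v,\bar w)(x_1-\bar w)-e^{\bar w}\big),&x\in R_2,\\ m_3(u)(x_1-u)+(-u)^p,&x\in R_3,\\ q(v,w)(x_1-w)+w^p,&x\in R_4,\end{cases}$$ with $u=u(x)$, $v=v(x)$, $w=w(x)$; at $x=(0,1)$ the last line is read as $0$. (The formulas agree on shared boundaries.) *)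

(* Defs.v *)
From mathcomp Require Import all_boot all_order all_algebra.
From mathcomp Require Import all_classical all_reals all_analysis.

Set Implicit Arguments.
Unset Strict Implicit.
Unset Printing Implicit Defensive.

Import Order.TTheory GRing.Theory Num.Theory.
Import numFieldNormedType.Exports.

Local Open Scope classical_set_scope.
Local Open Scope ring_scope.

(* Quantities introduced as "the unique solution of ..." are rendered with
   [get], so their defining properties hold once existence is proved. *)

Section LowerBellman.
Context {R : realType}.
Local Notation mu := (@lebesgue_measure R).

(* Intervals are given by their endpoints.  Including them or not does not
   change any average, so closed intervals are used throughout.  Averages are
   extended real numbers since that of |phi|^p below may be +oo. *)
Definition avg (c d : R) (f : R -> R) : \bar R :=
  ((d - c)^-1%:E * \int[mu]_(t in `[c, d]) (f t)%:E)%E.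

Definition weight (a b : R) (w : R -> R) : Prop :=
  [/\ {ae mu, forall t, t \in `[a, b] -> 0 < w t},
      mu.-integrable `[a, b] (EFin \o w)
    & mu.-integrable `[a, b] (EFin \o (fun t => ln (w t)))].

Definition Ainfty_char (a b : R) (w : R -> R) : \bar R :=
  ereal_sup [set s | exists c d : R, [/\ a <= c, c < d, d <= b
    & s = (avg c d w * expeR (- avg c d (fun t => ln (w t))))%E]].

Definition Omega (C : R) : set (R * R) :=
  [set x | expR x.1 <= x.2 <= C * expR x.1].

Definition test_functions (x : R * R) (C a b : R) : set (R -> R) :=
  [set phi | [/\ mu.-integrable `[a, b] (EFin \o phi),
      avg a b phi = x.1%:E,
      avg a b (expR \o phi) = x.2%:E,
      weight a b (expR \o phi)
    & (Ainfty_char a b (expR \o phi) <= C%:E)%E]].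

Definition lower_bellman (p C a b : R) (x : R * R) : \bar R :=
  ereal_inf [set avg a b (fun t => `|phi t| `^ p)
            | phi in test_functions x C a b].

Definition Gamma (z : R) : R :=
  \int[mu]_(s in `]0, +oo[) (s `^ (z - 1) * expR (- s)).

Definition xi0 (p : R) : R := 1 - (3 `^ (p + 2) * Gamma p)^-1.

Definition C0 (p : R) : R := expR (- xi0 p) / (1 - xi0 p).

Definition xi (C : R) : R :=
  get [set t : R | 0 <= t < 1 /\ expR (- t) = C * (1 - t)].

Definition k (C z : R) : R := expR z / (1 - xi C).

Definition u (C : R) (x : R * R) : R :=
  get [set z : R | x.2 = k C z * (x.1 - z) + expR z /\ z <= x.1 <= z + xi C].

Definition r (v w : R) : R := (expR w - expR v) / (w - v).

Definition q (p v w : R) : R := (w `^ p - (- v) `^ p) / (w - v).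

Definition F (p v w : R) : R :=
  (expR w - expR v)
    * (w `^ p - (- v) `^ p - p * w `^ (p - 1) - p * (- v) `^ (p - 1))
  + p * (w - v) * (w `^ (p - 1) * expR v + (- v) `^ (p - 1) * expR w).

Definition F_root (p v w : R) : Prop :=
  - w < v < - (w * ((p - 1) / p)) /\ F p v w = 0.

Definition vF (p w : R) : R := get [set v : R | F_root p v w].

Definition D (p w : R) : R :=
  let v := vF p w in
  p * ((w `^ (p - 1) + (- v) `^ (p - 1)) / (expR w - expR v)).

Definition c1 (p C : R) : R :=
  xi C * (expR 1 * (1 - xi C) * Gamma (p - 1)) `^ (p - 2)^-1.

Definition c2 (p C : R) : R :=
  xi C * (2 * expR 1 * (1 - xi C) * Gamma p) `^ (p - 2)^-1.

Definition tail (p C w : R) : R :=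
  \int[mu]_(s in `[w, +oo[) (s `^ (p - 2) * expR (- s / xi C)).

Definition wstar (p C : R) : R :=
  get [set w : R | 0 < w < c1 p C /\
    ((xi C)^-1 - 1) * tail p C w - w `^ (p - 2) * expR (- w / xi C) = 0].

Definition wbar (p C : R) : R :=
  get [set w : R | wstar p C < w < c2 p C /\
    ((xi C)^-1 - 1) * p * (p - 1) * expR (w * ((xi C)^-1 - 1)) * tail p C w
      = D p w].

Definition vbar (p C : R) : R := vF p (wbar p C).

(* The lines x2 = tangent_line C z x1 (tangent to the upper boundary curve of
   Omega C at abscissa z + xi C) and x2 = chord_line v w x1 both pass through
   the points of the lower boundary curve with abscissa z, resp. v and w. *)
Definition tangent_line (C z x1 : R) : R := k C z * (x1 - z) + expR z.

Definition chord_line (v w x1 : R) : R := r v w * (x1 - w) + expR w.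

Definition R1 (p C : R) : set (R * R) :=
  [set x | Omega C x /\ x.2 <= tangent_line C (wbar p C) x.1] `|`
  [set x | Omega C x /\ wbar p C + xi C <= x.1].

Definition R2 (p C : R) : set (R * R) :=
  [set x | [/\ Omega C x,
      x.2 <= tangent_line C (vbar p C) x.1,
      chord_line (vbar p C) (wbar p C) x.1 <= x.2
    & tangent_line C (wbar p C) x.1 <= x.2]] `|`
  [set x | [/\ Omega C x,
      vbar p C + xi C <= x.1 <= wbar p C + xi C,
      tangent_line C (vbar p C) x.1 <= x.2
    & tangent_line C (wbar p C) x.1 <= x.2]].

Definition R3 (p C : R) : set (R * R) :=
  [set x | [/\ Omega C x, x.1 <= vbar p C + xi C
    & tangent_line C (vbar p C) x.1 <= x.2]].

Definition R4 (p C : R) : set (R * R) :=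
  [set x | Omega C x /\ x.2 <= chord_line (vbar p C) (wbar p C) x.1].

Definition m1 (p C z : R) : R :=
  p / xi C * expR (z / xi C)
    * \int[mu]_(s in `[z, +oo[) (s * `|s| `^ (p - 2) * expR (- s / xi C)).

Definition m3 (p C z : R) : R :=
  - (p / xi C * expR (z / xi C)
      * \int[mu]_(s in `[z, vbar p C]) ((- s) `^ (p - 1) * expR (- s / xi C)))
  + expR ((z - vbar p C) / xi C)
      * (expR (vbar p C - wbar p C)
           * (m1 p C (wbar p C) - p * wbar p C `^ (p - 1))
         - p * (- vbar p C) `^ (p - 1)).

Definition on_segment (A B x : R * R) : Prop :=
  exists2 t : R, 0 <= t <= 1
    & x = ((1 - t) * A.1 + t * B.1, (1 - t) * A.2 + t * B.2).

Definition chord_ends (p : R) (x : R * R) : R * R :=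
  if x == (0, 1) then (0, 0) else
  get [set vw : R * R | [/\ 0 < vw.2 < (p - 2) / (3 * p),
    F_root p vw.1 vw.2
    & on_segment (vw.1, expR vw.1) (vw.2, expR vw.2) x]].

Definition b1 (p C : R) (x : R * R) : R :=
  let u := u C x in m1 p C u * (x.1 - u) + u `^ p.

Definition b2 (p C : R) (x : R * R) : R :=
  let v := vbar p C in let w := wbar p C in
  q p v w * (x.1 - w) + w `^ p
  + (m1 p C w - q p v w) / (k C w - r v w)
      * (x.2 - r v w * (x.1 - w) - expR w).

Definition b3 (p C : R) (x : R * R) : R :=
  let u := u C x in m3 p C u * (x.1 - u) + (- u) `^ p.

Definition b4 (p : R) (x : R * R) : R :=
  let v := (chord_ends p x).1 in let w := (chord_ends p x).2 in
  if x == (0, 1) then 0 else q p v w * (x.1 - w) + w `^ p.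

(* R1, ..., R4 cover Omega C and the formulas agree where they overlap, so
   the order of the tests is immaterial. *)
Definition candidate (p C : R) (x : R * R) : R :=
  if x \in R1 p C then b1 p C x
  else if x \in R2 p C then b2 p C x
  else if x \in R3 p C then b3 p C x
  else b4 p x.

End LowerBellman.

(* Main.v *)
(** Write f(s) = |s|^p, let T_z be the tangent line through (z, e^z) and u = u(x).

    The candidate as a family of planes. Off R4 the candidate at x is L_u(x), where L_z
    is the affine function that touches f at z along the lower boundary and whose
    x2-coefficient is K(z); K is constant on [vbar, wbar], and
    d/dz L_z(x) = K'(z) (x2 - T_z(x1)) with K' <= 0. Hence L_u(s, e^s) <= f(s) for all s
    up to some distance beyond x1, and the candidate dominates L_u near x up to a
    quadratic error. On R4 the plane that touches f at both ends of the chord through x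
    has the same properties.

    Lower bound. For a test function phi on Q = [a, b] and a level al, let S be the open
    set of the points at which some average of phi to the right, or from a past the
    point, exceeds al. By the rising sun lemma the average of phi on each component of S
    is al, so that the averages of phi and e^phi over S form a point x_S of Omega_C,
    and phi <= al almost everywhere off S. Integrating the plane of x_S shows that
    |S| b(x_S) + int_(Q - S) |phi|^p decreases by at most O(d^2) when al increases by d;
    small steps make the error vanish, and as al tends to infinity the first term tends
    to 0.

    Upper bound. Equality is attained by nonincreasing functions built from logarithmic
    pieces v + xi log(T / (t - a)), along which the running averages move on the upper
    boundary, and constant pieces, along which they move on a line towards a point of
    the lower boundary. *)

Require Import Defs.
From mathcomp Require Import all_boot all_order all_algebra.
From mathcomp Require Import all_classical all_reals all_analysis.
From mathcomp Require Import measurable_realfun lra.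

Set Implicit Arguments.
Unset Strict Implicit.
Unset Printing Implicit Defensive.

Import Order.TTheory GRing.Theory Num.Theory.
Import numFieldNormedType.Exports.

Local Open Scope classical_set_scope.
Local Open Scope ring_scope.

(** * Calculus *)

(** Bisecting Q is obstructed by the shape of [Omega C]: the segment joining the averages over two
    halves may leave the domain, so local convexity cannot be used along it. Level sets avoid this.
    All components of a level set have the same mean al, so the A_infty bounds on them add up and
    keep the averages in the same [Omega C], and a small change of al shifts their abscissa slightly
    to the right. There the plane at x can exceed the candidate only because a point to the right of
    x may lie above tangent lines that touch the upper boundary before it; the excess and the range
    of such lines are both of order d. The equation K' = kappa (K - g) with g = f'' e^-s says that
    neighbouring planes L_z agree to first order along T_z. On the right the solution is the one
    with K e^(-kappa z) tending to 0. [wbar] is where it meets the coefficient [D] of a plane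
    tangent to f at two points, and that plane then serves on all of [vbar, wbar]. The bound C > C0
    forces [xi] so close to 1 that this crossing happens where the two-point planes are known to
    exist. *)

Section Calculus.
Context {R : realType}.
Implicit Types (f g : R -> R) (x y z a b c : R).

(** Differentiation rules on explicit abstractions, so that a derivative can be assembled as a
    single term and adjusted by [is_derive_eq]. *)
Lemma isD_cst c x : is_derive x 1 (fun=> c : R) 0.
Proof. exact: is_derive_cst. Qed.

Lemma isD_id x : is_derive x 1 (fun t : R => t) 1.
Proof. exact: is_derive_id. Qed.

Lemma isD_add f g x a b : is_derive x 1 f a -> is_derive x 1 g b ->
  is_derive x 1 (fun t => f t + g t) (a + b).
Proof. by move=> fa gb; exact: is_deriveD. Qed.

Lemma isD_opp f x a : is_derive x 1 f a -> is_derive x 1 (fun t => - f t) (- a).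
Proof. by move=> fa; exact: is_deriveN. Qed.

Lemma isD_mul f g x a b : is_derive x 1 f a -> is_derive x 1 g b ->
  is_derive x 1 (fun t => f t * g t) (a * g x + f x * b).
Proof.
move=> fa gb; apply: (is_derive_eq (is_deriveM fa gb)).
by rewrite /GRing.scale/=; lra.
Qed.

Lemma isD_comp f g x a b : is_derive (g x) 1 f a -> is_derive x 1 g b ->
  is_derive x 1 (fun t => f (g t)) (a * b).
Proof.
move=> fa gb; apply: (is_derive_eq (is_derive1_comp fa gb)).
by rewrite /GRing.scale/=; lra.
Qed.

Lemma isD_expR g x b : is_derive x 1 g b ->
  is_derive x 1 (fun t => expR (g t)) (expR (g x) * b).
Proof. by move=> gb; apply: isD_comp gb; exact: is_derive_expR. Qed.

Lemma isD_cont f x a : is_derive x 1 f a -> {for x, continuous f}.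
Proof. by case=> fx _; apply: differentiable_continuous; exact/derivable1_diffP. Qed.

End Calculus.

(** * Monotonicity from the sign of the derivative; convexity of exp *)

Section Monotone.
Context {R : realType}.

Lemma mono_le (f df : R -> R) (a b : R) : a <= b ->
  (forall x, a <= x <= b -> is_derive x 1 f (df x)) ->
  (forall x, a < x < b -> 0 <= df x) -> f a <= f b.
Proof.
rewrite le_eqVlt => /predU1P[->//|ab] fd d0.
have [x xab /eqP] : exists2 c, c \in `]a, b[%R & f b - f a = df c * (b - a).
  apply: MVT => //.
    by move=> x; rewrite in_itv/= => /andP[/ltW ax /ltW xb]; apply: fd; rewrite ax.
  apply: continuous_in_subspaceT => x /[1!inE]/=; rewrite in_itv/= => xab.
  exact: isD_cont (fd _ xab).
rewrite subr_eq => /eqP ->; rewrite lerDr mulr_ge0 ?subr_ge0 ?(ltW ab)//.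
by apply: d0; move: xab; rewrite in_itv.
Qed.

Lemma mono_lt (f df : R -> R) (a b : R) : a < b ->
  (forall x, a <= x <= b -> is_derive x 1 f (df x)) ->
  (forall x, a < x < b -> 0 < df x) -> f a < f b.
Proof.
move=> ab fd d0.
have [x xab /eqP] : exists2 c, c \in `]a, b[%R & f b - f a = df c * (b - a).
  apply: MVT => //.
    by move=> x; rewrite in_itv/= => /andP[/ltW ax /ltW xb]; apply: fd; rewrite ax.
  apply: continuous_in_subspaceT => x /[1!inE]/=; rewrite in_itv/= => xab.
  exact: isD_cont (fd _ xab).
rewrite subr_eq => /eqP ->; rewrite ltrDr mulr_gt0 ?subr_gt0//.
by apply: d0; move: xab; rewrite in_itv.
Qed.

Lemma expR_ge_tangent (x y : R) : expR x * (1 + (y - x)) <= expR y.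
Proof.
have -> : expR y = expR x * expR (y - x) by rewrite -expRD; congr expR; lra.
by rewrite ler_pM2l ?expR_gt0// expR_ge1Dx.
Qed.

Lemma expR_gt_tangent (x y : R) : y != x -> expR x * (1 + (y - x)) < expR y.
Proof.
move=> yx; have -> : expR y = expR x * expR (y - x) by rewrite -expRD; congr expR; lra.
by rewrite ltr_pM2l ?expR_gt0// expR_gt1Dx// subr_eq0.
Qed.

Lemma expR_conv (t a b : R) : 0 <= t <= 1 ->
  expR (t * a + (1 - t) * b) <= t * expR a + (1 - t) * expR b.
Proof.
move=> /andP[t0 t1]; set m := t * a + (1 - t) * b.
have ha := expR_ge_tangent m a; have hb := expR_ge_tangent m b.
have {}ha := ler_wpM2l t0 ha.
have {}hb : (1 - t) * (expR m * (1 + (b - m))) <= (1 - t) * expR b.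
  by rewrite ler_wpM2l ?subr_ge0.
apply: le_trans (lerD ha hb); rewrite le_eqVlt; apply/orP; left; apply/eqP.
by move: (expR m) => E; rewrite /m; lra.
Qed.

End Monotone.

Section EpsDelta.
Context {R : realType}.

Lemma cont_epsP (f : R -> R) (x : R) :
  {for x, continuous f} <->
  forall e, 0 < e -> exists2 d, 0 < d & forall y, `|y - x| < d -> `|f y - f x| < e.
Proof.
split=> [/cvgrPdist_lt fx e e0|h].
  have [d /= d0 H] := fx _ e0; exists d => // y yx; rewrite distrC.
  by apply: H; rewrite /= distrC.
apply/cvgrPdist_lt => e e0; have [d d0 H] := h _ e0.
by exists d => //= y yx; rewrite distrC H// distrC.
Qed.

End EpsDelta.

(** * Derivatives of powers of |s| across the origin *)

Section Powers.
Context {R : realType}.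
Implicit Types q s x : R.

Lemma abspow_continuous q : 0 < q -> continuous (fun s : R => `|s| `^ q).
Proof.
move=> q0 x; have [->|x0] := eqVneq x 0.
  apply/cont_epsP => e e0; exists (e `^ q^-1); first exact: powR_gt0.
  move=> y; rewrite !subr0 normr0 powR0 ?gt_eqF// subr0 (ger0_norm (powR_ge0 _ _)) => ye.
  have := @gt0_ltr_powR R q q0 `|y| (e `^ q^-1).
  rewrite !nnegrE normr_ge0 powR_ge0 => /(_ isT isT ye).
  rewrite -powRrM mulVf ?gt_eqF// powRr1; [exact | exact: ltW].
have hp : {for `|x|, continuous (fun s : R => s `^ q)}.
  have x1 : 0 < `|x| by rewrite normr_gt0.
  exact: isD_cont (is_derive1_powR q x1).
have hn : {for x, continuous (@Num.norm _ R)} by apply: norm_continuous.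
exact: (continuous_comp hn hp).
Qed.

(** The signed power has one formula on both sides of 0; at 0 itself its Caratheodory slope is
    |s|^q, which is continuous and vanishes there. *)
Lemma is_derive_spow q x : 0 < q ->
  is_derive x 1 (fun s : R => s * `|s| `^ q) ((q + 1) * `|x| `^ q).
Proof.
move=> q0; have [->|x0] := eqVneq x 0.
  rewrite normr0 powR0 ?gt_eqF// mulr0.
  apply/is_derive1_caratheodory; exists (fun s => `|s| `^ q); split.
  - by move=> z; rewrite mul0r !subr0 mulrC.
  - exact: abspow_continuous.
  - by rewrite normr0 powR0 ?gt_eqF.
have [xp|xneg] : 0 < x \/ 0 < - x.
  by move: x0; rewrite neq_lt oppr_gt0 => /orP[]; [right|left].
- have := is_derive1_powR (q + 1) xp; rewrite addrK (gtr0_norm xp) => h.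
  apply: (near_eq_is_derive _ h).
  near=> t; have t0 : 0 < t by near: t; exact: lt_nbhsr.
  rewrite (gtr0_norm t0) powRD ?(gt_eqF t0) ?implybT//.
  by rewrite (powRr1 (ltW t0)); lra.
- have xn0 : x < 0 by rewrite -oppr_gt0.
  have := is_derive1_powR (q + 1) xneg; rewrite addrK => h.
  have h2 : is_derive x 1 (fun s : R => - (- s) `^ (q + 1)) ((q + 1) * `|x| `^ q).
    apply: (is_derive_eq (isD_opp (isD_comp h (isD_opp (isD_id x))))).
    by rewrite (ltr0_norm xn0); lra.
  apply: (near_eq_is_derive _ h2).
  near=> t; have t0 : t < 0 by near: t; exact: lt_nbhsl.
  have nt0 : 0 < - t by rewrite oppr_gt0.
  rewrite (ltr0_norm t0) powRD ?oppr_eq0 ?(lt_eqF t0) ?implybT//.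
  by rewrite (powRr1 (ltW nt0)); lra.
Unshelve. all: by end_near. Qed.

Lemma abspow_spow q s : 0 < q -> `|s| `^ (q + 2) = s * (s * `|s| `^ q).
Proof.
move=> q0; have [->|s0] := eqVneq s 0.
  by rewrite mul0r normr0 powR0// gt_eqF// addr_gt0.
rewrite powRD ?normr_eq0 ?s0 ?implybT// (@powR_mulrn _ _ 2)// real_normK ?num_real//.
by rewrite expr2; lra.
Qed.

Lemma is_derive_abspow q x : 0 < q ->
  is_derive x 1 (fun s : R => `|s| `^ (q + 2)) ((q + 2) * (x * `|x| `^ q)).
Proof.
move=> q0; rewrite (_ : (fun _ => _) = (fun s => s * (s * `|s| `^ q))); last first.
  by apply/funext => s; exact: abspow_spow.
have h := is_derive_spow x q0.
by apply: (is_derive_eq (isD_mul (isD_id x) h)); lra.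
Qed.

End Powers.

(** * Primitives and the fundamental theorem of calculus *)

Section Primitive.
Context {R : realType}.
Local Notation mu := (@lebesgue_measure R).

Lemma continuous_itv_integrable (h : R -> R) a b : continuous h ->
  mu.-integrable `[a, b] (EFin \o h).
Proof.
move=> hc; apply: continuous_compact_integrable; first exact: segment_compact.
exact: continuous_subspaceT.
Qed.

Lemma continuous_primitive (h : R -> R) : continuous h ->
  exists H : R -> R, forall x : R, is_derive x 1 H (h x).
Proof.
move=> hc.
pose I a x := \int[mu]_(t in `[a, x]) h t.
have dI (a x : R) : a < x -> is_derive x 1 (I a) (h x).
  move=> ax; have x1 : x < x + 1 by rewrite ltrDl.
  have [dI eI] := continuous_FTC1_closed x1 (continuous_itv_integrable a (x + 1) hc) ax (hc x).
  by split; [exact: dI|rewrite -derive1E].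
have shift (a b x : R) : a <= b -> b <= x -> I a x = I a b + I b x.
  move=> ab bx; rewrite /I.
  have := @Rintegral_itvB R h (BLeft a) (BRight x) b.
  rewrite !bnd_simp => /(_ (continuous_itv_integrable a x hc) ab bx).
  rewrite Rintegral_itv_obnd_cbnd; first by lra.
  by apply: integrableS (continuous_itv_integrable b x hc) => //; exact: subset_itv_oc_cc.
(* An integral from a base point is differentiable only to the right of that point, so the base
   point is kept at least one unit left of both 0 and x; subtracting the integral up to 0 removes
   the dependence on it. *)
exists (fun x => if 0 <= x then I (-1) x - I (-1) 0 else I (x - 1) x - I (x - 1) 0).
move=> x; pose a := Num.min (x - 2) (-2).
have hD : is_derive x 1 (fun y => I a y - I a 0) (h x).
  have ha : is_derive x 1 (I a) (h x) by apply: dI; rewrite gt_min; lra.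
  by apply: is_derive_eq; lra.
apply: (near_eq_is_derive _ hD).
near=> t.
have ta : a <= t - 1.
  rewrite ge_min; have : x - 1 < t by near: t; apply: lt_nbhsr; lra.
  by lra.
have a2 : a <= - 1 by rewrite ge_min; apply/orP; right; lra.
case: ifPn => [t0|]; last rewrite -ltNge => t0.
- by rewrite (shift a (-1) t) ?(shift a (-1) 0)//; lra.
- by rewrite (shift a (t - 1) t) ?(shift a (t - 1) 0)//; lra.
Unshelve. all: by end_near. Qed.

Lemma Rintegral_primitive (h H : R -> R) a b : continuous h ->
  (forall x : R, is_derive x 1 H (h x)) -> a <= b ->
  \int[mu]_(t in `[a, b]) h t = H b - H a.
Proof.
move=> hc hH; rewrite le_eqVlt => /predU1P[<-|ab].
  by rewrite set_itv1 Rintegral_set1 subrr.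
rewrite /Rintegral (@continuous_FTC2 _ h H) //.
- exact: continuous_subspaceT.
- split => [x _||]; first by have [] := hH x.
  + exact/cvg_at_right_filter/(isD_cont (hH a)).
  + exact/cvg_at_left_filter/(isD_cont (hH b)).
- by move=> x _; rewrite derive1E; have [_] := hH x.
Qed.

Lemma Rintegral_primitivey (h H : R -> R) a l :
  (forall x, a <= x -> 0 <= h x) -> {in `]a, +oo[, continuous h} ->
  h x @[x --> a^'+] --> h a ->
  (forall x, a < x -> is_derive x 1 H (h x)) ->
  H x @[x --> a^'+] --> H a -> H x @[x --> +oo] --> l ->
  \int[mu]_(t in `[a, +oo[) h t = l - H a.
Proof.
move=> h0 hc ha hH Ha Hl; rewrite (@Rintegral_ge0_continuous_FTC2y _ h H a l)//.
- by apply/continuous_within_itvcyP; split.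
- by move=> x ax; have [] := hH x ax.
- by move=> x; rewrite in_itv/= andbT => ax; rewrite derive1E; have [] := hH x ax.
Qed.

End Primitive.

(** * The power function and its bitangent planes *)

Section PowerFunction.
Context {R : realType}.
Variable p : R.
Hypothesis hp : 2 < p.
Ltac plra := move: hp; lra.
Implicit Types s t v w x : R.

Definition powf s := `|s| `^ p.
Definition powf1 s := p * (s * `|s| `^ (p - 2)).
Definition powf2 s := p * (p - 1) * `|s| `^ (p - 2).
(** The curvature of |s|^p relative to that of e^s. *)
Definition powg s := powf2 s * expR (- s).

Let q0 : 0 < p - 2. Proof. by rewrite subr_gt0. Qed.
Let p0 : 0 < p * (p - 1). Proof. by rewrite mulr_gt0//; plra. Qed.

Lemma is_derive_powf x : is_derive x 1 powf (powf1 x).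
Proof. by have := is_derive_abspow x q0; rewrite /powf /powf1 subrK. Qed.

Lemma is_derive_powf1 x : is_derive x 1 powf1 (powf2 x).
Proof.
apply: (is_derive_eq (isD_mul (isD_cst p x) (is_derive_spow x q0))).
by rewrite /powf2; plra.
Qed.

Lemma powf_ge0 s : 0 <= powf s. Proof. exact: powR_ge0. Qed.

Lemma powf2_gt0 s : s != 0 -> 0 < powf2 s.
Proof. by move=> s0; rewrite mulr_gt0// powR_gt0// normr_gt0. Qed.

Lemma powf2_ge0 s : 0 <= powf2 s.
Proof. by rewrite mulr_ge0// ?powR_ge0// ltW. Qed.

Lemma powg_gt0 s : s != 0 -> 0 < powg s.
Proof. by move=> s0; rewrite mulr_gt0 ?expR_gt0// powf2_gt0. Qed.

Lemma powg_expR s : powg s * expR s = powf2 s.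
Proof. by rewrite /powg -mulrA -expRD addNr expR0 mulr1. Qed.

Lemma powf_pos s : 0 <= s -> powf s = s `^ p.
Proof. by move=> s0; rewrite /powf ger0_norm. Qed.

Lemma powf_neg s : s <= 0 -> powf s = (- s) `^ p.
Proof. by move=> s0; rewrite /powf ler0_norm. Qed.

Lemma powf1_pos s : 0 < s -> powf1 s = p * s `^ (p - 1).
Proof.
move=> s0; rewrite /powf1 gtr0_norm//; congr (_ * _).
have -> : p - 2 = p - 1 - 1 by plra.
by rewrite mulr_powRB1 ?(ltW s0)//; plra.
Qed.

Lemma powf1_neg s : s < 0 -> powf1 s = - (p * (- s) `^ (p - 1)).
Proof.
move=> s0; have ns0 : 0 < - s by rewrite oppr_gt0.
by rewrite -powf1_pos// /powf1 normrN; plra.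
Qed.

Lemma powg_decr s t : s < t -> t <= 0 -> powg t < powg s.
Proof.
move=> st t0; have s0 : s < 0 by exact: lt_le_trans st t0.
rewrite /powg ltr_pM ?powf2_ge0 ?expR_ge0//; last by rewrite ltr_expR ltrN2.
rewrite /powf2 ltr_pM2l// (ltr0_norm s0) (ler0_norm t0).
by apply: gt0_ltr_powR => //; rewrite ?nnegrE ?ltrN2//; plra.
Qed.

Lemma is_derive_powg x : 0 < x ->
  is_derive x 1 (fun s => p * (p - 1) * s `^ (p - 2) * expR (- s))
    (p * (p - 1) * x `^ (p - 2 - 1) * (p - 2 - x) * expR (- x)).
Proof.
move=> x0; have h := is_derive1_powR (p - 2) x0.
have h2 := isD_mul (isD_mul (isD_cst (p * (p - 1)) x) h) (isD_expR (isD_opp (isD_id x))).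
apply: (is_derive_eq h2).
have := @mulr_powRB1 R x (p - 2) (ltW x0) q0.
by move: (_ `^ _) (_ `^ _) => a b <-; plra.
Qed.

Lemma powg_incr s t : 0 <= s -> s < t -> t <= p - 2 -> powg s < powg t.
Proof.
rewrite le_eqVlt => /predU1P[<- t0 _|s0 st tq].
  rewrite {1}/powg /powf2 normr0 powR0 ?gt_eqF// mulr0 mul0r.
  by rewrite powg_gt0// gt_eqF.
have t0 := lt_trans s0 st.
rewrite /powg /powf2 (gtr0_norm s0) (gtr0_norm t0).
pose h (x : R) := p * (p - 1) * x `^ (p - 2) * expR (- x).
pose dh (x : R) := p * (p - 1) * x `^ (p - 2 - 1) * (p - 2 - x) * expR (- x).
rewrite -/(h s) -/(h t).
apply: (@mono_lt _ h dh s t st) => [x /andP[sx _]|x /andP[sx xt]].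
  by apply: is_derive_powg; exact: lt_le_trans sx.
have x0 := lt_trans s0 sx.
by rewrite /dh !mulr_gt0 ?expR_gt0 ?powR_gt0//; plra.
Qed.

Lemma powg_decr2 s t : p - 2 <= s -> s <= t -> powg t <= powg s.
Proof.
move=> qs st; have s0 := lt_le_trans q0 qs; have t0 := lt_le_trans s0 st.
rewrite /powg /powf2 (gtr0_norm s0) (gtr0_norm t0) -lerN2.
pose h (x : R) := - (p * (p - 1) * x `^ (p - 2) * expR (- x)).
pose dh (x : R) := - (p * (p - 1) * x `^ (p - 2 - 1) * (p - 2 - x) * expR (- x)).
rewrite -/(h s) -/(h t).
apply: (@mono_le _ h dh s t st) => [x /andP[sx _]|x /andP[sx xt]].
  by apply: isD_opp; apply: is_derive_powg; exact: lt_le_trans sx.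
have x0 := lt_trans s0 sx; rewrite /dh oppr_ge0.
have h1 : 0 <= p * (p - 1) * x `^ (p - 2 - 1) * expR (- x).
  by rewrite !mulr_ge0 ?expR_ge0 ?powR_ge0//; plra.
have h2 : p - 2 - x <= 0 by plra.
by have := mulr_ge0_le0 h1 h2; plra.
Qed.

Definition pgap A B K s := powf s - (A + B * s + K * expR s).
Definition pgap1 B K s := powf1 s - (B + K * expR s).

Lemma is_derive_pgap A B K x : is_derive x 1 (pgap A B K) (pgap1 B K x).
Proof.
apply: (is_derive_eq (isD_add (is_derive_powf x) (isD_opp (isD_add (isD_add
  (isD_cst A x) (isD_mul (isD_cst B x) (isD_id x)))
  (isD_mul (isD_cst K x) (is_derive_expR x)))))).
by rewrite /pgap1; plra.
Qed.

Lemma is_derive_pgap1 B K x :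
  is_derive x 1 (pgap1 B K) ((powg x - K) * expR x).
Proof.
apply: (is_derive_eq (isD_add (is_derive_powf1 x) (isD_opp (isD_add
  (isD_cst B x) (isD_mul (isD_cst K x) (is_derive_expR x)))))).
by rewrite mulrBl powg_expR; plra.
Qed.

(* The plane [y2 -> A + B y1 + K y2] restricted to the lower boundary is tangent
   to [powf] at both [v] and [w]. *)
Definition bitangent A B K v w := [/\ v < 0, 0 < w < p - 2,
  pgap A B K v = 0 /\ pgap1 B K v = 0 & pgap A B K w = 0 /\ pgap1 B K w = 0].

Lemma rolle_isD (h dh : R -> R) a b : a < b ->
  (forall x : R, is_derive x 1 h (dh x)) -> h a = h b ->
  exists2 c, a < c < b & dh c = 0.
Proof.
move=> ab hd hab.
have [c] : exists2 c, c \in `]a, b[ & h b - h a = dh c * (b - a).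
  apply: MVT => // x; apply: continuous_subspaceT => {}x; exact: isD_cont (hd x).
rewrite in_itv/= hab subrr => acb /esym/eqP; rewrite mulf_eq0 => /orP[/eqP|].
  by exists c.
by rewrite subr_eq0 gt_eqF.
Qed.

(* [pgap'' = (powg - K) exp] and [powg] decreases on the negative axis and
   increases up to [p - 2], so between two double zeros it crosses the level [K]
   exactly twice. *)
Lemma bitangent_level A B K v w : bitangent A B K v w ->
  exists d1 d2, [/\ v < d1 < 0, 0 < d2 < w, powg d1 = K & powg d2 = K].
Proof.
case=> v0 /andP[w0 wq] [Gv G'v] [Gw G'w].
have vw : v < w by exact: lt_trans w0.
have [c /andP[vc cw] G'c] := rolle_isD vw (is_derive_pgap A B K) (etrans Gv (esym Gw)).
have [d1 /andP[vd dc] e1] := rolle_isD vc (is_derive_pgap1 B K) (etrans G'v (esym G'c)).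
have [d2 /andP[cd dw] e2] := rolle_isD cw (is_derive_pgap1 B K) (etrans G'c (esym G'w)).
have level d : (powg d - K) * expR d = 0 -> powg d = K.
  by move/eqP; rewrite mulf_eq0 [expR d == 0]gt_eqF ?expR_gt0// orbF subr_eq0 => /eqP.
have {}e1 := level _ e1; have {}e2 := level _ e2.
have d12 : d1 < d2 by exact: lt_trans cd.
exists d1, d2; split => //.
- rewrite vd/= ltNge; apply/negP => d10.
  by have := powg_incr d10 d12 (ltW (lt_trans dw wq)); rewrite e1 e2 ltxx.
- rewrite dw andbT ltNge; apply/negP => d20.
  by have := powg_decr d12 d20; rewrite e1 e2 ltxx.
Qed.

Lemma bitangent_K_lt A B K v w : bitangent A B K v w ->
  [/\ 0 < K, K < powg v & K < powg w].
Proof.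
move=> h; have [d1 [d2 [/andP[vd1 d10] /andP[d20 d2w] e1 e2]]] := bitangent_level h.
case: h => v0 /andP[w0 wq] _ _; split.
- by rewrite -e1 powg_gt0// lt_eqF.
- by rewrite -e1; apply: powg_decr => //; exact: ltW.
- by rewrite -e2; apply: powg_incr => //; exact: ltW.
Qed.

(** By [bitangent_level] the gap is convex left of d1, concave on [d1, d2] and convex on
    [d2, p - 2]. A double zero is the strict minimum of its convex piece, and on the concave piece
    the gap is at least the smaller of its two end values. Beyond p - 2 [powg] decreases again,
    hence the bound on s. *)
Lemma bitangent_gap_gt0 A B K v w s : bitangent A B K v w ->
  s <= p - 2 -> s != v -> s != w -> 0 < pgap A B K s.
Proof.
move=> h sq sv sw.
have [d1 [d2 [/andP[vd1 d10] /andP[d20 d2w] e1 e2]]] := bitangent_level h.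
case: h => v0 /andP[w0 wq] [Gv G'v] [Gw G'w].
have dG := is_derive_pgap A B K; have dG1 := is_derive_pgap1 B K.
have incr1 x y : x < y -> y <= d1 -> pgap1 B K x < pgap1 B K y.
  move=> xy yd; apply: (mono_lt xy (fun x _ => dG1 x)) => z /andP[xz zy].
  rewrite mulr_gt0 ?expR_gt0// subr_gt0 -e1; apply: powg_decr; last exact: ltW.
  exact: lt_le_trans yd.
have incr2 x y : d2 <= x -> x < y -> y <= p - 2 -> pgap1 B K x < pgap1 B K y.
  move=> dx xy yd; apply: (mono_lt xy (fun x _ => dG1 x)) => z /andP[xz zy].
  rewrite mulr_gt0 ?expR_gt0// subr_gt0 -e2; apply: powg_incr; first exact: ltW.
    exact: le_lt_trans xz.
  by rewrite ltW// (lt_le_trans zy).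
have decr x y : d1 <= x -> x <= y -> y <= d2 -> pgap1 B K y <= pgap1 B K x.
  move=> dx xy yd; rewrite -lerN2.
  apply: (mono_le xy (fun x _ => isD_opp (dG1 x))) => z /andP[xz zy].
  rewrite -mulNr mulr_ge0 ?expR_ge0// oppr_ge0 subr_le0.
  have [z0|z0] := leP z 0.
    by rewrite -e1 ltW// powg_decr//; exact: le_lt_trans xz.
  rewrite -e2 ltW// powg_incr//; first exact: ltW.
    exact: lt_le_trans yd.
  by rewrite ltW// (lt_trans d2w).
have left x : x <= d1 -> x != v -> 0 < pgap A B K x.
  move=> xd; rewrite neq_lt => /orP[xv|vx].
    rewrite -Gv -ltrN2.
    apply: (mono_lt xv (fun x _ => isD_opp (dG x))) => z /andP[xz zv].
    by rewrite oppr_gt0 -G'v incr1// ltW.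
  rewrite -Gv; apply: (mono_lt vx (fun x _ => dG x)) => z /andP[vz zx].
  by rewrite -G'v incr1// ltW// (lt_le_trans zx).
have right x : d2 <= x -> x <= p - 2 -> x != w -> 0 < pgap A B K x.
  move=> dx xq; rewrite neq_lt => /orP[xw|wx].
    rewrite -Gw -ltrN2.
    apply: (mono_lt xw (fun x _ => isD_opp (dG x))) => z /andP[xz zw].
    rewrite oppr_gt0 -G'w incr2//; last exact: ltW.
    by rewrite ltW// (le_lt_trans dx).
  rewrite -Gw; apply: (mono_lt wx (fun x _ => dG x)) => z /andP[wz zx].
  by rewrite -G'w incr2//; [exact: ltW|rewrite ltW// (lt_le_trans zx)].
have [|d1s] := leP s d1; first by move/left; exact.
have [|sd2] := leP d2 s; first by move/right; exact.
have [G's|G's] := leP 0 (pgap1 B K s).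
  apply: (lt_le_trans (left d1 (lexx _) _)); first by rewrite gt_eqF.
  apply: (mono_le (ltW d1s) (fun x _ => dG x)) => z /andP[d1z zs].
  by rewrite (le_trans G's)// decr// ltW.
apply: (lt_le_trans (right d2 (lexx _) _ _)); [|by rewrite lt_eqF|].
  by rewrite ltW// (lt_trans d2w).
rewrite -lerN2; apply: (mono_le (ltW sd2) (fun x _ => isD_opp (dG x))) => z /andP[sz zd].
by rewrite oppr_ge0 (le_trans _ (ltW G's))// decr// ltW.
Qed.

Lemma bitangent_gap_ge0 A B K v w s : bitangent A B K v w ->
  s <= p - 2 -> 0 <= pgap A B K s.
Proof.
move=> h sq; have [->|sv] := eqVneq s v; first by case: h => _ _ [->].
have [->|sw] := eqVneq s w; first by case: h => _ _ _ [->].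
exact: ltW (bitangent_gap_gt0 h sq sv sw).
Qed.

End PowerFunction.

(** * Elementary bounds for exponentials and powers *)

Section ExpBounds.
Context {R : realType}.
Implicit Types w y r x : R.

Lemma expRN_le2 y : 0 <= y -> expR (- y) <= 1 - y + y ^+ 2 / 2.
Proof.
move=> y0; rewrite -subr_ge0.
pose h (t : R) := 1 - t + 2^-1 * (t * t) - expR (- t).
have dh (x : R) : is_derive x 1 h (-1 + x + expR (- x)).
  apply: is_derive_eq; rewrite /GRing.scale/=; lra.
have := @mono_le R h _ 0 y y0 (fun x _ => dh x).
rewrite /h oppr0 expR0 expr2 => H.
suff /H : forall x, 0 < x < y -> 0 <= -1 + x + expR (- x) by lra.
by move=> x _; have := expR_ge1Dx (- x); lra.
Qed.

Lemma expR_ge2 y : 0 <= y -> 1 + y + y ^+ 2 / 2 <= expR y.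
Proof.
move=> y0; rewrite -subr_ge0.
pose h (t : R) := expR t - (1 + t + 2^-1 * (t * t)).
have dh (x : R) : is_derive x 1 h (expR x - (1 + x)).
  by apply: is_derive_eq; rewrite /GRing.scale/=; lra.
have := @mono_le R h _ 0 y y0 (fun x _ => dh x).
rewrite /h expR0 expr2 => H.
suff /H : forall x, 0 < x < y -> 0 <= expR x - (1 + x) by lra.
by move=> x _; have := expR_ge1Dx x; lra.
Qed.

Lemma expR_le_third w : 0 <= w -> w <= 3^-1 -> expR w <= 1 + w + 3 / 2 * w ^+ 2.
Proof.
move=> w0 w3; have h1 := expR_ge1Dx (- w).
have h2 : expR w * expR (- w) = 1 by rewrite -expRD subrr expR0.
have h3 := expR_gt0 w.
have h4 : expR w * (1 - w) <= 1 by rewrite -[leRHS]h2 ler_pM2l.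
(* The product equals 1 + 3/2 w^2 (1/3 - w). *)
have h5 : 1 <= (1 + w + 3 / 2 * w ^+ 2) * (1 - w).
  have : 0 <= w ^+ 2 * (3^-1 - w) by rewrite mulr_ge0 ?sqr_ge0 ?subr_ge0.
  by rewrite -subr_ge0; lra.
rewrite -(@ler_pM2r _ (1 - w)); last by lra.
exact: le_trans h5.
Qed.

Lemma bernoulli_powR x r : 0 <= x -> 1 <= r -> 1 + r * x <= (1 + x) `^ r.
Proof.
move=> x0 r1; rewrite -subr_ge0.
pose h (t : R) := (1 + t) `^ r - (1 + r * t).
have dh t : 0 <= t <= x -> is_derive t 1 h (r * (1 + t) `^ (r - 1) - r).
  move=> /andP[t0 _]; have t1 : 0 < 1 + t by lra.
  apply: (is_derive_eq (isD_add (isD_comp (is_derive1_powR r t1)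
    (isD_add (isD_cst 1 t) (isD_id t))) (isD_opp (isD_add (isD_cst 1 t)
    (isD_mul (isD_cst r t) (isD_id t)))))).
  by lra.
have := @mono_le R h _ 0 x x0 dh.
rewrite /h addr0 powR1 mulr0 addr0 subrr => H.
apply: H => t /andP[t0 _].
rewrite subr_ge0 ler_peMr//; first by lra.
have := @ge0_ler_powR R (r - 1); rewrite subr_ge0 => /(_ r1 1 (1 + t)).
by rewrite !nnegrE powR1; apply; lra.
Qed.

Lemma sinh_lt w : 0 < w -> expR w - expR (- w) < w * (expR w + expR (- w)).
Proof.
move=> w0; rewrite -subr_gt0.
pose h (t : R) := t * (expR t + expR (- t)) - (expR t - expR (- t)).
have dh (t : R) : is_derive t 1 h (t * (expR t - expR (- t))).
  by apply: is_derive_eq; rewrite /GRing.scale/=; lra.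
have := @mono_lt R h _ 0 w w0 (fun t _ => dh t).
rewrite /h mul0r oppr0 expR0 => H.
suff /H : forall t, 0 < t < w -> 0 < t * (expR t - expR (- t)) by lra.
by move=> t /andP[t0 _]; rewrite mulr_gt0// subr_gt0 ltr_expR; lra.
Qed.

End ExpBounds.

(** * The chord equation F(v, w) = 0 *)

Section Cup.
Context {R : realType}.
Variable p : R.
Hypothesis hp : 2 < p.
Ltac plra := move: hp; lra.
Implicit Types s t v w x : R.

(** The coefficients forced by tangency: [chordK] by the slopes at both ends, [chordB] and [chordA]
    by slope and value at w. The one condition left, the value at v, is F = 0: the gap at v times
    e^w - e^v is -F. *)
Definition chordK v w := p * ((w `^ (p - 1) + (- v) `^ (p - 1)) / (expR w - expR v)).
Definition chordB v w := powf1 p w - chordK v w * expR w.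
Definition chordA v w := powf p w - chordB v w * w - chordK v w * expR w.

Lemma F_bitangent v w : v < 0 -> 0 < w < p - 2 -> F p v w = 0 ->
  bitangent p (chordA v w) (chordB v w) (chordK v w) v w.
Proof.
move=> v0 /andP[w0 wq] Fvw; split=> //; first by rewrite w0.
  have E0 : expR w - expR v != 0.
    by rewrite subr_eq0 gt_eqF// ltr_expR (lt_trans v0).
  have KE : chordK v w * (expR w - expR v) = p * (w `^ (p - 1) + (- v) `^ (p - 1)).
    by rewrite /chordK -mulrA mulfVK.
  have g1 : pgap1 p (chordB v w) (chordK v w) v = 0.
    rewrite /pgap1 /chordB (powf1_neg hp v0) (powf1_pos hp w0).
    by move: KE; lra.
  split => //; apply: (mulfI E0); rewrite mulr0.
  rewrite /pgap /chordA /chordB (powf1_pos hp w0) (powf_pos _ (ltW w0)) (powf_neg _ (ltW v0)).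
  move: Fvw KE; rewrite /F.
  move: (chordK v w) (expR w) (expR v) (w `^ (p - 1)) ((- v) `^ (p - 1)) (w `^ p) ((- v) `^ p).
  move=> K X Y w1 v1 wp vp Fvw KE.
  have KE2 : K * (X - Y) * ((X - Y) - (w - v) * X) = p * (w1 + v1) * ((X - Y) - (w - v) * X) by rewrite KE.
  by move: Fvw KE2; lra.
by split; rewrite /pgap /pgap1 /chordA /chordB; lra.
Qed.

Lemma bitangentE A B K v w s : bitangent p A B K v w ->
  pgap p A B K s = powf p s - powf p w - powf1 p w * (s - w)
    - K * (expR s - expR w * (1 + (s - w))).
Proof.
case=> _ _ _ []; rewrite /pgap /pgap1 => e0 e1.
have -> : A = powf p w - B * w - K * expR w by lra.
by have -> : B = powf1 p w - K * expR w; lra.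
Qed.

Lemma bitangentEv A B K v w s : bitangent p A B K v w ->
  pgap p A B K s = powf p s - powf p v - powf1 p v * (s - v)
    - K * (expR s - expR v * (1 + (s - v))).
Proof.
case=> _ _ [] + + _; rewrite /pgap /pgap1 => e0 e1.
have -> : A = powf p v - B * v - K * expR v by lra.
by have -> : B = powf1 p v - K * expR v; lra.
Qed.

(** Once w is fixed, only K is free, and it multiplies the positive remainder e^s - e^w (1 + (s -
    w)). Each gap is positive at the left zero of the other, which orders [K1] and [K2] strictly
    both ways. *)
Lemma bitangent_uniq A1 B1 K1 v1 A2 B2 K2 v2 w :
  bitangent p A1 B1 K1 v1 w -> bitangent p A2 B2 K2 v2 w -> v1 = v2.
Proof.
move=> h1 h2; apply/eqP/negP => /negP v12.
case: (h1) => v10 /andP[w0 wq] [g11 _] _; case: (h2) => v20 _ [g22 _] _.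
have h12 : 0 < pgap p A1 B1 K1 v2.
  by apply: (bitangent_gap_gt0 hp h1); [plra|rewrite eq_sym|rewrite lt_eqF//; plra].
have h21 : 0 < pgap p A2 B2 K2 v1.
  by apply: (bitangent_gap_gt0 hp h2) => //; [plra|rewrite lt_eqF//; plra].
have e1 : 0 < expR v1 - expR w * (1 + (v1 - w)).
  by rewrite subr_gt0 expR_gt_tangent// lt_eqF//; plra.
have e2 : 0 < expR v2 - expR w * (1 + (v2 - w)).
  by rewrite subr_gt0 expR_gt_tangent// lt_eqF//; plra.
have K12 : 0 < (K2 - K1) * (expR v2 - expR w * (1 + (v2 - w))).
  by move: h12 g22; rewrite (bitangentE _ h1) (bitangentE _ h2); lra.
have K21 : 0 < (K1 - K2) * (expR v1 - expR w * (1 + (v1 - w))).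
  by move: h21 g11; rewrite (bitangentE _ h1) (bitangentE _ h2); lra.
by move: K12 K21; rewrite !pmulr_lgt0//; lra.
Qed.

Lemma expaff_three (a b k x y z : R) : x < y -> y < z -> 0 <= k ->
  a + b * x + k * expR x <= 0 -> a + b * z + k * expR z < 0 ->
  a + b * y + k * expR y < 0.
Proof.
move=> xy yz k0 hx hz; have xz : 0 < z - x by lra.
pose t := (z - y) / (z - x).
have tE : t * (z - x) = z - y by rewrite /t mulfVK// gt_eqF.
have t0 : 0 < t by rewrite divr_gt0//; lra.
have t1 : t < 1 by rewrite ltr_pdivrMr//; lra.
have yE : y = t * x + (1 - t) * z by lra.
have : expR y <= t * expR x + (1 - t) * expR z.
  by rewrite {1}yE expR_conv// !ltW.
move/(ler_wpM2l k0) => h.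
have h1 : t * (a + b * x + k * expR x) <= 0 by rewrite mulr_ge0_le0// ltW.
have h2 : (1 - t) * (a + b * z + k * expR z) < 0 by rewrite pmulr_rlt0// subr_gt0.
by rewrite {1}yE; lra.
Qed.

(** The difference h of the two gaps has the form a + b s + k e^s, hence is convex or concave. If v1
    < v2, its signs at v1 < v2 < w1 < w2 would alternate -, +, -, +, one change too many. If v1 =
    v2, the values at w1 and w2 give K2 - K1 opposite signs. *)
Lemma bitangent_decr A1 B1 K1 v1 w1 A2 B2 K2 v2 w2 :
  bitangent p A1 B1 K1 v1 w1 -> bitangent p A2 B2 K2 v2 w2 -> w1 < w2 -> v2 < v1.
Proof.
move=> h1 h2 w12; rewrite ltNge; apply/negP => v12.
case: (h1) => v10 /andP[w10 wq1] [g11 _] [g1w _].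
case: (h2) => v20 /andP[w20 wq2] [g22 _] [g2w _].
pose h s := (A2 - A1) + (B2 - B1) * s + (K2 - K1) * expR s.
have hE s : h s = pgap p A1 B1 K1 s - pgap p A2 B2 K2 s by rewrite /h /pgap; lra.
have hw1 : h w1 < 0.
  rewrite hE g1w sub0r oppr_lt0 (bitangent_gap_gt0 hp h2)//; first by plra.
    by rewrite gt_eqF//; plra.
  by rewrite lt_eqF.
have hw2 : 0 < h w2.
  rewrite hE g2w subr0 (bitangent_gap_gt0 hp h1)//; first by plra.
    by rewrite gt_eqF//; plra.
  by rewrite gt_eqF.
have hv1 : h v1 <= 0.
  by rewrite hE g11 sub0r oppr_le0 (bitangent_gap_ge0 hp h2)//; plra.
have hv2 : 0 <= h v2.
  by rewrite hE g22 subr0 (bitangent_gap_ge0 hp h1)//; plra.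
move: v12; rewrite le_eqVlt => /predU1P[v12|v12].
  subst v2; have := hE w1; have := hE w2.
  rewrite !(bitangentEv _ h1) !(bitangentEv _ h2) => e2 e1.
  have p1 : 0 < expR w1 - expR v1 * (1 + (w1 - v1)).
    by rewrite subr_gt0 expR_gt_tangent// gt_eqF//; plra.
  have p2 : 0 < expR w2 - expR v1 * (1 + (w2 - v1)).
    by rewrite subr_gt0 expR_gt_tangent// gt_eqF//; plra.
  have q1 : (K2 - K1) * (expR w1 - expR v1 * (1 + (w1 - v1))) < 0 by lra.
  have q2 : 0 < (K2 - K1) * (expR w2 - expR v1 * (1 + (w2 - v1))) by lra.
  by move: q1 q2; rewrite pmulr_llt0// pmulr_lgt0//; lra.
have [k0|k0] := leP 0 (K2 - K1).
  have v2w1 : v2 < w1 by plra.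
  by have := expaff_three v12 v2w1 k0 hv1 hw1; move: hv2; rewrite /h; lra.
have nk0 : 0 <= - (K2 - K1) by lra.
have v2w1 : v2 < w1 by plra.
have := @expaff_three (- (A2 - A1)) (- (B2 - B1)) (- (K2 - K1)) v2 w1 w2 v2w1 w12 nk0.
by move: hv2 hw2 hw1; rewrite /h => a1 a2 a3 H; have := H _ _; lra.
Qed.

Lemma F_opp_gt0 w : 0 < w -> 0 < F p (- w) w.
Proof.
move=> w0; rewrite /F opprK.
have := sinh_lt w0; have := powR_gt0 (p - 1) w0.
move: (w `^ p) (w `^ (p - 1)) (expR w) (expR (- w)) => a b X Y b0 h.
have h1 : 0 < p * b * (w * (X + Y) - (X - Y)) by rewrite !mulr_gt0//; plra.
by lra.
Qed.

(** Bernoulli's inequality (1 + 1/(p - 1))^(p - 1) >= 2, inverted. *)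
Lemma lambda_powR_le : ((p - 1) / p) `^ (p - 1) <= 2^-1.
Proof.
have p1 : 0 < p - 1 by plra.
have p0 : 0 < p by plra.
have := @bernoulli_powR R (p - 1)^-1 (p - 1).
rewrite invr_ge0 (ltW p1) mulfV ?gt_eqF// => /(_ isT).
have -> : 1 + (p - 1)^-1 = ((p - 1) / p)^-1.
  rewrite invf_div.
  by apply: (@mulIf _ (p - 1)); rewrite ?gt_eqF// mulfVK ?gt_eqF// mulrDl mulVf ?gt_eqF//; lra.
have l0 : 0 < (p - 1) / p by rewrite divr_gt0.
have -> : ((p - 1) / p)^-1 `^ (p - 1) = (((p - 1) / p) `^ (p - 1))^-1.
  by rewrite -powR_inv1 ?(ltW l0)// -powRrM mulN1r powRN.
have P0 := powR_gt0 (p - 1) l0.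
move=> H; have {}H : 2 <= (((p - 1) / p) `^ (p - 1))^-1 by apply: le_trans (H _); plra.
by rewrite -lef_pV2 ?posrE ?invrK// invr_gt0.
Qed.

(** With v = - l w, l = (p - 1)/p and P = l^(p - 1), the factor w^(p - 1) splits off. Second-order
    bounds for the exponentials are enough: the terms of first order in w cancel, and what remains
    is (1 + l) w^2 times a positive constant minus a multiple of w, which is where w < (p - 2)/(3 p)
    enters. *)
Lemma F_lambda_lt0 w : 0 < w < (p - 2) / (3 * p) -> F p (- (w * ((p - 1) / p))) w < 0.
Proof.
move=> /andP[w0 wW]; have p0 : 0 < p by plra.
have := lambda_powR_le; set l := (p - 1) / p; set P := l `^ (p - 1) => P2.
have P0 : 0 <= P by exact: powR_ge0.
pose i := p^-1; have pi : p * i = 1 by rewrite mulfV// gt_eqF.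
have i0 : 0 < i by rewrite invr_gt0.
have lE : l = 1 - i by rewrite /l mulrBl mulfV ?gt_eqF// mul1r.
have i1 : i < 2^-1 by rewrite ltf_pV2 ?posrE.
have l0 : 0 < l by lra.
have w3p : 3 * p * w < p - 2 by move: wW; rewrite ltr_pdivlMr ?mulr_gt0//; lra.
have w3 : w <= 3^-1.
  have : 0 <= p * (3^-1 - w) by lra.
  by rewrite pmulr_rge0// subr_ge0.
have lw0 : 0 <= w * l by rewrite mulr_ge0 ?ltW.
rewrite /F opprK (powRM _ (ltW w0) (ltW l0)) (powRM (p - 1) (ltW w0) (ltW l0)) -/P.
rewrite -(@mulr_powRB1 _ w p (ltW w0) p0) -(@mulr_powRB1 _ l p (ltW l0) p0) -/P.
set w1 := w `^ (p - 1).
have w10 : 0 < w1 by exact: powR_gt0.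
have hX1 := expR_ge2 (ltW w0); have hX2 := expR_le_third (ltW w0) w3.
have hY := expRN_le2 lw0.
move: hX1 hX2 hY; move: (expR w) (expR (- (w * l))) => X Y hX1 hX2 hY.
suff main : 0 < (X - Y) * (p * (1 + P) - w * (1 - l * P)) - p * w * (1 + l) * (Y + P * X).
  by have := mulr_gt0 w10 main; lra.
have lP0 : 0 <= l * P by rewrite mulr_ge0// ltW.
have lP1 : l * P <= 2^-1.
  by apply: le_trans P2; rewrite ler_piMl//; lra.
have m0 : 0 <= p * (1 + P) - w * (1 - l * P).
  have : 0 <= p * P by rewrite mulr_ge0// ltW.
  have : 0 <= w * (l * P) by rewrite mulr_ge0// ltW.
  by plra.
have El : w * (1 + l) * (1 + w * i / 2) <= X - Y.
  by apply: le_trans (lerB hX1 hY); rewrite lE; lra.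
have H1 := ler_wpM2r m0 El.
have H2 : Y + P * X <= 1 - w * l + (w * l) ^+ 2 / 2 + P * (1 + w + 3 / 2 * w ^+ 2).
  by apply: lerD => //; apply: ler_wpM2l.
have pwl : 0 <= p * w * (1 + l) by rewrite !mulr_ge0 ?(ltW p0) ?(ltW w0)//; lra.
have {}H2 := ler_wpM2l pwl H2.
apply: lt_le_trans (lerB H1 H2).
rewrite [X in 0 < X](_ : _ = w * (1 + l) * w * ((p - 3 / 2 - P * (p - 3 / 2 + i))
  - w * (i * (1 - l * P) / 2 + p * l ^+ 2 / 2 + 3 / 2 * p * P))); last first.
  have pl : p * l = p - 1 by rewrite lE; lra.
  have e1 : p * i * (w * (1 + l) * w * (1 + P) / 2) = (w * (1 + l) * w * (1 + P) / 2) by rewrite pi mul1r.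
  have e2 : p * l * (w * (1 + l) * w) = (p - 1) * (w * (1 + l) * w) by rewrite pl.
  have e3 : (1 - i) * (w * (1 + l) * w * P) = l * (w * (1 + l) * w * P) by rewrite lE.
  by lra.
rewrite !mulr_gt0//; first by lra.
have pl2 : p * l ^+ 2 = p - 2 + i.
  have : i * (p * i) = i by rewrite pi mulr1.
  by rewrite lE; lra.
have c2 : i * (1 - l * P) / 2 + p * l ^+ 2 / 2 + 3 / 2 * p * P <= 5 / 4 * p - 1 + i.
  have a1 : 0 <= i * (l * P) by rewrite mulr_ge0// ltW.
  have a2 : p * P <= p * 2^-1 by rewrite ler_wpM2l// ltW.
  by rewrite pl2; lra.
have c1 : (p - 3 / 2) / 2 - i / 2 <= p - 3 / 2 - P * (p - 3 / 2 + i).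
  have : P * (p - 3 / 2 + i) <= 2^-1 * (p - 3 / 2 + i) by rewrite ler_wpM2r//; plra.
  by lra.
have c3 := ler_wpM2l (ltW w0) c2.
suff : w * (5 / 4 * p - 1 + i) < (p - 3 / 2) / 2 - i / 2 by lra.
(* After multiplication by 12 p and the use of 3 p w < p - 2, the claim is (p - 2) (p + 7 - 4/p) >
   0. *)
rewrite -(@ltr_pM2l _ (12 * p)); last by rewrite mulr_gt0.
have -> : 12 * p * ((p - 3 / 2) / 2 - i / 2) = 3 * (p - 2) * (2 * p + 1) by lra.
have -> : 12 * p * (w * (5 / 4 * p - 1 + i)) = 3 * p * w * (5 * p - 4 + 4 * i) by lra.
apply: (@le_lt_trans _ _ ((p - 2) * (5 * p - 4 + 4 * i))).
  by rewrite ler_wpM2r ?ltW//; plra.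
have : 0 < (p - 2) * (p + 7 - 4 * i) by rewrite mulr_gt0//; plra.
by lra.
Qed.
End Cup.

Section Ivt.
Context {R : realType}.

Lemma ivt_root (h : R -> R) (a b : R) : a < b ->
  (forall x, a <= x <= b -> {for x, continuous h}) -> 0 < h a -> h b < 0 ->
  exists2 c, a < c < b & h c = 0.
Proof.
move=> ab hc ha hb.
have [c + hc0] : exists2 c, c \in `[a, b] & h c = 0.
  apply: IVT; first exact: ltW.
    by apply: continuous_in_subspaceT => x /[1!inE]/=; rewrite in_itv/=; exact: hc.
  by rewrite ge_min le_max (ltW hb) (ltW ha) orbT.
rewrite in_itv/= => /andP[ac cb]; exists c => //.
rewrite !lt_neqAle ac cb !andbT; apply/andP; split.
  by apply/eqP => e; move: ha; rewrite e hc0 ltxx.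
by apply/eqP => e; move: hb; rewrite -e hc0 ltxx.
Qed.

End Ivt.

(** * The branch w -> v of the chord equation *)

Section CupRoots.
Context {R : realType}.
Variable p : R.
Hypothesis hp : 2 < p.
Ltac plra := move: hp; lra.
Implicit Types s t v w x : R.

Let p0 : 0 < p. Proof. by plra. Qed.
Let p1 : 0 < p - 1. Proof. by plra. Qed.

Definition wmax : R := (p - 2) / (3 * p).

Lemma wmax_lt : wmax < p - 2.
Proof.
by rewrite /wmax ltr_pdivrMr ?mulr_gt0// ltr_pMr ?subr_gt0//; plra.
Qed.

Lemma wmax_third : wmax < 3^-1.
Proof. by rewrite /wmax ltr_pdivrMr ?mulr_gt0//; plra. Qed.

(* [F] with absolute values, which make it continuous in both variables. *)
Definition absF v w := (expR w - expR v)
    * (`|w| `^ p - `|v| `^ p - p * `|w| `^ (p - 1) - p * `|v| `^ (p - 1))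
  + p * (w - v) * (`|w| `^ (p - 1) * expR v + `|v| `^ (p - 1) * expR w).

Lemma absFE v w : v <= 0 -> 0 <= w -> F p v w = absF v w.
Proof. by move=> v0 w0; rewrite /F /absF (ler0_norm v0) (ger0_norm w0). Qed.

Lemma absF_continuousl w : continuous (absF^~ w).
Proof.
move=> v; rewrite /absF.
have c1 := abspow_continuous p0 (x := v); have c2 := abspow_continuous p1 (x := v).
have c3 := @continuous_expR R v.
apply: cvgD; apply: cvgM.
- by apply: cvgB => //; exact: cvg_cst.
- apply: cvgB; last by apply: cvgM => //; exact: cvg_cst.
  by apply: cvgB; [apply: cvgB => //; exact: cvg_cst|exact: cvg_cst].
- by apply: cvgM; [exact: cvg_cst|apply: cvgB; [exact: cvg_cst|exact: cvg_id]].
- by apply: cvgD; apply: cvgM => //; exact: cvg_cst.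
Qed.

Lemma absF_continuousr v : continuous (absF v).
Proof.
move=> w; rewrite /absF.
have c1 := abspow_continuous p0 (x := w); have c2 := abspow_continuous p1 (x := w).
have c3 := @continuous_expR R w.
apply: cvgD; apply: cvgM.
- by apply: cvgB => //; exact: cvg_cst.
- apply: cvgB; last exact: cvg_cst.
  apply: cvgB; first by apply: cvgB => //; exact: cvg_cst.
  by apply: cvgM => //; exact: cvg_cst.
- by apply: cvgM; [exact: cvg_cst|apply: cvgB; [exact: cvg_id|exact: cvg_cst]].
- by apply: cvgD; apply: cvgM => //; exact: cvg_cst.
Qed.

Lemma lambda_bnd : 0 < (p - 1) / p < 1.
Proof. by rewrite divr_gt0//= ltr_pdivrMr// mul1r; plra. Qed.

Lemma F_root_neg v w : 0 < w -> F_root p v w -> v < 0.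
Proof.
move=> w0 [/andP[_ vw] _]; apply: lt_trans vw _.
by rewrite oppr_lt0 mulr_gt0//; case/andP: lambda_bnd.
Qed.

Lemma absF_ends w : 0 < w < wmax ->
  0 < absF (- w) w /\ absF (- (w * ((p - 1) / p))) w < 0.
Proof.
move=> hw; have /andP[w0 _] := hw; have /andP[l0 l1] := lambda_bnd.
have wl0 : 0 < w * ((p - 1) / p) by rewrite mulr_gt0.
rewrite -!absFE ?oppr_le0 ?(ltW w0) ?(ltW wl0)//.
by split; [exact: F_opp_gt0|exact: F_lambda_lt0].
Qed.

Lemma F_root_ex w : 0 < w < wmax -> exists v, F_root p v w.
Proof.
move=> hw; have [h1 h2] := absF_ends hw; have /andP[w0 _] := hw.
have /andP[l0 l1] := lambda_bnd.
have ab : - w < - (w * ((p - 1) / p)) by rewrite ltrN2 gtr_pMr.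
have [v hv e] := ivt_root ab (fun x _ => @absF_continuousl w x) h1 h2.
exists v; split => //; rewrite absFE ?(ltW w0)//.
case/andP: hv => _ hv; apply/ltW/(lt_trans hv).
by rewrite oppr_lt0 mulr_gt0.
Qed.

Lemma F_root_bitangent v w : 0 < w < wmax -> F_root p v w ->
  bitangent p (chordA p v w) (chordB p v w) (chordK p v w) v w.
Proof.
move=> /andP[w0 wm] h; apply: (F_bitangent hp); first exact: F_root_neg h.
  by rewrite w0 (lt_trans wm)// wmax_lt.
by case: h.
Qed.

Lemma F_root_uniq v1 v2 w : 0 < w < wmax -> F_root p v1 w -> F_root p v2 w ->
  v1 = v2.
Proof.
move=> hw h1 h2.
exact: (bitangent_uniq hp (F_root_bitangent hw h1) (F_root_bitangent hw h2)).
Qed.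

Lemma vFP w : 0 < w < wmax -> F_root p (vF p w) w.
Proof. by move=> hw; have /getPex := F_root_ex hw. Qed.

Lemma vF_bitangent w : 0 < w < wmax ->
  bitangent p (chordA p (vF p w) w) (chordB p (vF p w) w) (D p w) (vF p w) w.
Proof. by move=> hw; apply: F_root_bitangent => //; exact: vFP. Qed.

Lemma vF_decr w1 w2 : 0 < w1 -> w1 < w2 -> w2 < wmax -> vF p w2 < vF p w1.
Proof.
move=> w10 w12 w2m; apply: (bitangent_decr hp _ _ w12); apply: vF_bitangent.
  by rewrite w10 (lt_trans w12).
by rewrite w2m (lt_trans w10).
Qed.

(** An implicit function argument from uniqueness alone: [absF] changes sign between v - d and v + d
    at w0, the signs persist for w near w0, and the root found in between must be [vF p w]. *)
Lemma vF_continuous w0 : 0 < w0 < wmax -> {for w0, continuous (vF p)}.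
Proof.
move=> hw; have /andP[w00 w0m] := hw; have [/andP[v1 v2] Fv] := vFP hw.
have /andP[l0 l1] := lambda_bnd; set l := (p - 1) / p in l0 l1 v2 *.
have v0 := F_root_neg w00 (vFP hw).
have [E1 E2] := absF_ends hw.
set v := vF p w0 in v1 v2 v0 Fv *.
apply/cvgrPdist_lt => e e0.
(* At most half the distance from v to the ends of the search interval, so that v - d and v + d stay
   inside it. *)
pose d := Num.min e (Num.min (v + w0) (- (w0 * l) - v)) / 2.
have m0 : 0 < Num.min e (Num.min (v + w0) (- (w0 * l) - v)).
  by rewrite !lt_min e0/=; apply/andP; split; lra.
have d0 : 0 < d by rewrite divr_gt0.
have de : d < e.
  by apply: (@lt_le_trans _ _ (d * 2)); [lra|rewrite /d mulfVK// ge_min lexx].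
have d1 : - w0 < v - d.
  suff : d * 2 <= v + w0 by lra.
  by rewrite /d mulfVK// !ge_min lexx/= orbT.
have d2 : v + d < - (w0 * l).
  suff : d * 2 <= - (w0 * l) - v by lra.
  by rewrite /d mulfVK// !ge_min lexx/= !orbT.
have wl0 : 0 < w0 * l by rewrite mulr_gt0.
have vE : v = vF p w0 by [].
have lE : l = (p - 1) / p by [].
have root0 x : - w0 < x < - (w0 * l) -> absF x w0 = 0 -> x = v.
  move=> hx e1; apply: (F_root_uniq hw _ (vFP hw)); split => //; rewrite absFE//; last exact: ltW.
  by case/andP: hx => _ /ltW h; apply: le_trans h _; lra.
have S1 : 0 < absF (v - d) w0.
  rewrite ltNge; apply/negP; rewrite le_eqVlt => /predU1P[e1|e1].
    by have := root0 (v - d) _ e1; rewrite d1/= => H; have := H _; lra.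
  have [c hc e2] := ivt_root d1 (fun x _ => @absF_continuousl w0 x) E1 e1.
  by have := root0 c _ e2 => H; have := H _; lra.
have S2 : absF (v + d) w0 < 0.
  rewrite ltNge; apply/negP; rewrite le_eqVlt => /predU1P[e1|e1].
    by have := root0 (v + d) _ (esym e1) => H; have := H _; lra.
  have [c hc e2] := ivt_root d2 (fun x _ => @absF_continuousl w0 x) e1 E2.
  by have := root0 c _ e2 => H; have := H _; lra.
have dv : v - d < v + d by lra.
clearbody d l v.
have N1 : \forall w \near w0, 0 < absF (v - d) w.
  exact: (cvgr_gt _ (@absF_continuousr (v - d) w0)).
have N2 : \forall w \near w0, absF (v + d) w < 0.
  exact: (cvgr_lt _ (@absF_continuousr (v + d) w0)).
near=> w.
have w_0 : 0 < w by near: w; exact: lt_nbhsr.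
have w_m : w < wmax by near: w; exact: lt_nbhsl.
have w_1 : - w < v - d.
  suff : d - v < w by lra.
  by near: w; apply: lt_nbhsr; lra.
have w_2 : v + d < - (w * l).
  suff : w * l < - (v + d) by lra.
  rewrite -ltr_pdivlMr//; near: w; apply: lt_nbhsl.
  by rewrite ltr_pdivlMr//; lra.
have [||||c /andP[c1 c2] e2] := @ivt_root _ (absF^~ w) (v - d) (v + d).
- exact: dv.
- by move=> x _; exact: absF_continuousl.
- by near: w.
- by near: w.
have hww : 0 < w < wmax by rewrite w_0.
have -> : vF p w = c.
  apply: (F_root_uniq hww (vFP hww)); split; first by rewrite -lE (lt_trans w_1 c1) (lt_trans c2 w_2).
  rewrite absFE//; last exact: ltW.
  have wl_0 := mulr_gt0 w_0 l0; apply: (le_trans (ltW (lt_trans c2 w_2))).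
  by rewrite oppr_le0 ltW.
by rewrite -vE ltr_norml; apply/andP; split; have dde := de; move: c1 c2 dde; clear; lra.
Unshelve. all: by end_near. Qed.

Lemma D_continuous w0 : 0 < w0 < wmax -> {for w0, continuous (D p)}.
Proof.
move=> hw; have /andP[w00 w0m] := hw; have vc := vF_continuous hw.
have v0 := F_root_neg w00 (vFP hw).
have cw : (fun w : R => w `^ (p - 1)) w @[w --> w0] --> w0 `^ (p - 1).
  exact: isD_cont (is_derive1_powR (p - 1) w00).
have nv0 : 0 < - vF p w0 by rewrite oppr_gt0.
have cv : (fun w : R => (- vF p w) `^ (p - 1)) w @[w --> w0] --> (- vF p w0) `^ (p - 1).
  have h := isD_cont (is_derive1_powR (p - 1) nv0).
  apply: (@continuous_comp _ _ _ (fun w => - vF p w) (fun t => t `^ (p - 1)) w0 _ h).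
  exact: cvgN.
have ce : expR (vF p w) @[w --> w0] --> expR (vF p w0).
  by apply: (@continuous_comp _ _ _ (vF p) (@expR R) w0 vc); exact: continuous_expR.
rewrite /continuous_at {2}/D.
apply: cvgM; first exact: cvg_cst.
apply: cvgM; first exact: cvgD.
apply: cvgV.
  by rewrite gt_eqF// subr_gt0 ltr_expR (lt_trans v0).
by apply: cvgB => //; exact: continuous_expR.
Qed.

End CupRoots.

(** * Incomplete Gamma integrals *)

Section IncompleteGamma.
Context {R : realType}.
Local Notation mu := (@lebesgue_measure R).
Implicit Types (q x z s : R) (f h : R -> R).

Definition vanishing f := forall e, 0 < e -> exists A : R, forall z, A <= z -> `|f z| < e.

Lemma vanishingP f : f z @[z --> +oo] --> 0 <-> vanishing f.
Proof.
split=> [/cvgrPdist_lt h e e0|h].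
  have [A [_ HA]] := h _ e0; exists (A + 1) => z Az.
  by rewrite -normrN -sub0r HA//; lra.
apply/cvgrPdist_lt => e e0; have [A HA] := h _ e0.
by exists A; split; [exact: num_real|move=> z /ltW Az; rewrite sub0r normrN HA].
Qed.

Lemma vanishingD f h : vanishing f -> vanishing h -> vanishing (fun z => f z + h z).
Proof.
move=> vf vh e e0; have [A HA] := vf _ (divr_gt0 e0 (ltr0Sn _ 1)).
have [B HB] := vh _ (divr_gt0 e0 (ltr0Sn _ 1)).
exists (Num.max A B) => z; rewrite ge_max => /andP[Az Bz].
by apply: le_lt_trans (ler_normD _ _) _; have := HA _ Az; have := HB _ Bz; lra.
Qed.

Lemma vanishingZ k f : vanishing f -> vanishing (fun z => k * f z).
Proof.
move=> vf e e0; have k1 : 0 < `|k| + 1 by rewrite ltr_wpDl.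
have [A HA] := vf _ (divr_gt0 e0 k1); exists A => z Az; rewrite normrM.
have := HA _ Az; rewrite ltr_pdivlMr// => H; apply: le_lt_trans H.
by rewrite mulrC ler_wpM2l// lerDl.
Qed.

Lemma vanishing_le f h (z0 : R) : (forall z, z0 <= z -> `|f z| <= h z) ->
  vanishing h -> vanishing f.
Proof.
move=> fh vh e e0; have [A HA] := vh _ e0; exists (Num.max z0 A) => z.
rewrite ge_max => /andP[z0z Az]; apply: le_lt_trans (fh _ z0z) _.
exact: le_lt_trans (ler_norm _) (HA _ Az).
Qed.

Lemma vanishing_comp_scale f (x : R) : 0 < x -> vanishing f -> vanishing (fun z => f (z / x)).
Proof.
move=> x0 vf e e0; have [A HA] := vf _ e0; exists (A * x) => z Az.
by apply: HA; rewrite ler_pdivlMr.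
Qed.

Lemma vanishing_expRN : vanishing (fun z : R => expR (- z)).
Proof. by apply/vanishingP; exact: cvgr_expR. Qed.

(** Stands in for integration by parts and for substitution in improper integrals: [IG_rec] and
    [IG_scale] reduce to comparing derivatives. *)
Lemma eq_from_infty f h (d : R -> R) z0 : 
  (forall z, z0 <= z -> is_derive z 1 f (d z)) ->
  (forall z, z0 <= z -> is_derive z 1 h (d z)) ->
  vanishing f -> vanishing h -> forall z, z0 <= z -> f z = h z.
Proof.
move=> df dh vf vh z z0z.
have vfh : vanishing (fun z => f z + -1 * h z) by apply: vanishingD => //; exact: vanishingZ.
have cst y : z <= y -> f z - h z = f y - h y.
  move=> zy; have dd x : z <= x <= y -> is_derive x 1 (fun t => f t - h t) 0.
    move=> /andP[zx _]; have z0x := le_trans z0z zx.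
    by apply: (is_derive_eq (isD_add (df _ z0x) (isD_opp (dh _ z0x)))); rewrite subrr.
  apply/eqP; rewrite eq_le; apply/andP; split.
    exact: (@mono_le R (fun t => f t - h t) (fun=> 0) z y zy dd (fun _ _ => lexx 0)).
  rewrite -lerN2.
  apply: (@mono_le R (fun t => - (f t - h t)) (fun=> 0) z y zy _ (fun _ _ => lexx 0)).
  by move=> x /dd dx; apply: (is_derive_eq (isD_opp dx)); rewrite oppr0.
apply/eqP; rewrite -subr_eq0 -normr_le0; apply/ler_addgt0Pr => e e0; rewrite add0r.
have [A HA] := vfh _ e0.
rewrite (cst (Num.max z A)) ?le_max ?lexx//.
have := HA (Num.max z A); rewrite le_max lexx orbT => /(_ isT) /ltW.
by rewrite mulN1r.
Qed.

(** Half of the exponent absorbs the power: t <= e^t at t = s / (2 x q), raised to the power q. *)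
Lemma pow_exp_le q x s : 0 < q -> 0 < x -> 0 <= s ->
  s `^ q * expR (- s / x) <= (2 * x * q) `^ q * expR (- (s / (2 * x))).
Proof.
move=> q0 x0 s0.
have k0 : 0 < 2 * x * q by rewrite !mulr_gt0.
have h1 : s / (2 * x * q) <= expR (s / (2 * x * q)) by have := expR_ge1Dx (s / (2 * x * q)); lra.
have h2 : s <= 2 * x * q * expR (s / (2 * x * q)) by rewrite -ler_pdivrMl// mulrC.
have h3 : s `^ q <= (2 * x * q) `^ q * expR (s / (2 * x)).
  have -> : expR (s / (2 * x)) = expR (s / (2 * x * q)) `^ q.
    rewrite /powR gt_eqF ?expR_gt0// expRK; congr expR.
    rewrite [(2 * x * q)^-1]invfM; set A := (2 * x)^-1.
    have : (q * q^-1) * (s * A) = s * A by rewrite mulfV ?mul1r// gt_eqF.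
    by lra.
  rewrite -powRM ?(ltW k0) ?expR_ge0//.
  apply: ge0_ler_powR; rewrite ?nnegrE ?(ltW q0)//.
  by rewrite mulr_ge0 ?expR_ge0// ltW.
have := ler_wpM2r (expR_ge0 (- s / x)) h3.
move/le_trans; apply; rewrite -[leLHS]mulrA -expRD.
suff -> : s / (2 * x) + - s / x = - (s / (2 * x)) by [].
by rewrite [in LHS]invfM; rewrite [X in _ = - (s * X)]invfM; lra.
Qed.

Lemma vanishing_pow_exp q x : 0 < q -> 0 < x ->
  vanishing (fun z => `|z| `^ q * expR (- z / x)).
Proof.
move=> q0 x0; apply: (@vanishing_le _ (fun z => (2 * x * q) `^ q * expR (- (z / (2 * x)))) 0).
  move=> z z0; rewrite ger0_norm ?mulr_ge0 ?powR_ge0 ?expR_ge0// ger0_norm//.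
  exact: pow_exp_le.
by apply: vanishingZ; apply: (vanishing_comp_scale _ vanishing_expRN); rewrite mulr_gt0.
Qed.

(** The upper incomplete Gamma integral of order q + 1 at scale x. The absolute value makes it
    differentiable on the whole line; [K3] involves it at negative arguments. *)
Definition IG q x z := \int[mu]_(s in `[z, +oo[) (`|s| `^ q * expR (- s / x)).

Let ker_continuous q x : 0 < q -> continuous (fun s : R => `|s| `^ q * expR (- s / x)).
Proof.
move=> q0 s; apply: cvgM; first exact: abspow_continuous.
have h := is_derive_expR (- s / x).
have := isD_cont (isD_expR (isD_mul (isD_opp (isD_id s)) (isD_cst x^-1 s))).
by [].
Qed.

Let ker_ge0 q x s : 0 <= `|s| `^ q * expR (- s / x).
Proof. by rewrite mulr_ge0 ?powR_ge0 ?expR_ge0. Qed.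

Lemma IG_spec q x : 0 < q -> 0 < x ->
  (forall z, is_derive z 1 (IG q x) (- (`|z| `^ q * expR (- z / x)))) /\
  vanishing (IG q x).
Proof.
move=> q0 x0; have hc := @ker_continuous q x q0.
set h := fun s : R => `|s| `^ q * expR (- s / x) in hc.
have [H dH] := continuous_primitive hc.
have Hmono a b : a <= b -> H a <= H b.
  by move=> ab; apply: (mono_le ab (fun x _ => dH x)) => y _; exact: ker_ge0.
have ub : has_ubound (range H).
  (* The bound [pow_exp_le] integrated over the positive half-line; a monotone bounded primitive
     then has a limit l, and the integral is l - H z. *)
  exists (H 0 + (2 * x * q) `^ q * (2 * x)) => _ [z _ <-].
  have M0 : 0 <= (2 * x * q) `^ q * (2 * x) by rewrite mulr_ge0 ?powR_ge0//; lra.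
  have [z0|z0] := leP z 0; first by have := Hmono _ _ z0; lra.
  pose G t := (2 * x * q) `^ q * ((2 * x) * (- expR (- (t / (2 * x))))) - H t.
  have dG (t : R) : is_derive t 1 G ((2 * x * q) `^ q * expR (- (t / (2 * x))) - h t).
    apply: (is_derive_eq (isD_add (isD_mul (isD_cst _ t) (isD_mul (isD_cst _ t) (isD_opp (isD_expR
      (isD_opp (isD_mul (isD_id t) (isD_cst (2 * x)^-1 t))))))) (isD_opp (dH t)))).
    have x2 : 2 * x * (2 * x)^-1 = 1 by rewrite mulfV// gt_eqF// mulr_gt0.
    set e := expR _; set M := _ `^ _; set i := (2 * x)^-1 in x2 *.
    have : (2 * x * i) * (M * e) = M * e by rewrite x2 mul1r.
    by lra.
  have := @mono_le R G _ 0 z (ltW z0) (fun t _ => dG t).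
  have Gz : 0 <= (2 * x * q) `^ q * (2 * x * expR (- (z / (2 * x)))).
    by rewrite !mulr_ge0 ?powR_ge0 ?expR_ge0//; lra.
  rewrite /G mul0r oppr0 expR0.
  suff dG0 t : 0 < t < z -> 0 <= (2 * x * q) `^ q * expR (- (t / (2 * x))) - h t.
    by move/(_ dG0); lra.
  move=> /andP[t0 _].
  by rewrite subr_ge0 /h ger0_norm ?(ltW t0)// pow_exp_le// ltW.
have Hl := nondecreasing_cvgr Hmono ub; set l := sup (range H) in Hl.
have IE z : IG q x z = l - H z.
  apply: (@Rintegral_primitivey _ h H z l) => //.
  - by move=> y _; exact: ker_ge0.
  - exact: (cvg_at_right_filter (hc z)).
  - exact: cvg_at_right_filter (isD_cont (dH z)).
rewrite (_ : IG q x = fun z => l - H z); last by apply/funext.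
split=> [z|].
  by apply: (is_derive_eq (isD_add (isD_cst l z) (isD_opp (dH z)))); rewrite add0r.
apply/vanishingP; rewrite -(subrr l); apply: cvgB => //; exact: cvg_cst.
Qed.

Lemma is_derive_IG q x z : 0 < q -> 0 < x ->
  is_derive z 1 (IG q x) (- (`|z| `^ q * expR (- z / x))).
Proof. by move=> q0 x0; have [] := IG_spec q0 x0. Qed.

Lemma vanishing_IG q x : 0 < q -> 0 < x -> vanishing (IG q x).
Proof. by move=> q0 x0; have [] := IG_spec q0 x0. Qed.

Lemma IG_ge0 q x z : 0 <= IG q x z.
Proof. by apply: Rintegral_ge0 => s _; exact: ker_ge0. Qed.

Lemma IG_decr q x a b : 0 < q -> 0 < x -> 0 <= a -> a < b -> IG q x b < IG q x a.
Proof.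
move=> q0 x0 a0 ab; rewrite -ltrN2.
apply: (mono_lt ab (fun t _ => isD_opp (is_derive_IG t q0 x0))) => t /andP[at_ _].
by rewrite opprK mulr_gt0 ?expR_gt0// powR_gt0// normr_gt0 gt_eqF//; lra.
Qed.

Lemma IG_gt0 q x z : 0 < q -> 0 < x -> 0 <= z -> 0 < IG q x z.
Proof.
move=> q0 x0 z0; apply: le_lt_trans (IG_ge0 q x (z + 1)) _.
by apply: IG_decr => //; rewrite ltrDl.
Qed.

Lemma IG_rec q x z : 0 < q -> 0 < x -> 0 <= z ->
  IG (q + 1) x z = x * (z * `|z| `^ q * expR (- z / x)) + (q + 1) * x * IG q x z.
Proof.
move=> q0 x0; have q10 : 0 < q + 1 by lra.
apply: (@eq_from_infty _ (fun z => x * (z * `|z| `^ q * expR (- z / x)) + (q + 1) * x * IG q x z)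
  (fun z => - (`|z| `^ (q + 1) * expR (- z / x)))).
- by move=> t _; exact: is_derive_IG.
- move=> t t0.
  have h1 := is_derive_spow t q0.
  have h2 := isD_mul (isD_opp (isD_id t)) (isD_cst x^-1 t).
  apply: (is_derive_eq (isD_add (isD_mul (isD_cst x t) (isD_mul h1 (isD_expR h2)))
    (isD_mul (isD_cst _ t) (is_derive_IG t q0 x0)))).
  have -> : `|t| `^ (q + 1) = t * `|t| `^ q.
    by rewrite (ger0_norm t0) -(mulr_powRB1 t0 q10) addrK.
  set e := expR _; set T := `|t| `^ q.
  have : (x * x^-1) * (t * T * e) = t * T * e by rewrite mulfV ?mul1r// gt_eqF.
  by lra.
- exact: vanishing_IG.
- apply: vanishingD; last exact: vanishingZ (vanishing_IG q0 x0).
  apply: vanishingZ; apply: (@vanishing_le _ _ 0 _ (vanishing_pow_exp q10 x0)) => t t0.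
  rewrite ger0_norm ?mulr_ge0 ?powR_ge0 ?expR_ge0//.
  by rewrite (ger0_norm t0) -(mulr_powRB1 t0 q10) addrK; exact: lexx.
Qed.

Lemma IG_scale q x z : 0 < q -> 0 < x -> 0 <= z ->
  IG q x z = x * x `^ q * IG q 1 (z / x).
Proof.
move=> q0 x0; apply: (@eq_from_infty _ (fun z => x * x `^ q * IG q 1 (z / x))
  (fun z => - (`|z| `^ q * expR (- z / x)))).
- by move=> t _; exact: is_derive_IG.
- move=> t t0.
  have h1 : is_derive t 1 (fun u : R => u / x) (1 / x).
    by apply: (is_derive_eq (isD_mul (isD_id t) (isD_cst x^-1 t))); lra.
  have h2 := @is_derive_IG q 1 (t / x) q0 ltr01.
  apply: (is_derive_eq (isD_mul (isD_cst (x * x `^ q) t) (@isD_comp R _ (fun u : R => u / x) t _ _ h2 h1))).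
  have tx0 : 0 <= t / x by rewrite divr_ge0// ltW.
  rewrite (ger0_norm tx0) (ger0_norm t0).
  have -> : t `^ q = (t / x) `^ q * x `^ q.
    by rewrite -powRM ?(ltW x0)// mulfVK// gt_eqF.
  rewrite divr1 -[- (t / x)]mulNr; set e := expR _; set T := (t / x) `^ q; set X := x `^ q.
  have : (x * x^-1) * (X * T * e) = X * T * e by rewrite mulfV ?mul1r// gt_eqF.
  by lra.
- exact: vanishing_IG.
- by apply: vanishingZ; apply: (vanishing_comp_scale x0); exact: vanishing_IG.
Qed.

Lemma GammaE z : 1 < z -> Gamma z = IG (z - 1) 1 0.
Proof.
move=> z1; have q0 : 0 < z - 1 by lra.
rewrite /Gamma /IG /Rintegral; congr fine.
rewrite -integral_itv_obnd_cbnd; last first.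
  apply/measurable_EFinP; apply: open_continuous_measurable_fun => // s _.
  exact: ker_continuous.
apply: eq_integral => s; rewrite inE/= in_itv/= andbT => s0.
by rewrite gtr0_norm// divr1.
Qed.

Lemma Gamma_rec z : 1 < z -> Gamma (z + 1) = z * Gamma z.
Proof.
move=> z1; have q0 : 0 < z - 1 by lra.
rewrite !GammaE//; last by lra.
have -> : z + 1 - 1 = z - 1 + 1 by lra.
by rewrite IG_rec// !mul0r mulr0 add0r subrK mulr1.
Qed.

Lemma Gamma_gt0 z : 1 < z -> 0 < Gamma z.
Proof. by move=> z1; rewrite GammaE// IG_gt0//; lra. Qed.

(** On [1, +oo[ the power is at least 1, and e^-s integrates to e^-1 there. *)
Lemma Gamma_ge z : 1 < z -> expR (- 1) <= Gamma z.
Proof.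
move=> z1; have q0 : 0 < z - 1 by lra.
rewrite GammaE//; apply: le_trans (ltW (IG_decr q0 ltr01 (lexx 0) ltr01)).
rewrite leNgt; apply/negP => lt1.
pose h t := IG (z - 1) 1 t - expR (- t).
have vh : vanishing h.
  have := vanishingD (vanishing_IG q0 ltr01) (vanishingZ (-1) vanishing_expRN).
  by rewrite /h; under eq_fun do rewrite mulN1r.
have e0 : 0 < - h 1 by rewrite /h; lra.
have [A HA] := vh _ e0.
have := HA (Num.max A 1); rewrite le_max lexx => /(_ isT).
suff : h (Num.max A 1) <= h 1 by rewrite ltr_norml => H /andP[]; lra.
have m1 : 1 <= Num.max A 1 by rewrite le_max lexx orbT.
rewrite -lerN2.
pose dh t := `|t| `^ (z - 1) * expR (- t / 1) - expR (- t) :> R.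
apply: (@mono_le _ (fun t => - h t) dh _ _ m1) => t.
  move=> _; apply: (is_derive_eq (isD_opp (isD_add (is_derive_IG t q0 ltr01) (isD_opp (isD_expR (isD_opp (isD_id t))))))).
  by rewrite /dh; lra.
move=> /andP[t1 _]; rewrite /dh divr1 subr_ge0 ler_peMl ?expR_ge0//.
have t0 : 0 <= t by lra.
rewrite (ger0_norm t0).
have := @ge0_ler_powR R (z - 1) (ltW q0) 1 t.
by rewrite powR1 !nnegrE; apply => //; exact: ltW.
Qed.

End IncompleteGamma.

(** * The parameters of the candidate *)

Section Xi.
Context {R : realType}.
Implicit Types C x y t : R.

Lemma expRN_div_incr x y : 0 <= x -> x <= y -> y < 1 ->
  expR (- x) / (1 - x) <= expR (- y) / (1 - y).
Proof.
move=> x0 xy y1.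
rewrite ler_pdivrMr; last by lra.
rewrite mulrAC ler_pdivlMr; last by lra.
have -> : expR (- x) = expR (- y) * expR (y - x) by rewrite -expRD; congr expR; lra.
rewrite -mulrA ler_pM2l ?expR_gt0//.
have h := expR_ge1Dx (x - y).
have h2 : expR (x - y) * expR (y - x) = 1.
  by rewrite -expRD -[RHS]expR0; congr expR; lra.
have h3 : (1 - y) <= expR (x - y) * (1 - x).
  have : (1 - (y - x)) * (1 - x) <= expR (x - y) * (1 - x) by rewrite ler_wpM2r//; lra.
  have : 0 <= x * (y - x) by rewrite mulr_ge0//; lra.
  by lra.
have := ler_wpM2l (expR_ge0 (y - x)) h3.
by move/le_trans; apply; rewrite mulrA [expR (y - x) * expR _]mulrC h2 mul1r.
Qed.

Lemma xi_spec C : 1 < C -> 0 < xi C < 1 /\ expR (- xi C) = C * (1 - xi C).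
Proof.
move=> C1.
pose h t := C * (1 - t) - expR (- t).
have hc : continuous h.
  move=> t; apply: cvgB; first by apply: cvgM; [exact: cvg_cst|apply: cvgB; [exact: cvg_cst|exact: cvg_id]].
  exact: isD_cont (isD_expR (isD_opp (isD_id t))).
have [||z /andP[z0 z1] ez] := @ivt_root R h 0 1 ltr01 (fun x _ => hc x).
- by rewrite /h oppr0 expR0; lra.
- by rewrite /h subrr mulr0 sub0r oppr_lt0 expR_gt0.
have hz : [set t : R | 0 <= t < 1 /\ expR (- t) = C * (1 - t)] z.
  by split; [rewrite (ltW z0)|move: ez; rewrite /h; lra].
have [/andP[]] := getI hz; rewrite -/(xi C) => x0 x1 ex; split => //.
rewrite x1 andbT lt_neqAle x0 andbT eq_sym; apply/eqP => e0.
by move: ex; rewrite e0 oppr0 expR0; lra.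
Qed.

Lemma tail_IG p C w : 0 <= w -> tail p C w = IG (p - 2) (xi C) w.
Proof.
move=> w0; apply: eq_Rintegral => s; rewrite inE/= in_itv/= andbT => ws.
by rewrite ger0_norm// (le_trans w0).
Qed.

Lemma m1_IG p C z : 2 < p -> 0 <= z ->
  m1 p C z = p / xi C * expR (z / xi C) * IG (p - 1) (xi C) z.
Proof.
move=> hp z0; congr (_ * _); apply: eq_Rintegral => s; rewrite inE/= in_itv/= andbT => zs.
have s0 : 0 <= s by exact: le_trans zs.
rewrite (ger0_norm s0); congr (_ * _).
have -> : p - 2 = p - 1 - 1 by lra.
by rewrite mulr_powRB1//; lra.
Qed.

End Xi.

(* Packed so that [done] does not try to unfold [C0 p < C]. *)
Record admissible {R : realType} (p C : R) : Prop :=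
  Admissible { adm_p : 2 < p; adm_C : C0 p < C }.

(** * Consequences of C > C0: the location of wstar and wbar *)

Section AdmissibleParameters.
Context {R : realType}.
#[local] Opaque IG Gamma xi.
Variables p C : R.
Hypothesis H0 : admissible p C.
Ltac plra := move: (adm_p H0); lra.
Implicit Types s t v w x z : R.

Lemma C0_denominator_gt0 : 0 < 3 `^ (p + 2) * Gamma p.
Proof. by rewrite mulr_gt0 ?powR_gt0// Gamma_gt0//; plra. Qed.

Lemma C_gt1 : 1 < C.
Proof.
apply: le_lt_trans (adm_C H0); rewrite /C0 /xi0; set e := _^-1.
have e0 : 0 < e by rewrite invr_gt0 C0_denominator_gt0.
have -> : 1 - (1 - e) = e by lra.
by rewrite ler_pdivlMr// mul1r; have := expR_ge1Dx (- (1 - e)); lra.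
Qed.

Lemma xi_gt0 : 0 < xi C. Proof. by have [/andP[]] := xi_spec C_gt1. Qed.
Lemma xi_lt1 : xi C < 1. Proof. by have [/andP[]] := xi_spec C_gt1. Qed.
Lemma xiE : expR (- xi C) = C * (1 - xi C). Proof. by have [] := xi_spec C_gt1. Qed.

(** C = e^-xi / (1 - xi) is nondecreasing in xi, so C > C0 means xi > xi0. *)
Lemma one_sub_xi_lt : 1 - xi C < (3 `^ (p + 2) * Gamma p)^-1.
Proof.
set e := _^-1; rewrite ltNge; apply/negP => eX.
have e0 : 0 < e by rewrite invr_gt0 C0_denominator_gt0.
have x0 := xi_gt0; have x1 := xi_lt1.
have := @expRN_div_incr R (xi C) (1 - e).
have -> : expR (- xi C) / (1 - xi C) = C by rewrite xiE mulfK// gt_eqF//; lra.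
move=> H; have {}H := H (ltW x0) _ _.
have : C <= expR (- (1 - e)) / (1 - (1 - e)) by apply: H; lra.
by move: (adm_C H0); rewrite /C0 /xi0 -/e; lra.
Qed.

Lemma expR1_le : expR 1 <= 27 / 8 :> R.
Proof.
have h : expR (3^-1 : R) <= 3 / 2.
  by have := @expR_le_third R 3^-1; rewrite invr_ge0 ler0n lexx => /(_ isT isT); lra.
have -> : expR 1 = expR (3^-1) * (expR (3^-1) * expR (3^-1)) :> R.
  by rewrite -!expRD; congr expR; lra.
have e0 := expR_ge0 (3^-1 : R).
have h2 : expR (3^-1) * expR (3^-1) <= 3 / 2 * (3 / 2) :> R by apply: ler_pM.
by apply: le_trans (ler_pM e0 (mulr_ge0 e0 e0) h h2) _; lra.
Qed.

(** 24 = 81 * 8/27, from 3^(p + 2) > 81 and Gamma(p) >= e^-1 >= 8/27. A crude form of the bound on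
    C, sufficient for the slope and length comparisons of the geometry. *)
Lemma inv_one_sub_xi_gt : 24 < (1 - xi C)^-1.
Proof.
have hp := adm_p H0.
have x1 := xi_lt1; have h := one_sub_xi_lt.
have e0 : 0 < 1 - xi C by lra.
have : 3 `^ (p + 2) * Gamma p < (1 - xi C)^-1 by rewrite -ltf_pV2 ?posrE ?invrK ?invr_gt0 ?C0_denominator_gt0.
apply: lt_trans.
have h1 : (81 : R) < 3 `^ (p + 2).
  have -> : 81 = (3 : R) `^ 4 by rewrite (powR_mulrn 4) // -!natrX.
  have -> : p + 2 = 4 + (p - 2) by lra.
  rewrite [ltRHS]powRD ?pnatr_eq0 ?implybT// ltr_pMr ?powR_gt0//.
  rewrite /powR pnatr_eq0/= expR_gt1 mulr_gt0 ?subr_gt0//.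
  by rewrite ln_gt0// ltr1n.
have h2 := @Gamma_ge R p; have {}h2 : expR (- 1) <= Gamma p by apply: h2; plra.
have h3 : (8 / 27 : R) <= expR (- 1).
  have := expR1_le; have e10 := expR_gt0 (1 : R).
  have : expR 1 * expR (- 1) = 1 :> R by rewrite -expRD subrr expR0.
  move=> e1 e2; have := ler_wpM2r (expR_ge0 (- 1 : R)) e2; lra.
have h4 : 81 * (8 / 27) < 3 `^ (p + 2) * Gamma p.
  apply: (@lt_le_trans _ _ (3 `^ (p + 2) * (8 / 27))); first by rewrite ltr_pM2r.
  by rewrite ler_pM2l ?powR_gt0//; lra.
by lra.
Qed.

Definition kappa : R := (xi C)^-1 - 1.

Lemma kappa_gt0 : 0 < kappa.
Proof. by rewrite subr_gt0 invf_gt1 ?xi_gt0// xi_lt1. Qed.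

Lemma inv_xi : (xi C)^-1 = kappa + 1. Proof. by rewrite /kappa; lra. Qed.

(* [K1], [K3] are the coefficients of x2 in the supporting planes of the candidate
   on R1 and R3: both solve K' = kappa (K - g) with g = f'' e^-s, and K3 is the
   solution that takes at vbar the value that K1 takes at wbar. *)
Definition K1 z := kappa * (p * (p - 1)) * expR (kappa * z) * IG (p - 2) (xi C) z.

Lemma is_derive_K1 z : is_derive z 1 K1 (kappa * (K1 z - powg p z)).
Proof.
have q0 : 0 < p - 2 by plra.
have h := is_derive_IG z q0 xi_gt0.
apply: (is_derive_eq (isD_mul (isD_mul (isD_cst (kappa * (p * (p - 1))) z)
  (isD_expR (isD_mul (isD_cst kappa z) (isD_id z)))) h)).
rewrite /K1 /powg /powf2.
have -> : - z / xi C = - (kappa * z) - z by rewrite inv_xi; lra.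
rewrite expRD; have : expR (kappa * z) * expR (- (kappa * z)) = 1 by rewrite -expRD subrr expR0.
set a := expR _; set b := expR _ => ab.
set T := `|z| `^ _; set e := expR (- z).
have : a * b * (kappa * (p * (p - 1)) * T * e) = kappa * (p * (p - 1)) * T * e by rewrite ab mul1r.
by lra.
Qed.

(** Integration by parts. The right side is the slope in x1, along the tangent line at z, of the
    plane with x2-coefficient [K1] (see [plane_tangent]). *)
Lemma m1E z : 0 <= z -> m1 p C z = powf1 p z + K1 z * expR z / kappa.
Proof.
move=> z0; have q0 : 0 < p - 2 by plra.
rewrite (m1_IG C (adm_p H0) z0).
have -> : p - 1 = p - 2 + 1 by lra.
rewrite (IG_rec q0 xi_gt0 z0) /powf1 /K1.
set T := `|z| `^ (p - 2); set I := IG _ _ _.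
have -> : - z / xi C = - (z / xi C) by rewrite mulNr.
have k0 := kappa_gt0.
have kk : kappa * kappa^-1 = 1 by rewrite mulfV// gt_eqF.
have xx : xi C * (xi C)^-1 = 1 by rewrite mulfV// gt_eqF// xi_gt0.
have ee : expR (z / xi C) = expR (kappa * z) * expR z.
  by rewrite -expRD inv_xi; congr expR; lra.
have e1 : expR (z / xi C) * expR (- (z / xi C)) = 1 by rewrite -expRD subrr expR0.
rewrite mulrDr; congr (_ + _).
  set a := expR (z / xi C) in e1 *; set b := expR (- _) in e1 *.
  have : xi C * (xi C)^-1 * (a * b) * (p * (z * T)) = p * (z * T) by rewrite xx e1 !mul1r.
  by lra.
rewrite ee; set a := expR (kappa * z); set b := expR z.
have : xi C * (xi C)^-1 * (p * (p - 1) * a * b * I) = p * (p - 1) * a * b * I by rewrite xx mul1r.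
have : kappa * kappa^-1 * (p * (p - 1) * a * b * I) = p * (p - 1) * a * b * I by rewrite kk mul1r.
by lra.
Qed.

(** The left side of the equation for [wstar]. By [K1_sub_powg], [wstar] is a point where [K1]
    crosses [powg]. *)
Definition K1_gap z := kappa * IG (p - 2) (xi C) z - `|z| `^ (p - 2) * expR (- z / xi C).

Lemma K1_gap_continuous : continuous K1_gap.
Proof.
move=> z; have q0 : 0 < p - 2 by plra.
apply: cvgB.
  apply: cvgM; first exact: cvg_cst.
  exact: (isD_cont (is_derive_IG z q0 xi_gt0)).
apply: cvgM; first exact: abspow_continuous.
exact: (isD_cont (isD_expR (isD_mul (isD_opp (isD_id z)) (isD_cst (xi C)^-1 z)))).
Qed.

Lemma K1_sub_powg z : K1 z - powg p z = p * (p - 1) * expR (kappa * z) * K1_gap z.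
Proof.
rewrite /K1 /powg /powf2 /K1_gap.
have -> : expR (- z) = expR (kappa * z) * expR (- z / xi C).
  by rewrite -expRD inv_xi; congr expR; lra.
by lra.
Qed.

Lemma Gamma_pred : Gamma p = (p - 1) * Gamma (p - 1).
Proof. by rewrite -Gamma_rec ?subrK//; plra. Qed.

Lemma Gamma_p1_gt0 : 0 < Gamma (p - 1). Proof. by apply: Gamma_gt0; plra. Qed.
Lemma powRVK x r : 0 < r -> 0 <= x -> (x `^ r^-1) `^ r = x.
Proof. by move=> r0 x0; rewrite -powRrM mulVf ?gt_eqF// powRr1. Qed.

Lemma IG0E : IG (p - 2) (xi C) 0 = xi C * xi C `^ (p - 2) * Gamma (p - 1).
Proof.
have hp := adm_p H0.
have q0 : 0 < p - 2 by plra.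
rewrite (IG_scale q0 xi_gt0 (lexx 0)) mul0r GammaE; last by plra.
by have -> : p - 1 - 1 = p - 2 by lra.
Qed.

Let b1 := expR 1 * (1 - xi C) * Gamma (p - 1).
Let b2 := 2 * expR 1 * (1 - xi C) * Gamma p.

Lemma xi_compl_gt0 : 0 < 1 - xi C. Proof. by rewrite subr_gt0 xi_lt1. Qed.

Lemma b1_gt0 : 0 < b1. Proof. by rewrite /b1 !mulr_gt0 ?expR_gt0 ?xi_compl_gt0 ?Gamma_p1_gt0. Qed.

Lemma b1_lt_b2 : b1 < b2.
Proof.
have hp := adm_p H0.
have := b1_gt0; rewrite /b2 Gamma_pred; set g := Gamma (p - 1).
have -> : 2 * expR 1 * (1 - xi C) * ((p - 1) * g) = 2 * (p - 1) * b1 by rewrite /b1 -/g; lra.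
by move=> b0; rewrite ltr_pMl//; plra.
Qed.

(** Here the factor 3^(p + 2) of C0 is spent: b2 < 2 e / (81 * 3^(p - 2)), while (3 wmax)^(p - 2) =
    ((p - 2)/p)^(p - 2) >= e^-2, and 2 e^3 <= 81. *)
Lemma b2_lt : b2 < wmax p `^ (p - 2).
Proof.
have hp := adm_p H0.
have q0 : 0 < p - 2 by plra.
have p0 : 0 < p by plra.
have h : (1 - xi C) * (3 `^ (p + 2) * Gamma p) < 1.
  by have := one_sub_xi_lt; rewrite -(ltr_pM2r C0_denominator_gt0) mulVf ?gt_eqF ?C0_denominator_gt0.
have e3 : (3 : R) `^ (p + 2) = 81 * 3 `^ (p - 2).
  have -> : 81 = (3 : R) `^ 4 by rewrite (powR_mulrn 4) // -!natrX.
  by rewrite -powRD ?pnatr_eq0 ?implybT//; congr (_ `^ _); lra.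
have T0 : 0 < 3 `^ (p - 2) :> R by rewrite powR_gt0.
have hb : b2 * (81 * 3 `^ (p - 2)) < 2 * expR 1.
  rewrite -e3.
  have -> : b2 * 3 `^ (p + 2) = 2 * expR 1 * ((1 - xi C) * (3 `^ (p + 2) * Gamma p)) by rewrite /b2; lra.
  by rewrite gtr_pMr// mulr_gt0// expR_gt0.
have wm : 3 * wmax p = (p - 2) / p.
  by rewrite /wmax invfM; lra.
have wm0 : 0 < wmax p by rewrite divr_gt0// mulr_gt0.
have e2 : expR (- 2) <= 3 `^ (p - 2) * wmax p `^ (p - 2).
  rewrite -powRM ?(ltW wm0)// wm.
  have r0 : 0 < (p - 2) / p by rewrite divr_gt0.
  rewrite /powR gt_eqF// ler_expR.
  have : ln (p / (p - 2)) <= 2 / (p - 2).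
    rewrite -ler_expR lnK ?posrE ?divr_gt0//.
    apply: le_trans (expR_ge1Dx _).
    rewrite ler_pdivrMr// mulrDl mul1r divfK ?gt_eqF//; lra.
  have -> : ln (p / (p - 2)) = - ln ((p - 2) / p).
    by rewrite -lnV ?posrE// invf_div.
  move=> H; have := ler_wpM2l (ltW q0) H.
  by rewrite mulrCA divff ?gt_eqF// mulr1; lra.
have e27 := expR1_le.
have ee : expR (- 2) * (expR 1 * expR 1) = 1 :> R.
  by rewrite -!expRD -[RHS]expR0; congr expR; lra.
have E0 := expR_gt0 (1 : R); have F0 := expR_gt0 (- 2 : R).
have c3 : 2 * expR 1 <= 81 * expR (- 2) :> R.
  have h2 : expR 1 * expR 1 <= 27 / 8 * (27 / 8) :> R by apply: ler_pM; rewrite // ltW.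
  have h3 : expR 1 * (expR 1 * expR 1) <= 27 / 8 * (27 / 8 * (27 / 8)) :> R.
    by apply: ler_pM; rewrite ?mulr_ge0// ltW.
  have : 0 <= expR (- 2) * (81 / 2 - expR 1 * (expR 1 * expR 1)) :> R.
    by rewrite mulr_ge0 ?(ltW F0)//; lra.
  have -> : expR (- 2) * (81 / 2 - expR 1 * (expR 1 * expR 1)) = 81 / 2 * expR (- 2) - expR 1 * (expR (- 2) * (expR 1 * expR 1)) :> R by lra.
  by rewrite ee; lra.
rewrite -(@ltr_pM2r _ (81 * 3 `^ (p - 2))) ?mulr_gt0//.
apply: lt_le_trans hb _; apply: le_trans c3 _.
by rewrite mulrCA ler_pM2l// mulrC.
Qed.

Lemma c1_gt0 : 0 < c1 p C.
Proof. by rewrite /c1 mulr_gt0 ?xi_gt0// powR_gt0// b1_gt0. Qed.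

Lemma c1_lt_c2 : c1 p C < c2 p C.
Proof.
have hp := adm_p H0.
have q0 : 0 < p - 2 by plra.
rewrite /c1 /c2 ltr_pM2l ?xi_gt0//; apply: gt0_ltr_powR; rewrite ?invr_gt0 ?nnegrE//.
- exact: ltW b1_gt0.
- exact: ltW (lt_trans b1_gt0 b1_lt_b2).
- exact: b1_lt_b2.
Qed.

Lemma b2_root_lt : b2 `^ (p - 2)^-1 < wmax p.
Proof.
have hp := adm_p H0.
have q0 : 0 < p - 2 by plra.
have wm0 : 0 < wmax p by rewrite divr_gt0// mulr_gt0//; plra.
have -> : wmax p = (wmax p `^ (p - 2)) `^ (p - 2)^-1.
  by rewrite -powRrM mulfV ?gt_eqF// powRr1// ltW.
apply: gt0_ltr_powR; rewrite ?invr_gt0 ?nnegrE ?powR_ge0//.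
  exact: ltW (lt_trans b1_gt0 b1_lt_b2).
exact: b2_lt.
Qed.

Lemma c2_lt_xi : c2 p C < xi C.
Proof.
rewrite /c2 gtr_pMr ?xi_gt0//; apply: lt_trans b2_root_lt _.
by apply: lt_trans (wmax_third (adm_p H0)) _; lra.
Qed.

Lemma c2_lt_wmax : c2 p C < wmax p.
Proof.
apply: le_lt_trans b2_root_lt; rewrite /c2 ger_pMl ?(ltW xi_lt1)//.
by rewrite powR_gt0// (lt_trans b1_gt0 b1_lt_b2).
Qed.

Lemma K1_gap0_gt0 : 0 < K1_gap 0.
Proof.
have hp := adm_p H0.
have q0 : 0 < p - 2 by plra.
rewrite /K1_gap normr0 powR0 ?gt_eqF// mul0r subr0 mulr_gt0 ?kappa_gt0//.
exact: (IG_gt0 q0 xi_gt0 (lexx 0)).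
Qed.

(** The definition of c1 is read off this estimate: the tail integral is replaced by its value at 0,
    which gives Gamma(p - 1), and the factor e pays for e^(-c1/xi) since c1 <= xi. *)
Lemma K1_gap_c1_lt0 : K1_gap (c1 p C) < 0.
Proof.
have hp := adm_p H0.
have q0 : 0 < p - 2 by plra.
have h1 := IG_decr q0 xi_gt0 (lexx 0) c1_gt0.
have x0 := xi_gt0.
rewrite /K1_gap subr_lt0 (ger0_norm (ltW c1_gt0)).
apply: (@lt_le_trans _ _ (kappa * IG (p - 2) (xi C) 0)).
  by rewrite ltr_pM2l ?kappa_gt0.
have cE : c1 p C `^ (p - 2) = xi C `^ (p - 2) * b1.
  by rewrite /c1 powRM ?(ltW x0) ?powR_ge0// powRVK// ltW// b1_gt0.
rewrite cE IG0E /kappa.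
have e1 : 1 <= expR 1 * expR (- c1 p C / xi C).
  rewrite -expRD; apply: (le_trans _ (expR_ge1Dx _)).
  have : c1 p C / xi C <= 1.
    by rewrite ler_pdivrMr// mul1r ltW// (lt_trans c1_lt_c2 c2_lt_xi).
  by rewrite mulNr; lra.
set T := xi C `^ (p - 2); have T0 : 0 < T by rewrite powR_gt0.
have -> : ((xi C)^-1 - 1) * (xi C * T * Gamma (p - 1)) = (1 - xi C) * T * Gamma (p - 1).
  have : (xi C * (xi C)^-1) * (T * Gamma (p - 1)) = T * Gamma (p - 1) by rewrite mulfV ?mul1r// gt_eqF.
  by lra.
rewrite /b1; have /(ler_wpM2l _) := e1.
move=> /(_ ((1 - xi C) * T * Gamma (p - 1))); rewrite mulr1 => H.
apply: le_trans (H _) _; first by rewrite !mulr_ge0// ?(ltW xi_compl_gt0) ?(ltW T0) ?(ltW Gamma_p1_gt0).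
by rewrite le_eqVlt; apply/orP; left; apply/eqP; lra.
Qed.

Lemma wstar_spec : 0 < wstar p C < c1 p C /\ K1_gap (wstar p C) = 0.
Proof.
have [z hz ez] := ivt_root c1_gt0 (fun x _ => @K1_gap_continuous x) K1_gap0_gt0 K1_gap_c1_lt0.
have : [set w : R | 0 < w < c1 p C /\ ((xi C)^-1 - 1) * tail p C w - w `^ (p - 2) * expR (- w / xi C) = 0] z.
  split => //; have z0 : 0 <= z by case/andP: hz => /ltW.
  by rewrite tail_IG//; move: ez; rewrite /K1_gap (ger0_norm z0).
move/getI; rewrite -/(wstar p C) => -[h e]; split => //.
have z0 : 0 <= wstar p C by case/andP: h => /ltW.
by move: e; rewrite tail_IG// /K1_gap (ger0_norm z0).
Qed.

(** The tangent to exp at w and - w < v give e^w - e^v < 2 w e^w; the term (- v)^(p - 1) is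
    dropped. *)
Lemma D_gt v w : 0 < w -> - w < v -> v < 0 -> p / 2 * w `^ (p - 2) * expR (- w) < chordK p v w.
Proof.
have hp := adm_p H0.
move=> w0 wv v0; have p0 : 0 < p by plra.
have E0 : 0 < expR w - expR v by rewrite subr_gt0 ltr_expR (lt_trans v0).
have h : expR w - expR v < 2 * w * expR w.
  have := expR_ge_tangent w v; have := expR_gt0 w => ew h.
  have : 0 < expR w * (w + v) by rewrite mulr_gt0//; lra.
  by lra.
have wE : w `^ (p - 1) = w * w `^ (p - 2).
  have -> : p - 2 = p - 1 - 1 by lra.
  by rewrite mulr_powRB1 ?(ltW w0)//; plra.
have T0 : 0 < w `^ (p - 2) by rewrite powR_gt0.
have V0 : 0 <= (- v) `^ (p - 1) by exact: powR_ge0.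
rewrite /chordK mulrA ltr_pdivlMr// wE.
have e1 : expR w * expR (- w) = 1 by rewrite -expRD subrr expR0.
have F0 := expR_gt0 (- w).
apply: (@lt_le_trans _ _ (p / 2 * w `^ (p - 2) * expR (- w) * (2 * w * expR w))).
  by rewrite ltr_pM2l// !mulr_gt0//; lra.
have -> : p / 2 * w `^ (p - 2) * expR (- w) * (2 * w * expR w) = p * (w * w `^ (p - 2)) * (expR w * expR (- w)) by lra.
by rewrite e1 mulr1 ler_pM2l// lerDl.
Qed.

(** In c2 the factor 2 offsets the 1/2 in [D_gt], Gamma(p) replaces (p - 1) Gamma(p - 1), and e pays
    for the exponentials since c2 <= xi. *)
Lemma K1_c2_lt : K1 (c2 p C) < D p (c2 p C).
Proof.
have hp := adm_p H0.
have q0 : 0 < p - 2 by plra.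
have x0 := xi_gt0; have k0 := kappa_gt0.
have c20 : 0 < c2 p C by exact: lt_trans c1_gt0 c1_lt_c2.
have hw : 0 < c2 p C < wmax p by rewrite c20 c2_lt_wmax.
have [/andP[v1 v2] _] := vFP hp hw.
apply: le_lt_trans (D_gt c20 v1 (F_root_neg (adm_p H0) c20 (vFP (adm_p H0) hw))).
have h1 := ltW (IG_decr q0 xi_gt0 (lexx 0) c20).
have cE : c2 p C `^ (p - 2) = xi C `^ (p - 2) * b2.
  rewrite /c2 powRM ?(ltW x0) ?powR_ge0// powRVK//.
  exact: ltW (lt_trans b1_gt0 b1_lt_b2).
rewrite cE /K1.
apply: (@le_trans _ _ (kappa * (p * (p - 1)) * expR (kappa * c2 p C) * IG (p - 2) (xi C) 0)).
  by rewrite ler_wpM2l// !mulr_ge0 ?expR_ge0 ?(ltW k0)//; plra.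
rewrite IG0E /b2 Gamma_pred.
set T := xi C `^ (p - 2); have T0 : 0 < T by rewrite powR_gt0.
have kx : kappa * xi C = 1 - xi C by rewrite /kappa mulrBl mulVf ?gt_eqF// mul1r.
have -> : kappa * (p * (p - 1)) * expR (kappa * c2 p C) * (xi C * T * Gamma (p - 1)) =
   (p * (p - 1) * T * Gamma (p - 1)) * ((kappa * xi C) * expR (kappa * c2 p C)) by lra.
rewrite kx.
have -> : p / 2 * (T * (2 * expR 1 * (1 - xi C) * ((p - 1) * Gamma (p - 1)))) * expR (- c2 p C) =
  (p * (p - 1) * T * Gamma (p - 1)) * ((1 - xi C) * (expR 1 * expR (- c2 p C))) by lra.
rewrite ler_wpM2l//; first by rewrite !mulr_ge0 ?(ltW T0) ?(ltW Gamma_p1_gt0)//; plra.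
rewrite ler_pM2l ?xi_compl_gt0// -expRD ler_expR.
have : c2 p C / xi C <= 1 by rewrite ler_pdivrMr// mul1r ltW// c2_lt_xi.
by rewrite inv_xi; lra.
Qed.

(** At [wstar] the value of [K1] is [powg], which exceeds [D] by [bitangent_K_lt]; at c2 it is below
    [D]. The intermediate value theorem gives the crossing. *)
Lemma wbar_spec : [/\ 0 < wbar p C, wbar p C < c2 p C & K1 (wbar p C) = D p (wbar p C)].
Proof.
have hp := adm_p H0.
have [/andP[ws0 wsc1] Nws] := wstar_spec.
have wsc2 := lt_trans wsc1 c1_lt_c2.
have c2m := c2_lt_wmax.
have hD w : wstar p C <= w <= c2 p C -> {for w, continuous (fun w => K1 w - D p w)}.
  move=> /andP[h1 h2]; apply: cvgB; first exact: isD_cont (is_derive_K1 w).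
  by apply: (D_continuous (adm_p H0)); rewrite (lt_le_trans ws0)//= (le_lt_trans h2).
have hws : 0 < wstar p C < wmax p by rewrite ws0 (lt_trans wsc2).
have h1 : 0 < K1 (wstar p C) - D p (wstar p C).
  have [_ _] := bitangent_K_lt hp (vF_bitangent (adm_p H0) hws).
  have := K1_sub_powg (wstar p C); rewrite Nws mulr0.
  by lra.
have h2 : K1 (c2 p C) - D p (c2 p C) < 0 by rewrite subr_lt0 K1_c2_lt.
have [z hz ez] := ivt_root wsc2 hD h1 h2.
have zP w : 0 <= w -> ((xi C)^-1 - 1) * p * (p - 1) * expR (w * ((xi C)^-1 - 1)) * tail p C w = K1 w.
  by move=> w0; rewrite (tail_IG p C w0) /K1 /kappa [w * _]mulrC !mulrA.
have : [set w : R | wstar p C < w < c2 p C /\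
    ((xi C)^-1 - 1) * p * (p - 1) * expR (w * ((xi C)^-1 - 1)) * tail p C w
      = D p w] z.
  have z0 : 0 <= z by case/andP: hz => wz _; apply/ltW/(lt_trans ws0 wz).
  by split; [exact: hz|rewrite (zP z z0); apply/eqP; rewrite -subr_eq0 ez].
move/getI; rewrite -/(wbar p C) => -[/andP[a1 a2] e]; have w0 := lt_trans ws0 a1.
by split; [exact: w0|exact: a2|rewrite -e (zP _ (ltW w0))].
Qed.

Lemma wbar_bounds : 0 < wbar p C < wmax p.
Proof. by have [w0 wc _] := wbar_spec; rewrite w0 (lt_trans wc c2_lt_wmax). Qed.

Lemma vbar_root : F_root p (vbar p C) (wbar p C).
Proof. exact: (vFP (adm_p H0) wbar_bounds). Qed.

End AdmissibleParameters.

(** * Tangent lines and chords *)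

Section TangentLines.
Context {R : realType}.
Variable C : R.
Hypothesis C1 : 1 < C.
Ltac clra := move: C1; lra.
Implicit Types s z a b : R.

Let X0 : 0 < xi C. Proof. by have [/andP[]] := xi_spec C1. Qed.
Let X1 : xi C < 1. Proof. by have [/andP[]] := xi_spec C1. Qed.
Let d0 : 0 < 1 - xi C. Proof. by rewrite subr_gt0. Qed.

Lemma C_expR_xi : C * expR (xi C) = (1 - xi C)^-1.
Proof.
have [_ e] := xi_spec C1; apply: (@mulIf _ (1 - xi C)); first by rewrite gt_eqF.
rewrite mulVf ?gt_eqF// mulrAC -e -expRD addNr; exact: expR0.
Qed.

Lemma tangent_lineE z s :
  tangent_line C z s = expR z * (1 + (s - z) / (1 - xi C)).
Proof. by rewrite /tangent_line /k; lra. Qed.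

Lemma tangent_line_top z s :
  tangent_line C z s = C * (expR (z + xi C) * (1 + (s - (z + xi C)))).
Proof.
rewrite tangent_lineE expRD.
have := C_expR_xi; set i := _^-1 => e.
have -> : C * (expR z * expR (xi C) * (1 + (s - (z + xi C)))) =
  expR z * (1 + (s - (z + xi C))) * (C * expR (xi C)) by lra.
rewrite e.
have : (1 - xi C) * i = 1 by rewrite mulfV// gt_eqF.
move=> h; have : expR z * ((1 - xi C) * i) = expR z by rewrite h mulr1.
by lra.
Qed.

Lemma tangent_line_le_upper z s : tangent_line C z s <= C * expR s.
Proof.
rewrite tangent_line_top ler_pM2l; last by clra.
exact: expR_ge_tangent.
Qed.

Lemma tangent_line_at_top z : tangent_line C z (z + xi C) = C * expR (z + xi C).
Proof. by rewrite tangent_line_top subrr addr0 mulr1. Qed.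

Lemma tangent_line_id z : tangent_line C z z = expR z.
Proof. by rewrite tangent_lineE subrr mul0r addr0 mulr1. Qed.

Lemma tangent_line_le_lower z s : s <= z -> tangent_line C z s <= expR s.
Proof.
move=> sz; apply: le_trans (expR_ge_tangent z s).
rewrite tangent_lineE ler_pM2l ?expR_gt0// lerD2l.
have i1 : 1 <= (1 - xi C)^-1 by rewrite invf_ge1//; move: X0; lra.
have : 0 <= ((1 - xi C)^-1 - 1) * (z - s) by rewrite mulr_ge0// subr_ge0.
by lra.
Qed.

(** A distance, larger than xi, up to which the lower boundary stays below its secant continued
    along the tangent line. It is explicit because e^hstar = 1/(1 - xi): there the line has height 1
    + hstar/(1 - xi) > 1/(1 - xi), and convexity covers the points before. *)
Definition hstar : R := - ln (1 - xi C).

Lemma hstar_gt : xi C < hstar.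
Proof.
rewrite /hstar; suff : ln (1 - xi C) < - xi C by lra.
rewrite -ltr_expR lnK ?posrE//.
have := @expR_gt1Dx R (- xi C); rewrite oppr_eq0 gt_eqF// => /(_ isT); lra.
Qed.

Lemma lower_le_tangent_line z s : z <= s -> s <= z + hstar ->
  expR s <= tangent_line C z s.
Proof.
move=> zs sz; rewrite tangent_lineE.
have h0 : 0 < hstar by apply: lt_trans X0 hstar_gt.
pose t := (s - z) / hstar.
have tE : t * hstar = s - z by rewrite /t mulfVK// gt_eqF.
have t01 : 0 <= t <= 1.
  by rewrite divr_ge0 ?(ltW h0)//= ?subr_ge0// ler_pdivrMr// mul1r; lra.
have -> : expR s = expR z * expR (t * hstar + (1 - t) * 0).
  by rewrite -expRD; congr expR; rewrite tE; lra.
rewrite ler_pM2l ?expR_gt0//; apply: le_trans (expR_conv hstar 0 t01) _.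
rewrite expR0 mulr1 /hstar expRN lnK ?posrE// -/hstar -tE.
set i := _^-1; have i1 : (1 - xi C) * i = 1 by rewrite mulfV// gt_eqF.
have i0 : 0 < i by rewrite invr_gt0.
have : 0 <= t * i * (hstar - xi C).
  have /andP[t0 _] := t01; apply: mulr_ge0; first exact: (mulr_ge0 t0 (ltW i0)).
  by rewrite subr_ge0 ltW// hstar_gt.
have : t * ((1 - xi C) * i) = t by rewrite i1 mulr1.
by lra.
Qed.

Lemma is_derive_tangent_line s z :
  is_derive z 1 (fun z => tangent_line C z s)
    (expR z * (s - z - xi C) / (1 - xi C)).
Proof.
rewrite (_ : (fun _ => _) = fun z => expR z * (1 + (s - z) * (1 - xi C)^-1)); last first.
  by apply/funext => t; rewrite tangent_lineE.
apply: (is_derive_eq (isD_mul (is_derive_expR z) (isD_add (isD_cst 1 z) (isD_mul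
  (isD_add (isD_cst s z) (isD_opp (isD_id z))) (isD_cst (1 - xi C)^-1 z))))).
set i := _^-1; have i1 : (1 - xi C) * i = 1 by rewrite mulfV// gt_eqF.
have : expR z * ((1 - xi C) * i) = expR z by rewrite i1 mulr1.
by lra.
Qed.

(** As z grows, T_z(s) rises until z = s - xi, where the line touches the upper boundary above s,
    and falls afterwards. On the falling branch [u] is a coordinate: lying above or below T_z
    amounts to comparing [u] with z. *)
Lemma tangent_line_decr s a b : s - xi C <= a -> a < b ->
  tangent_line C b s < tangent_line C a s.
Proof.
move=> sa ab; rewrite -ltrN2.
apply: (mono_lt ab (fun z _ => isD_opp (is_derive_tangent_line s z))) => z /andP[az zb].
rewrite oppr_gt0 pmulr_llt0 ?invr_gt0// pmulr_rlt0 ?expR_gt0//; lra.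
Qed.

Lemma tangent_line_incr s a b : a <= b -> b <= s - xi C ->
  tangent_line C a s <= tangent_line C b s.
Proof.
move=> ab bs.
apply: (mono_le ab (fun z _ => is_derive_tangent_line s z)) => z /andP[az zb].
by rewrite mulr_ge0 ?invr_ge0 ?(ltW d0)// mulr_ge0 ?expR_ge0//; lra.
Qed.

Lemma tangent_line_continuous s : continuous (fun z => tangent_line C z s).
Proof. by move=> z; exact: isD_cont (is_derive_tangent_line s z). Qed.

Lemma u_spec (x : R * R) : Omega C x ->
  tangent_line C (u C x) x.1 = x.2 /\ u C x <= x.1 <= u C x + xi C.
Proof.
move=> /andP[x1 x2].
have [z hz ez] : exists2 z, z \in `[x.1 - xi C, x.1] & tangent_line C z x.1 = x.2.
  apply: IVT; first by move: X0; lra.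
    by apply: continuous_subspaceT; exact: tangent_line_continuous.
  have e : tangent_line C (x.1 - xi C) x.1 = C * expR x.1.
    by have := tangent_line_at_top (x.1 - xi C); rewrite subrK.
  by rewrite e tangent_line_id ge_min le_max x1 x2 orbT.
have : [set z : R | x.2 = k C z * (x.1 - z) + expR z /\ z <= x.1 <= z + xi C] z.
  split; first by rewrite -ez.
  by move: hz; rewrite in_itv/= => /andP[h1 h2]; rewrite h2/=; lra.
by move/getI => -[e1 e2]; split => //; rewrite /tangent_line.
Qed.

Lemma tangent_line_le_of_u (y : R * R) z : Omega C y -> u C y <= z ->
  tangent_line C z y.1 <= y.2.
Proof.
move=> oy; have [<- /andP[h1 h2]] := u_spec oy.
rewrite le_eqVlt => /predU1P[->//|uz].
by apply/ltW/tangent_line_decr => //; lra.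
Qed.

Lemma le_tangent_line_of_u (y : R * R) z : Omega C y -> z <= u C y ->
  y.1 - xi C <= z -> y.2 <= tangent_line C z y.1.
Proof.
move=> oy; have [<- /andP[h1 h2]] := u_spec oy.
rewrite le_eqVlt => /predU1P[->//|uz] h.
by apply/ltW/tangent_line_decr.
Qed.

Lemma u_le_of_tangent_line (y : R * R) z : Omega C y -> tangent_line C z y.1 <= y.2 ->
  y.1 <= z + xi C -> u C y <= z.
Proof.
move=> oy; have [<- /andP[h1 h2]] := u_spec oy => h h3.
rewrite leNgt; apply/negP => zu.
by have := @tangent_line_decr y.1 z (u C y) _ zu => H; have := H _; lra.
Qed.

Lemma le_u_of_tangent_line (y : R * R) z : Omega C y -> y.2 <= tangent_line C z y.1 ->
  z <= y.1 -> z <= u C y.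
Proof.
move=> oy; have [<- /andP[h1 h2]] := u_spec oy => h h3.
rewrite leNgt; apply/negP => uz.
by have := @tangent_line_decr y.1 (u C y) z _ uz => H; have := H _; lra.
Qed.

End TangentLines.

(** * Chords of the lower boundary *)

Section Chords.
Context {R : realType}.
Implicit Types v w s : R.

Lemma chord_lineE v w s : v < w ->
  chord_line v w s = ((w - s) / (w - v)) * expR v + (1 - (w - s) / (w - v)) * expR w.
Proof.
move=> vw; rewrite /chord_line /r.
set i := (w - v)^-1; have i1 : (w - v) * i = 1 by rewrite mulfV// gt_eqF// subr_gt0.
by lra.
Qed.

Lemma chord_linel v w : v < w -> chord_line v w v = expR v.
Proof. by move=> vw; rewrite chord_lineE// divff ?gt_eqF ?subr_gt0//; lra. Qed.

Lemma chord_liner v w : chord_line v w w = expR w.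
Proof. by rewrite /chord_line subrr mulr0 add0r. Qed.

Lemma lower_le_chord_line v w s : v < w -> v <= s <= w -> expR s <= chord_line v w s.
Proof.
move=> vw /andP[vs sw]; rewrite chord_lineE//; set t := _ / _.
have w0 : 0 < w - v by rewrite subr_gt0.
have tE : t * (w - v) = w - s by rewrite /t mulfVK// gt_eqF.
have t01 : 0 <= t <= 1.
  by rewrite divr_ge0 ?subr_ge0 ?(ltW vw)//= ler_pdivrMr// mul1r; lra.
have {1}-> : s = t * v + (1 - t) * w by lra.
exact: expR_conv.
Qed.

Lemma expR_conv_lt (t a b : R) : 0 < t < 1 -> a != b ->
  expR (t * a + (1 - t) * b) < t * expR a + (1 - t) * expR b.
Proof.
move=> /andP[t0 t1] ab; set m := t * a + (1 - t) * b.
have ma : a != m.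
  apply/eqP => e; have : (1 - t) * (a - b) = 0 by move: e; rewrite /m; lra.
  by move/eqP; rewrite mulf_eq0 !subr_eq0 (negbTE ab) orbF gt_eqF.
have ha := expR_gt_tangent ma; have hb := expR_ge_tangent m b.
have {}ha : t * (expR m * (1 + (a - m))) < t * expR a by rewrite ltr_pM2l.
have {}hb : (1 - t) * (expR m * (1 + (b - m))) <= (1 - t) * expR b.
  by rewrite ler_wpM2l ?subr_ge0// ltW.
apply: le_lt_trans (ltr_leD ha hb); rewrite le_eqVlt; apply/orP; left; apply/eqP.
by move: (expR m) => E; rewrite /m; lra.
Qed.

Lemma chord_line_lt_lower v w s : v < w -> (s < v) || (w < s) ->
  chord_line v w s < expR s.
Proof.
move=> vw hs; rewrite ltNge; apply/negP => hge.
have aff a b (t : R) : chord_line v w (t * a + (1 - t) * b) =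
    t * chord_line v w a + (1 - t) * chord_line v w b by rewrite /chord_line; lra.
have key a b c : a < b -> b < c -> expR a <= chord_line v w a ->
    expR c <= chord_line v w c -> chord_line v w b <= expR b -> False.
  move=> ab bc ha hc; have ac : 0 < c - a by lra.
  pose t := (c - b) / (c - a).
  have tE : t * (c - a) = c - b by rewrite /t mulfVK// gt_eqF.
  have t0 : 0 < t by rewrite divr_gt0//; lra.
  have t1 : t < 1 by rewrite ltr_pdivrMr//; lra.
  have -> : b = t * a + (1 - t) * c by lra.
  rewrite aff; have := @expR_conv_lt t a c; rewrite t0 t1 lt_eqF; last by lra.
  move=> /(_ isT isT); have := ler_wpM2l (ltW t0) ha.
  have t2 : 0 <= 1 - t by lra.
  by have := ler_wpM2l t2 hc; lra.
case/orP: hs => hs.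
  by apply: (key s v w hs vw hge); rewrite ?chord_linel ?chord_liner.
by apply: (key v w s vw hs _ hge); rewrite ?chord_linel ?chord_liner.
Qed.

End Chords.

(** * The chain of supporting planes *)

Section Glue.
Context {R : realType}.

Lemma glue_le (h : R -> R) (V W a b : R) : V < W -> a <= b ->
  (forall x y, a <= x -> x <= y -> y <= b -> y <= V -> h x <= h y) ->
  (forall x y, a <= x -> x <= y -> y <= b -> V <= x -> y <= W -> h x <= h y) ->
  (forall x y, a <= x -> x <= y -> y <= b -> W <= x -> h x <= h y) ->
  h a <= h b.
Proof.
move=> VW ab h1 h2 h3.
have h23 x : a <= x -> x <= b -> V <= x -> h x <= h b.
  move=> ax xb Vx; have [bW|Wb] := leP b W; first by apply: h2.
  have [xW|Wx] := leP x W; last by apply: h3 => //; exact: ltW.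
  by apply: le_trans (h2 x W _ _ _ _ _) (h3 W b _ _ _ _) => //; rewrite ?(ltW Wb)// (le_trans ax).
have [bV|Vb] := leP b V; first exact: h1.
have [aV|Va] := leP a V; last by apply: h23 => //; exact: ltW.
by apply: le_trans (h1 a V _ _ _ _) (h23 V _ _ _) => //; exact: ltW.
Qed.

End Glue.

Section BarPlane.
Context {R : realType}.
Variables p C : R.
Hypothesis H0 : admissible p C.
Implicit Types s t z a b : R.
Implicit Types y x : R * R.

Lemma bar_bitangent : exists A B, bitangent p A B (D p (wbar p C)) (vbar p C) (wbar p C).
Proof.
have h := vF_bitangent (adm_p H0) (wbar_bounds H0).
by exists (chordA p (vF p (wbar p C)) (wbar p C)), (chordB p (vF p (wbar p C)) (wbar p C)).
Qed.

End BarPlane.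

(** * Bounds for the coefficient K and monotonicity of the planes in z *)

Section Chain.
Context {R : realType}.
#[local] Opaque IG Gamma xi wbar vbar wstar vF m1 m3 D.
Variables p C : R.
Hypothesis H0 : admissible p C.
Implicit Types s t z a b K : R.
Implicit Types y x : R * R.
Local Notation V := (vbar p C).
Local Notation W := (wbar p C).
Local Notation Kb := (D p (wbar p C)).

Lemma V_lt0 : V < 0. Proof. by have [A [B []]] := bar_bitangent H0. Qed.
Lemma W_gt0 : 0 < W. Proof. by have [A [B [_ /andP[]]]] := bar_bitangent H0. Qed.
Lemma W_lt_q : W < p - 2. Proof. by have [A [B [_ /andP[]]]] := bar_bitangent H0. Qed.
Lemma VW : V < W. Proof. exact: lt_trans V_lt0 W_gt0. Qed.

Lemma Kb_facts : [/\ 0 < Kb, Kb < powg p V & Kb < powg p W].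
Proof. by have [A [B /(bitangent_K_lt (adm_p H0))]] := bar_bitangent H0. Qed.

Lemma K1_W : K1 p C W = Kb. Proof. by have [] := wbar_spec H0. Qed.

Definition K3 z := K1 p C z + expR (kappa C * (z - V)) * (Kb - K1 p C V).

Lemma K3_V : K3 V = Kb.
Proof. by rewrite /K3 subrr mulr0 expR0; lra. Qed.

Lemma is_derive_K3 z : is_derive z 1 K3 (kappa C * (K3 z - powg p z)).
Proof.
apply: (is_derive_eq (isD_add (is_derive_K1 H0 z) (isD_mul (isD_expR (isD_mul (isD_cst (kappa C) z)
  (isD_add (isD_id z) (isD_cst (- V) z)))) (isD_cst (Kb - K1 p C V) z)))).
by rewrite /K3; lra.
Qed.

(* Comparison with the constant [c] in the linear equation [K' = kappa (K - g)]. *)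
Lemma is_derive_damped (Kf : R -> R) c t :
  is_derive t 1 Kf (kappa C * (Kf t - powg p t)) ->
  is_derive t 1 (fun t => (Kf t - c) * expR (- (kappa C * t)))
    (kappa C * (c - powg p t) * expR (- (kappa C * t))).
Proof.
move=> dK.
apply: (is_derive_eq (isD_mul (isD_add dK (isD_cst (- c) t)) (isD_expR (isD_opp
  (isD_mul (isD_cst (kappa C) t) (isD_id t)))))).
by lra.
Qed.

(** Up to p - 2, [powg] increases, and comparison with the constant [powg p W] keeps [K1] below it.
    Past p - 2, [powg] decreases; if [K1] exceeded it at z, the damped difference J would be
    positive at z and nondecreasing from there on, although it vanishes at infinity. *)
Lemma K1_le_g z : W <= z -> K1 p C z <= powg p z.
Proof.
move=> Wz; have hp := adm_p H0; have k0 := kappa_gt0 H0; have w0 := W_gt0.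
have [_ _ Kw] := Kb_facts.
have [zq|qz] := leP z (p - 2).
  have : (K1 p C z - powg p W) * expR (- (kappa C * z)) <= 0.
    apply: (@le_trans _ _ ((K1 p C W - powg p W) * expR (- (kappa C * W)))); last first.
      by rewrite mulr_le0_ge0 ?expR_ge0// K1_W subr_le0 ltW.
    rewrite -lerN2; apply: (mono_le Wz (fun t _ => isD_opp (is_derive_damped _ (is_derive_K1 H0 t)))).
    move=> t /andP[Wt tz]; rewrite oppr_ge0 mulr_le0_ge0 ?expR_ge0//.
    rewrite mulr_ge0_le0 ?(ltW k0)// subr_le0 ltW//.
    by apply: powg_incr => //; [exact: ltW|exact: le_trans (ltW tz) zq].
  rewrite pmulr_lle0 ?expR_gt0// subr_le0 => /le_trans; apply.
  move: Wz; rewrite le_eqVlt => /predU1P[->//|Wz].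
  by apply/ltW/powg_incr => //; exact: ltW.
rewrite leNgt; apply/negP => gK.
have z0 : 0 < z by exact: lt_le_trans w0 Wz.
pose J t := (K1 p C t - powg p z) * expR (- (kappa C * t)).
have vJ : vanishing J.
  have q0 : 0 < p - 2 by rewrite subr_gt0.
  have v1 := vanishingZ (kappa C * (p * (p - 1))) (vanishing_IG q0 (xi_gt0 H0)).
  have kV : 0 < (kappa C)^-1 by rewrite invr_gt0.
  have v2 := vanishingZ (- powg p z) (vanishing_comp_scale kV (@vanishing_expRN R)).
  have := vanishingD v1 v2; congr vanishing; apply/funext => t.
  rewrite /J /K1 invrK [t * _]mulrC.
  have e1 : expR (kappa C * t) * expR (- (kappa C * t)) = 1 by rewrite -expRD subrr expR0.
  move: e1; set a := expR (kappa C * t); set b := expR (- _) => e1.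
  set I := IG _ _ _.
  have : kappa C * (p * (p - 1)) * I * (a * b) = kappa C * (p * (p - 1)) * I by rewrite e1 mulr1.
  by lra.
have J0 : 0 < J z by rewrite mulr_gt0 ?expR_gt0// subr_gt0.
have [A HA] := vJ _ J0.
have zm : z <= Num.max A z by rewrite le_max lexx orbT.
have : J z <= J (Num.max A z).
  apply: (mono_le zm (fun t _ => is_derive_damped _ (is_derive_K1 H0 t))) => t /andP[zt _].
  rewrite mulr_ge0 ?expR_ge0// mulr_ge0 ?(ltW k0)// subr_ge0.
  by apply: powg_decr2 => //; exact: ltW.
have := HA (Num.max A z); rewrite le_max lexx => /(_ isT).
by rewrite ltr_norml => /andP[_]; lra.
Qed.

(** The comparison runs leftwards from V, against the constant [powg p z], the largest value of
    [powg] on [z, V]. *)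
Lemma K3_le_g z : z <= V -> K3 z <= powg p z.
Proof.
move=> zV; have k0 := kappa_gt0 H0; have [_ Kv _] := Kb_facts.
have : (K3 z - powg p z) * expR (- (kappa C * z)) <= 0.
  apply: (@le_trans _ _ ((K3 V - powg p z) * expR (- (kappa C * V)))).
    apply: (mono_le zV (fun t _ => is_derive_damped _ (is_derive_K3 t))) => t /andP[zt tV].
    rewrite mulr_ge0 ?expR_ge0// mulr_ge0 ?(ltW k0)// subr_ge0 ltW//.
    apply: (powg_decr (adm_p H0)) => //; apply/ltW/(lt_trans tV); exact: V_lt0.
  rewrite mulr_le0_ge0 ?expR_ge0// K3_V subr_le0.
  move: zV; rewrite le_eqVlt => /predU1P[->|zV]; first exact: ltW.
  by apply/ltW/(lt_trans Kv)/(powg_decr (adm_p H0) zV)/ltW/V_lt0.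
by rewrite pmulr_lle0 ?expR_gt0// subr_le0.
Qed.

Lemma K1_ge0 z : 0 <= K1 p C z.
Proof.
have hp := adm_p H0.
by rewrite /K1 !mulr_ge0 ?IG_ge0 ?expR_ge0 ?(ltW (kappa_gt0 H0))//; lra.
Qed.

(** Up to positive factors, [K3] is the sum of [Kb] and of the incomplete Gamma integral over
    [z, V]. *)
Lemma K3_ge0 z : z <= V -> 0 <= K3 z.
Proof.
move=> zV; have hp := adm_p H0; have [Kb0 _ _] := Kb_facts.
have x0 := xi_gt0 H0; have q0 : 0 < p - 2 by rewrite subr_gt0.
have hI : IG (p - 2) (xi C) V <= IG (p - 2) (xi C) z.
  rewrite -lerN2.
  apply: (mono_le zV (fun t _ => isD_opp (is_derive_IG t q0 x0))) => t _.
  by rewrite opprK mulr_ge0 ?powR_ge0 ?expR_ge0.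
have e1 : expR (kappa C * (z - V)) * K1 p C V =
    kappa C * (p * (p - 1)) * expR (kappa C * z) * IG (p - 2) (xi C) V.
  have : expR (kappa C * (z - V)) * expR (kappa C * V) = expR (kappa C * z).
    by rewrite -expRD; congr expR; lra.
  by rewrite /K1 => <-; lra.
have c0 : 0 <= kappa C * (p * (p - 1)) * expR (kappa C * z).
  by rewrite !mulr_ge0 ?expR_ge0 ?(ltW (kappa_gt0 H0))//; lra.
have h2 := ler_wpM2l c0 hI.
have h3 : 0 <= expR (kappa C * (z - V)) * Kb by rewrite mulr_ge0 ?expR_ge0// ltW.
have ez : K1 p C z = kappa C * (p * (p - 1)) * expR (kappa C * z) * IG (p - 2) (xi C) z by [].
by rewrite /K3 ez; lra.
Qed.

(* The affine function with x2-coefficient [K] that touches |s|^p at [s = z]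
   along the lower boundary. *)
Definition plane z K y :=
  powf p z + powf1 p z * (y.1 - z) + K * (y.2 - expR z * (1 + (y.1 - z))).

Lemma kappa_compl : kappa C * (1 - xi C)^-1 = kappa C + 1.
Proof.
have x0 := xi_gt0 H0; have x1 := xi_lt1 H0.
apply: (@mulIf _ (1 - xi C)); first by rewrite gt_eqF// subr_gt0.
rewrite mulfVK; last by rewrite gt_eqF// subr_gt0.
have : xi C * (xi C)^-1 = 1 by rewrite mulfV// gt_eqF.
by rewrite /kappa; lra.
Qed.

(** The equation for K is exactly what makes this derivative a multiple of y2 - T_z(y1): to first
    order, moving z does not change the plane along T_z. *)
Lemma is_derive_plane (Kf : R -> R) y z :
  is_derive z 1 Kf (kappa C * (Kf z - powg p z)) ->
  is_derive z 1 (fun z => plane z (Kf z) y)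
    (kappa C * (Kf z - powg p z) * (y.2 - tangent_line C z y.1)).
Proof.
move=> dK; have hp := adm_p H0.
have d1 : is_derive z 1 (fun z => y.1 - z) (0 - 1) := isD_add (isD_cst y.1 z) (isD_opp (isD_id z)).
apply: (is_derive_eq (isD_add (isD_add (is_derive_powf hp z) (isD_mul (is_derive_powf1 hp z) d1))
  (isD_mul dK (isD_add (isD_cst y.2 z) (isD_opp (isD_mul (is_derive_expR z)
    (isD_add (isD_cst 1 z) d1))))))).
rewrite (tangent_lineE C) -powg_expR.
have := kappa_compl; set i := _^-1 => ki.
set e := expR z; set g := powg p z; set K := Kf z.
have : kappa C * i * ((K - g) * (e * (y.1 - z))) = (kappa C + 1) * ((K - g) * (e * (y.1 - z))) by rewrite ki.
by lra.
Qed.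

Definition chain z y := if z <= V then plane z (K3 z) y
  else if z <= W then plane W Kb y else plane z (K1 p C z) y.

Lemma plane_VW y : plane V Kb y = plane W Kb y.
Proof.
have [A [B h]] := bar_bitangent H0; case: h => _ _ [] + + [].
rewrite /pgap /pgap1 /plane => v0 v1 w0 w1.
have -> : powf p V = A + B * V + Kb * expR V by lra.
have -> : powf p W = A + B * W + Kb * expR W by lra.
have -> : powf1 p V = B + Kb * expR V by lra.
by have -> : powf1 p W = B + Kb * expR W; lra.
Qed.

Lemma chain_left z y : z <= V -> chain z y = plane z (K3 z) y.
Proof. by rewrite /chain => ->. Qed.

Lemma chain_mid z y : V <= z -> z <= W -> chain z y = plane W Kb y.
Proof.
rewrite le_eqVlt => /predU1P[<- _|Vz zW]; first by rewrite chain_left// K3_V plane_VW.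
by rewrite /chain leNgt Vz/= zW.
Qed.

Lemma chain_right z y : W <= z -> chain z y = plane z (K1 p C z) y.
Proof.
rewrite le_eqVlt => /predU1P[<-|Wz]; first by rewrite chain_mid// ?K1_W// ltW// VW.
by rewrite /chain leNgt (lt_trans VW Wz)/= leNgt Wz.
Qed.

(** One statement for three uses: sg = 1 and sg = -1 with M = 0 give the two monotonicity lemmas
    below, and M > 0 admits a derivative of the wrong sign but bounded size, as in [chain_near]. *)
Lemma chain_slope (sg M : R) y a b : 0 <= M -> a <= b ->
  (forall z K, a <= z <= b -> 0 <= K <= powg p z ->
    0 <= sg * (kappa C * (K - powg p z) * (y.2 - tangent_line C z y.1)) + M) ->
  sg * chain a y + M * a <= sg * chain b y + M * b.
Proof.
move=> M0 ab h; apply: (@glue_le R (fun z => sg * chain z y + M * z) V W) => //.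
- exact: VW.
- move=> x t ax xt tb tV; rewrite !chain_left//; last exact: le_trans tV.
  apply: (mono_le xt (fun z _ => isD_add (isD_mul (isD_cst sg z) (is_derive_plane y (is_derive_K3 z)))
    (isD_mul (isD_cst M z) (isD_id z)))) => z /andP[xz zt].
  have zV : z <= V by exact: le_trans (ltW zt) tV.
  have azb : a <= z <= b by rewrite (le_trans ax (ltW xz)) (le_trans (ltW zt) tb).
  have hK : 0 <= K3 z <= powg p z by rewrite K3_ge0// K3_le_g.
  by have := h z _ azb hK; lra.
- move=> x t ax xt tb Vx tW; rewrite !chain_mid//.
  + by rewrite lerD2l ler_wpM2l.
  + exact: le_trans xt.
  + exact: le_trans tW.
- move=> x t ax xt tb Wx; rewrite !chain_right//; last exact: le_trans xt.
  apply: (mono_le xt (fun z _ => isD_add (isD_mul (isD_cst sg z) (is_derive_plane y (is_derive_K1 H0 z)))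
    (isD_mul (isD_cst M z) (isD_id z)))) => z /andP[xz zt].
  have Wz : W <= z by exact: le_trans Wx (ltW xz).
  have azb : a <= z <= b by rewrite (le_trans ax (ltW xz)) (le_trans (ltW zt) tb).
  have hK : 0 <= K1 p C z <= powg p z by rewrite K1_ge0 K1_le_g.
  by have := h z _ azb hK; lra.
Qed.

Lemma chain_below y a b : a <= b ->
  (forall z, a <= z <= b -> y.2 <= tangent_line C z y.1) -> chain a y <= chain b y.
Proof.
move=> ab h; have := @chain_slope 1 0 y a b (lexx 0) ab.
rewrite !mul1r !mul0r !addr0; apply => z K azb /andP[_ Kg].
rewrite mul1r addr0 mulr_le0// ?subr_le0 ?h// mulr_ge0_le0// ?subr_le0//.
exact: ltW (kappa_gt0 H0).
Qed.

Lemma chain_above y a b : a <= b ->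
  (forall z, a <= z <= b -> tangent_line C z y.1 <= y.2) -> chain b y <= chain a y.
Proof.
move=> ab h; have := @chain_slope (-1) 0 y a b (lexx 0) ab.
rewrite !mulN1r !mul0r !addr0 lerN2; apply => z K azb /andP[_ Kg].
rewrite mulN1r addr0 oppr_ge0 mulr_le0_ge0// ?subr_ge0 ?h// mulr_ge0_le0// ?subr_le0//.
exact: ltW (kappa_gt0 H0).
Qed.

Lemma plane_lower z K s :
  plane z K (s, expR s) = powf p z + powf1 p z * (s - z) + K * (expR s - expR z * (1 + (s - z))).
Proof. by []. Qed.

Lemma chain_diag s : chain s (s, expR s) <= powf p s.
Proof.
have [sV|Vs] := leP s V; first by rewrite chain_left// plane_lower !subrr; lra.
have [sW|Ws] := leP s W.
  rewrite chain_mid ?(ltW Vs)// plane_lower.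
  have [A [B h]] := bar_bitangent H0.
  have sq : s <= p - 2 by apply/(le_trans sW)/ltW/W_lt_q.
  by have := bitangent_gap_ge0 (adm_p H0) h sq; rewrite (bitangentE _ h); lra.
by rewrite chain_right ?(ltW Ws)// plane_lower !subrr; lra.
Qed.

(** Moving the index from z to s can only raise the plane at (s, e^s): this point lies below T_t for
    z <= t <= s as long as s <= z + hstar, and above T_t for t >= s. *)
Lemma chain_le_powf z s : s <= z + hstar C -> chain z (s, expR s) <= powf p s.
Proof.
have C1 := C_gt1 H0; move=> sz; apply: le_trans (chain_diag s).
have [zs|sz'] := leP z s.
  apply: chain_below => // t /andP[zt ts] /=.
  by apply: (lower_le_tangent_line C1) => //; lra.
apply: chain_above; first exact: ltW.
move=> t /andP[st tz] /=; exact: (tangent_line_le_lower C1).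
Qed.

End Chain.

(** * The candidate *)

Section CandidateFormula.
Context {R : realType}.
#[local] Opaque IG Gamma xi wbar wstar vF D m1.
Variables p C : R.
Hypothesis H0 : admissible p C.
Implicit Types s t z a b K : R.
Implicit Types y x : R * R.
Local Notation mu := (@lebesgue_measure R).
Local Notation V := (vbar p C).
Local Notation W := (wbar p C).
Local Notation Kb := (D p (wbar p C)).

Lemma m3_integral z : z <= V ->
  \int[mu]_(s in `[z, V]) ((- s) `^ (p - 1) * expR (- s / xi C)) =
  IG (p - 1) (xi C) z - IG (p - 1) (xi C) V.
Proof.
move=> zV; have hp := adm_p H0; have p1 : 0 < p - 1 by lra.
have x0 := xi_gt0 H0.
transitivity (\int[mu]_(s in `[z, V]) (`|s| `^ (p - 1) * expR (- s / xi C))).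
  apply: eq_Rintegral => s; rewrite inE/= in_itv/= => /andP[_ sV].
  by rewrite ltr0_norm//; apply: le_lt_trans sV (V_lt0 H0).
have dH (t : R) : is_derive t 1 (fun t => - IG (p - 1) (xi C) t) (`|t| `^ (p - 1) * expR (- t / xi C)).
  by apply: (is_derive_eq (isD_opp (is_derive_IG t p1 x0))); rewrite opprK.
rewrite (@Rintegral_primitive R (fun s => `|s| `^ (p - 1) * expR (- s / xi C)) _ z V _ dH zV); first by lra.
move=> t; apply: cvgM; first exact: abspow_continuous.
exact: (isD_cont (isD_expR (isD_mul (isD_opp (isD_id t)) (isD_cst (xi C)^-1 t)))).
Qed.

Lemma m1_W : m1 p C W = powf1 p W + Kb * expR W / kappa C.
Proof. by rewrite (m1E H0 (ltW (W_gt0 H0))) (K1_W H0). Qed.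

(** Both sides satisfy the same linear first-order equation; up to a constant, [Phi] is their
    difference times e^(-z/xi). *)
Lemma m3E z : z <= V -> m3 p C z = powf1 p z + K3 p C z * expR z / kappa C.
Proof.
move=> zV; have hp := adm_p H0; have p1 : 0 < p - 1 by lra.
have x0 := xi_gt0 H0; have k0 := kappa_gt0 H0; have V0 := V_lt0 H0.
rewrite /m3 m3_integral// m1_W -(powf1_pos hp (W_gt0 H0)).
have -> : expR (V - W) * (powf1 p W + Kb * expR W / kappa C - powf1 p W) - p * (- V) `^ (p - 1) =
    expR V * Kb / kappa C + powf1 p V.
  have : expR (V - W) * expR W = expR V by rewrite -expRD subrK.
  by rewrite (powf1_neg hp V0) => <-; lra.
pose Phi t := powf1 p t * expR (- (t / xi C)) + K3 p C t * expR (- (kappa C * t)) / kappa C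
  + p / xi C * (IG (p - 1) (xi C) t - IG (p - 1) (xi C) V).
have dPhi t : z <= t <= V -> is_derive t 1 Phi 0.
  move=> /andP[_ tV]; have t0 : t < 0 by apply: le_lt_trans tV V0.
  apply: (is_derive_eq (isD_add (isD_add
    (isD_mul (is_derive_powf1 hp t) (isD_expR (isD_opp (isD_mul (isD_id t) (isD_cst (xi C)^-1 t)))))
    (isD_mul (isD_mul (is_derive_K3 H0 t) (isD_expR (isD_opp (isD_mul (isD_cst (kappa C) t) (isD_id t)))))
      (isD_cst (kappa C)^-1 t)))
    (isD_mul (isD_cst (p / xi C) t) (isD_add (is_derive_IG t p1 x0) (isD_cst (- IG (p - 1) (xi C) V) t))))).
  rewrite -powg_expR (powf1_neg hp t0) (ltr0_norm t0).
  have -> : expR (- t / xi C) = expR (- (t / xi C)) by congr expR; lra.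
  have ee : expR t * expR (- (t / xi C)) = expR (- (kappa C * t)).
    by rewrite -expRD; congr expR; rewrite inv_xi; lra.
  have kk : kappa C * (kappa C)^-1 = 1 by rewrite mulfV// gt_eqF.
  move: ee; set a := expR t; set b := expR (- (t / xi C)); set c := expR (- _) => ee.
  set g := powg p t; set K := K3 p C t; set i := (kappa C)^-1 in kk *.
  have h1 : kappa C * i * ((K - g) * c - K * c) = (K - g) * c - K * c by rewrite kk mul1r.
  have h2 : g * (a * b) = g * c by rewrite ee.
  by lra.
have PhiE : Phi z = Phi V.
  apply/eqP; rewrite eq_le; apply/andP; split.
    exact: (@mono_le R Phi (fun=> 0) z V zV dPhi (fun _ _ => lexx 0)).
  rewrite -lerN2; apply: (@mono_le R (fun t => - Phi t) (fun=> 0) z V zV _ (fun _ _ => lexx 0)).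
  by move=> t /dPhi dt; apply: (is_derive_eq (isD_opp dt)); rewrite oppr0.
move: PhiE; rewrite /Phi K3_V subrr mulr0 addr0.
have e1 : expR (z / xi C) * expR (- (z / xi C)) = 1 by rewrite -expRD subrr expR0.
have e2 : expR (z / xi C) * expR (- (kappa C * z)) = expR z.
  by rewrite -expRD; congr expR; rewrite inv_xi; lra.
have e3 : expR (z / xi C) * expR (- (V / xi C)) = expR ((z - V) / xi C).
  by rewrite -expRD; congr expR; lra.
have e4 : expR (z / xi C) * expR (- (kappa C * V)) = expR ((z - V) / xi C) * expR V.
  by rewrite -!expRD; congr expR; rewrite inv_xi; lra.
move: e1 e2 e3 e4; set E := expR (z / xi C).
set a := expR (- (z / _)); set b := expR (- (kappa C * z)); set c := expR (- (V / _)).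
set d := expR (- (kappa C * V)); set e := expR (_ / _); set j := (kappa C)^-1.
set I1 := IG _ _ z; set I2 := IG _ _ V => e1 e2 e3 e4 h.
have : E * (powf1 p z * a + K3 p C z * b * j + p / xi C * (I1 - I2)) =
   E * (powf1 p V * c + Kb * d * j) by rewrite h.
have -> : E * (powf1 p z * a + K3 p C z * b * j + p / xi C * (I1 - I2)) =
  powf1 p z * (E * a) + K3 p C z * (E * b) * j + E * (p / xi C * (I1 - I2)) by lra.
have -> : E * (powf1 p V * c + Kb * d * j) = powf1 p V * (E * c) + Kb * (E * d) * j by lra.
by rewrite e1 e2 e3 e4; lra.
Qed.

Lemma plane_tangent z K x : x.2 = tangent_line C z x.1 ->
  plane p z K x = powf p z + (powf1 p z + K * expR z / kappa C) * (x.1 - z).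
Proof.
move=> e; rewrite /plane e tangent_lineE.
have := kappa_compl H0; set i := _^-1; have k0 := kappa_gt0 H0.
move=> ki; have kk : kappa C * (kappa C)^-1 = 1 by rewrite mulfV// gt_eqF.
have -> : i = 1 + (kappa C)^-1.
  have : (kappa C)^-1 * (kappa C * i) = (kappa C)^-1 * (kappa C + 1) by rewrite ki.
  have -> : (kappa C)^-1 * (kappa C * i) = (kappa C * (kappa C)^-1) * i by lra.
  by rewrite kk mul1r => ->; rewrite mulrDr mulr1 [_ * kappa C]mulrC kk.
by lra.
Qed.

Lemma b1E x : Omega C x -> W <= u C x -> b1 p C x = chain p C (u C x) x.
Proof.
move=> ox Wu; have [e _] := u_spec (C_gt1 H0) ox.
have u0 : 0 < u C x by exact: lt_le_trans (W_gt0 H0) Wu.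
rewrite chain_right// (plane_tangent _ (esym e)) /b1 (m1E H0 (ltW u0)).
by rewrite (powf_pos _ (ltW u0)); lra.
Qed.

Lemma b3E x : Omega C x -> u C x <= V -> b3 p C x = chain p C (u C x) x.
Proof.
move=> ox uV; have [e _] := u_spec (C_gt1 H0) ox.
have u0 : u C x <= 0 by apply/(le_trans uV)/ltW/(V_lt0 H0).
by rewrite chain_left// (plane_tangent _ (esym e)) /b3 (m3E uV) (powf_neg _ u0); lra.
Qed.

Lemma r_lt_k : r V W < k C W.
Proof.
have VW0 := VW H0; have c0 := xi_compl_gt0 H0; have x0 := xi_gt0 H0.
have d0 : 0 < W - V by rewrite subr_gt0.
apply: (@lt_trans _ _ (expR W)).
  rewrite /r ltr_pdivrMr//.
  have := @expR_gt_tangent R W V; rewrite lt_eqF// => /(_ isT); lra.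
rewrite /k ltr_pdivlMr// gtr_pMr ?expR_gt0//; lra.
Qed.

Lemma b2E x : b2 p C x = plane p W Kb x.
Proof.
have hp := adm_p H0; have V0 := V_lt0 H0; have W0 := W_gt0 H0; have VW0 := VW H0.
have rk := r_lt_k.
rewrite /b2 /= m1_W -(powf_pos _ (ltW W0)).
have hq : q p V W * (W - V) = powf p W - powf p V.
  by rewrite /q mulfVK ?gt_eqF ?subr_gt0// (powf_pos _ (ltW W0)) (powf_neg _ (ltW V0)).
have hr : r V W * (W - V) = expR W - expR V by rewrite /r mulfVK// gt_eqF// subr_gt0.
have hV : plane p W Kb (V, expR V) = powf p V.
  by rewrite -(plane_VW H0) plane_lower !subrr; lra.
have qE : q p V W = powf1 p W + Kb * (r V W - expR W).
  have WV : W - V != 0 by rewrite gt_eqF// subr_gt0.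
  apply: (mulIf WV); rewrite hq -hV plane_lower.
  have : Kb * (r V W * (W - V)) = Kb * (expR W - expR V) by rewrite hr.
  by lra.
have kE : k C W = expR W + expR W / kappa C.
  rewrite /k.
  have := kappa_compl H0; set i := _^-1; have k0 := kappa_gt0 H0.
  move=> ki; have kk : kappa C * (kappa C)^-1 = 1 by rewrite mulfV// gt_eqF.
  have : (kappa C)^-1 * (kappa C * i) = (kappa C)^-1 * (kappa C + 1) by rewrite ki.
  have -> : (kappa C)^-1 * (kappa C * i) = (kappa C * (kappa C)^-1) * i by lra.
  rewrite kk mul1r => ->.
  have : (kappa C * (kappa C)^-1) * expR W = expR W by rewrite kk mul1r.
  by lra.
have -> : (powf1 p W + Kb * expR W / kappa C - q p V W) / (k C W - r V W) = Kb.
  rewrite [X in X / _](_ : _ = Kb * (k C W - r V W)); last by rewrite qE kE; lra.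
  by rewrite mulfK// subr_eq0 gt_eqF.
by rewrite qE /plane; lra.
Qed.

(* The part of R4 that is not on the bounding chord. *)
Definition below x := V < x.1 < W /\ x.2 < chord_line V W x.1.

(** A comparison of slopes at V: the chord has slope at most e^W <= e * e^V because W - V < 1, while
    the tangent line has slope e^V / (1 - xi) > 24 e^V. *)
Lemma chord_le_tangentV s : V <= s -> chord_line V W s <= tangent_line C V s.
Proof.
move=> Vs; have VW0 := VW H0; have d0 : 0 < W - V by rewrite subr_gt0.
have c0 := xi_compl_gt0 H0.
suff h : r V W <= k C V.
  have hr : r V W * (W - V) = expR W - expR V by rewrite /r mulfVK// gt_eqF.
  have : 0 <= (k C V - r V W) * (s - V) by rewrite mulr_ge0// subr_ge0.
  by rewrite /chord_line /tangent_line; lra.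
apply: (@le_trans _ _ (expR W)).
  rewrite /r ler_pdivrMr//.
  by have := @expR_ge_tangent R W V; lra.
have hW := wbar_bounds H0; have /andP[W0 Wm] := hW.
have [/andP[hv _] _] := vbar_root H0.
have w3 := wmax_third (adm_p H0).
have -> : expR W = expR V * expR (W - V) by rewrite -expRD; congr expR; lra.
rewrite /k ler_pM2l ?expR_gt0//.
apply: (@le_trans _ _ (expR 1)); first by rewrite ler_expR; lra.
by have := inv_one_sub_xi_gt H0; have := @expR1_le R; lra.
Qed.

(** Translates the four regions into the coordinate u: R1 becomes W <= u, R3 becomes u <= V, and R2
    is the part between that is not under the chord. On these three the candidate is a single family
    of planes, and only the open region under the chord remains apart. *)
Lemma cand_cases x : Omega C x ->
  (candidate p C x = chain p C (u C x) x /\ ~ below x) \/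
  (below x /\ candidate p C x = b4 p x).
Proof.
move=> ox; have C1 := C_gt1 H0; have VW0 := VW H0; have x0 := xi_gt0 H0.
have /andP[lo up] := ox.
have [ue /andP[ux xu]] := u_spec C1 ox.
have out z : x.1 < z -> expR x.1 <= x.2 -> tangent_line C z x.1 <= x.2.
  by move=> xz h; apply: le_trans h; apply: (tangent_line_le_lower C1); exact: ltW.
rewrite /candidate.
have [/set_mem h1|/negP n1] := boolP (x \in R1 p C).
  left.
  have Wu : W <= u C x /\ W <= x.1.
    case: h1 => -[_ h].
      have Wx : W <= x.1.
        rewrite leNgt; apply/negP => xW.
        have : tangent_line C W x.1 < expR x.1.
          apply: lt_le_trans (_ : expR W * (1 + (x.1 - W)) <= _); last exact: expR_ge_tangent.
          rewrite tangent_lineE ltr_pM2l ?expR_gt0// ltrD2l.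
          have i1 := inv_one_sub_xi_gt H0.
          have : 0 < ((1 - xi C)^-1 - 1) * (W - x.1) by rewrite mulr_gt0// subr_gt0//; lra.
          by lra.
        by move: h; rewrite leNgt => /negP; lra.
      by split=> //; exact: (le_u_of_tangent_line C1).
    by move: h => /= h; split; lra.
  case: Wu => Wu Wx; split; first exact: b1E.
  by case=> /andP[_ ]; lra.
have uW : u C x < W /\ x.1 < W + xi C /\ tangent_line C W x.1 < x.2.
  have n2 : x.1 < W + xi C.
    by rewrite ltNge; apply/negP => h; apply: n1; rewrite inE; right.
  have n3 : tangent_line C W x.1 < x.2.
    by rewrite ltNge; apply/negP => h; apply: n1; rewrite inE; left.
  split=> //; rewrite ltNge; apply/negP => Wu.
  have : x.2 <= tangent_line C W x.1 by apply: (le_tangent_line_of_u C1) => //; lra.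
  by lra.
case: uW => uW [xW TW].
have [/set_mem h2|/negP n2] := boolP (x \in R2 p C).
  left.
  have Vu : V <= u C x /\ (~ below x).
    case: h2 => [[_ h3 h4 h5]|[_ /andP[h3 h4] h5 h6]].
      have Vx : V <= x.1.
        rewrite leNgt; apply/negP => xV.
        have : tangent_line C V x.1 < expR x.1.
          apply: lt_le_trans (_ : expR V * (1 + (x.1 - V)) <= _); last exact: expR_ge_tangent.
          rewrite tangent_lineE ltr_pM2l ?expR_gt0// ltrD2l.
          have i1 := inv_one_sub_xi_gt H0.
          have : 0 < ((1 - xi C)^-1 - 1) * (V - x.1) by rewrite mulr_gt0// subr_gt0//; lra.
          by lra.
        by move: h3; rewrite leNgt => /negP; lra.
      split; first exact: (le_u_of_tangent_line C1).
      by case=> _; lra.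
    split; first by lra.
    have Vx : V <= x.1 by lra.
    by have := chord_le_tangentV Vx => h [_]; lra.
  case: Vu => Vu nb; split=> //.
  by rewrite b2E (chain_mid H0)// ltW.
have [/set_mem h3|/negP n3] := boolP (x \in R3 p C).
  left; case: h3 => _ h3 h4; split.
    by apply: b3E => //; exact: (u_le_of_tangent_line C1).
  case=> /andP[Vx _]; have := chord_le_tangentV (ltW Vx); lra.
right; split => //.
have TV : x.2 < tangent_line C V x.1.
  rewrite ltNge; apply/negP => TV.
  have [xV|Vx] := leP x.1 (V + xi C); first by apply: n3; rewrite inE.
  by apply: n2; rewrite inE; right; split => //; rewrite ?ltW.
have lc : x.2 < chord_line V W x.1.
  by rewrite ltNge; apply/negP => h; apply: n2; rewrite inE; left; split; [exact: ox|exact: ltW|exact: h|exact: ltW].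
split => //; apply/andP; split.
  rewrite ltNge; apply/negP => xV.
  by have := tangent_line_le_lower C1 xV; lra.
rewrite ltNge; apply/negP; rewrite le_eqVlt => /predU1P[e|Wx].
  by move: lc; rewrite -e chord_liner e; lra.
by have := @chord_line_lt_lower R V W x.1 VW0; rewrite Wx orbT => /(_ isT); lra.
Qed.

End CandidateFormula.

(** * Comparison of the supporting planes with the candidate *)

Section LocalConvexity.
Context {R : realType}.
#[local] Opaque IG Gamma xi wbar vF D m1 m3.
Variables p C : R.
Hypothesis H0 : admissible p C.
Implicit Types s t z a b K : R.
Implicit Types y x : R * R.
Local Notation V := (vbar p C).
Local Notation W := (wbar p C).
Local Notation Kb := (D p (wbar p C)).

Lemma vF_continuous_chord (s w0 : R) : 0 < w0 < wmax p ->
  {for w0, continuous (fun w => chord_line (vF p w) w s)}.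
Proof.
move=> hw; have hp := adm_p H0; have vc := vF_continuous hp hw.
have /andP[w00 _] := hw; have v0 := F_root_neg hp w00 (vFP hp hw).
rewrite /continuous_at /chord_line /r.
have ce : expR (vF p w) @[w --> w0] --> expR (vF p w0).
  by apply: (@continuous_comp _ _ _ (vF p) (@expR R) w0 vc); exact: continuous_expR.
apply: cvgD; last exact: continuous_expR.
apply: cvgM; last by apply: cvgB; [exact: cvg_cst|exact: cvg_id].
apply: cvgM; first by apply: cvgB => //; exact: continuous_expR.
apply: cvgV; first by rewrite subr_eq0 gt_eqF// (lt_trans v0).
by apply: cvgB => //; exact: cvg_id.
Qed.

Lemma vF_bounds w : 0 < w < wmax p -> - w < vF p w < 0.
Proof.
move=> hw; have hp := adm_p H0; have /andP[w0 _] := hw.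
have hr := vFP hp hw.
by rewrite (F_root_neg hp w0 hr) andbT; case: hr => /andP[].
Qed.

(** The chords move continuously with w. The one for W passes above x, and for small w the chord
    passes at or below x, so some chord in between goes through x. *)
Lemma below_chord x : Omega C x -> below p C x -> x != (0, 1) ->
  exists w, [/\ 0 < w < W, vF p w <= x.1 <= w & chord_line (vF p w) w x.1 = x.2].
Proof.
move=> /andP[lo _] [/andP[Vx xW] lt_ch] x01; have hp := adm_p H0.
have /andP[W0 Wm] := wbar_bounds H0.
have [w0 [w00 w0W hw0]] : exists w0, [/\ 0 < w0, w0 < W & chord_line (vF p w0) w0 x.1 <= x.2].
  have [x10|x10] := eqVneq x.1 0.
    have x2 : 1 < x.2.
      rewrite lt_neqAle; move: lo; rewrite x10 expR0 => ->; rewrite andbT.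
      apply/eqP => e; move/eqP: x01; apply.
      by rewrite [x]surjective_pairing x10 -e.
    have l0 : 0 < ln x.2 by rewrite ln_gt0.
    (* Above the origin the chord is at most e^w0, so w0 <= ln x2 puts it at or below x. *)
    pose w0 := Num.min (ln x.2) (W / 2).
    have w00 : 0 < w0 by rewrite lt_min l0 divr_gt0.
    have w0W : w0 < W by rewrite gt_min; apply/orP; right; lra.
    exists w0; split => //.
    have hw : 0 < w0 < wmax p by rewrite w00 (lt_trans w0W).
    have /andP[v1 v2] := vF_bounds hw.
    have vw : vF p w0 < w0 by exact: lt_trans w00.
    apply: (@le_trans _ _ (expR w0)); last first.
      rewrite -[leRHS](lnK (_ : x.2 \is Num.pos)) ?posrE ?(lt_trans ltr01)//.
      by rewrite ler_expR ge_min lexx.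
    rewrite /chord_line gerDr mulr_ge0_le0//; last by rewrite x10 sub0r oppr_le0 ltW.
    by rewrite /r divr_ge0 ?subr_ge0 ?ler_expR// ltW.
  (* Since - w0 < vF p w0, the choice w0 <= |x1| leaves no point of the open chord above x1: the
     line through the ends lies at or below the lower boundary there. *)
  pose w0 := Num.min `|x.1| (W / 2).
  have w00 : 0 < w0 by rewrite lt_min normr_gt0 x10 divr_gt0.
  have w0W : w0 < W by rewrite gt_min; apply/orP; right; lra.
  have w0x : w0 <= `|x.1| by rewrite ge_min lexx.
  exists w0; split => //.
  have hw : 0 < w0 < wmax p by rewrite w00 (lt_trans w0W).
  have /andP[v1 v2] := vF_bounds hw.
  have vw : vF p w0 < w0 by exact: lt_trans w00.
  apply: le_trans lo.
  have [xp|xn] := ltP 0 x.1.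
    move: w0x; rewrite gtr0_norm// le_eqVlt => /predU1P[->|w0x]; first by rewrite chord_liner.
    by apply/ltW/chord_line_lt_lower => //; rewrite w0x orbT.
  move: w0x; rewrite ler0_norm// => w0x.
  by apply/ltW/chord_line_lt_lower => //; apply/orP; left; lra.
pose Q w := chord_line (vF p w) w x.1.
have Qc : {within `[w0, W], continuous Q}.
  apply: continuous_in_subspaceT => w; rewrite inE/= in_itv/= => /andP[h1 h2].
  by apply: vF_continuous_chord; rewrite (lt_le_trans w00)//= (le_lt_trans h2).
have Qv : Num.min (Q w0) (Q W) <= x.2 <= Num.max (Q w0) (Q W).
  by rewrite ge_min hw0/= le_max (ltW lt_ch) orbT.
have [w + ew] := IVT (ltW w0W) Qc Qv; rewrite in_itv/= => /andP[h1 h2].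
have wW : w < W.
  rewrite lt_neqAle h2 andbT; apply/eqP => e.
  by move: lt_ch; rewrite -ew /Q e ltxx.
have w_0 : 0 < w by exact: lt_le_trans h1.
have hw : 0 < w < wmax p by rewrite w_0 (lt_trans wW).
have /andP[v1 v2] := vF_bounds hw.
have vw : vF p w < w by exact: lt_trans w_0.
exists w; split => //; first by rewrite w_0.
apply/negPn/negP; rewrite negb_and -!ltNge => /(chord_line_lt_lower vw).
by rewrite -/(Q w) ew ltNge lo.
Qed.

Lemma expaff_threel (a b k x y z : R) : x < y -> y < z -> 0 <= k ->
  a + b * x + k * expR x < 0 -> a + b * z + k * expR z <= 0 ->
  a + b * y + k * expR y < 0.
Proof.
move=> xy yz k0 hx hz; have xz : 0 < z - x by lra.
pose t := (z - y) / (z - x).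
have tE : t * (z - x) = z - y by rewrite /t mulfVK// gt_eqF.
have t0 : 0 < t by rewrite divr_gt0//; lra.
have t1 : t < 1 by rewrite ltr_pdivrMr//; lra.
have yE : y = t * x + (1 - t) * z by lra.
have : expR y <= t * expR x + (1 - t) * expR z.
  by rewrite {1}yE expR_conv// !ltW.
move/(ler_wpM2l k0) => h.
have h1 : t * (a + b * x + k * expR x) < 0 by rewrite pmulr_rlt0.
have h2 : (1 - t) * (a + b * z + k * expR z) <= 0 by rewrite mulr_ge0_le0// subr_ge0 ltW.
by rewrite {1}yE; lra.
Qed.

Definition aff A B K y := A + B * y.1 + K * y.2 :> R.

Definition mix t v w : R * R := ((1 - t) * v + t * w, (1 - t) * expR v + t * expR w).

Lemma aff_mix A B K t v w :
  aff A B K (mix t v w) = (1 - t) * aff A B K (v, expR v) + t * aff A B K (w, expR w).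
Proof. by rewrite /aff /mix/=; lra. Qed.

Lemma chord_line_mix (v w t : R) : v < w ->
  chord_line v w ((1 - t) * v + t * w) = (1 - t) * expR v + t * expR w.
Proof.
move=> vw; rewrite chord_lineE//.
have -> : (w - ((1 - t) * v + t * w)) / (w - v) = 1 - t.
  have -> : w - ((1 - t) * v + t * w) = (1 - t) * (w - v) by lra.
  by rewrite mulfK// gt_eqF// subr_gt0.
lra.
Qed.

Lemma b4_spec x : Omega C x -> below p C x ->
  exists v w t, [/\ 0 <= t <= 1, x = mix t v w,
    b4 p x = (1 - t) * powf p v + t * powf p w, V < v <= w /\ w < W
    & exists A B K, [/\ forall s, s <= p - 2 -> aff A B K (s, expR s) <= powf p s,
        aff A B K (v, expR v) = powf p v, aff A B K (w, expR w) = powf p w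
        & aff A B K (W, expR W) < powf p W]].
Proof.
move=> ox bx; have hp := adm_p H0; have V0 := V_lt0 H0; have W0 := W_gt0 H0.
have p0 : p != 0 by rewrite gt_eqF//; lra.
have f00 : powf p 0 = 0 by rewrite /powf normr0 powR0.
have [x01|x01] := eqVneq x (0, 1).
  (* The degenerate chord: both ends at 0, supported by the zero plane. *)
  exists 0, 0, 0; split.
  - by rewrite lexx ler01.
  - by rewrite x01 /mix expR0; congr pair; lra.
  - by rewrite /b4 x01 eqxx f00; lra.
  - by rewrite V0 lexx.
  exists 0, 0, 0; rewrite /aff/=; split => [s _|||].
  - by rewrite !mul0r !addr0 powf_ge0.
  - by rewrite f00; lra.
  - by rewrite f00; lra.
  by rewrite !mul0r !addr0 powR_gt0// normr_gt0 gt_eqF.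
have [w [hw /andP[vx xw] ew]] := below_chord ox bx x01.
have /andP[_ Wm] := wbar_bounds H0.
have hwm : 0 < w < wmax p by case/andP: hw => -> h/=; apply: lt_trans Wm.
have /andP[v1 v2] := vF_bounds hwm.
have vw : vF p w < w by apply: lt_trans v2 _; case/andP: hw.
pose S := [set vw : R * R | [/\ 0 < vw.2 < (p - 2) / (3 * p),
    F_root p vw.1 vw.2 & on_segment (vw.1, expR vw.1) (vw.2, expR vw.2) x]].
have hS : S (vF p w, w).
  split => //=; first exact: vFP.
  pose t := (x.1 - vF p w) / (w - vF p w).
  have d0 : 0 < w - vF p w by rewrite subr_gt0.
  have tE : t * (w - vF p w) = x.1 - vF p w by rewrite /t mulfVK// gt_eqF.
  exists t; first by rewrite divr_ge0 ?subr_ge0 ?(ltW vw)//= ler_pdivrMr// mul1r lerB.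
  have xe : x.1 = (1 - t) * vF p w + t * w by lra.
  rewrite [LHS]surjective_pairing /=; congr pair => //.
  by rewrite -ew xe chord_line_mix.
have := getI hS; set vw' := get S.
have ce : chord_ends p x = vw' by rewrite /chord_ends (negbTE x01).
case: vw' ce => v' w' ce [/= hw' hr' [t t01 xe]].
have rE := hr'; have hwm' : 0 < w' < wmax p by [].
have vE : v' = vF p w' by apply: (F_root_uniq hp hwm' hr'); exact: vFP.
have /andP[v1' v2'] := vF_bounds hwm'.
have /andP[w0' wm'] := hwm'.
have vw' : v' < w' by rewrite vE; exact: lt_trans w0'.
have x1E : x.1 = (1 - t) * v' + t * w' by rewrite xe.
have x2E : x.2 = chord_line v' w' x.1 by rewrite x1E chord_line_mix// xe.
(* [get] may return any admissible chord through x. If its right end were at W or beyond, its left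
   end would be at V or before, and the chord would lie on or above the one from V to W on that
   range, whereas x is strictly below. *)
have wW : w' < W.
  rewrite ltNge; apply/negP => Ww.
  have vV : v' <= V.
    move: Ww; rewrite le_eqVlt vE => /predU1P[<-|Ww]; first exact: lexx.
    by apply/ltW/(vF_decr hp W0 Ww).
  have c1 : expR V <= chord_line v' w' V.
    by apply: lower_le_chord_line => //; rewrite vV (le_trans _ Ww)// ltW// VW.
  have c2 : expR W <= chord_line v' w' W.
    by apply: lower_le_chord_line => //; rewrite Ww (le_trans vV)// ltW// VW.
  case: bx => /andP[Vx xW]; rewrite x2E ltNge => /negP; apply.
  rewrite (chord_lineE _ (VW H0)); set th := _ / _.
  have d0 : 0 < W - V by rewrite subr_gt0 VW.
  have thE : th * (W - V) = W - x.1 by rewrite /th mulfVK// gt_eqF.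
  have th0 : 0 <= th by rewrite divr_ge0 ?subr_ge0 ?(ltW xW)// ltW// VW.
  have th1 : 0 <= 1 - th by rewrite subr_ge0 ler_pdivrMr// mul1r; lra.
  apply: le_trans (lerD (ler_wpM2l th0 c1) (ler_wpM2l th1 c2)) _.
  rewrite le_eqVlt; apply/orP; left; apply/eqP.
  have xe2 : x.1 = th * V + (1 - th) * W by lra.
  by rewrite [X in _ = chord_line _ _ X]xe2 /chord_line; lra.
have Vv : V < v' by rewrite vE; apply: (vF_decr hp w0' wW).
exists v', w', t; split=> //.
- rewrite /b4 ce (negbTE x01) /=.
  have w'0 : 0 <= w' by exact: ltW.
  have v'0 : v' <= 0 by rewrite vE ltW.
  have hq : q p v' w' * (w' - v') = powf p w' - powf p v'.
    by rewrite /q mulfVK ?gt_eqF ?subr_gt0// (powf_pos _ w'0) (powf_neg _ v'0).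
  have -> : q p v' w' * (x.1 - w') = (t - 1) * (q p v' w' * (w' - v')) by rewrite x1E; lra.
  by rewrite hq -(powf_pos _ w'0); lra.
- by rewrite Vv ltW.
have hb := F_root_bitangent hp hwm' hr'.
exists (chordA p v' w'), (chordB p v' w'), (chordK p v' w').
have gE s : aff (chordA p v' w') (chordB p v' w') (chordK p v' w') (s, expR s) =
    powf p s - pgap p (chordA p v' w') (chordB p v' w') (chordK p v' w') s.
  by rewrite /aff /pgap/=; lra.
rewrite !gE; case: (hb) => _ _ [-> _] [-> _]; rewrite !subr0; split => //.
  by move=> s sq; rewrite gE lerBlDr lerDl (bitangent_gap_ge0 hp hb).
rewrite ltrBlDr ltrDl (bitangent_gap_gt0 hp hb)//; first exact/ltW/(W_lt_q H0).
  by rewrite gt_eqF// (lt_trans _ W0)// vE.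
by rewrite gt_eqF.
Qed.

Lemma chain_aff z : exists A B K, forall y, chain p C z y = aff A B K y.
Proof.
have pl z0 K : exists A B K', forall y, plane p z0 K y = aff A B K' y.
  exists (powf p z0 - powf1 p z0 * z0 - K * (expR z0 * (1 - z0))), (powf1 p z0 - K * expR z0), K.
  by move=> y; rewrite /plane /aff; lra.
have [zV|Vz] := leP z V.
  by have [A [B [K h]]] := pl z (K3 p C z); exists A, B, K => y; rewrite chain_left.
have [zW|Wz] := leP z W.
  have [A [B [K h]]] := pl W Kb; exists A, B, K => y.
  by rewrite (chain_mid H0) ?(ltW Vz).
have [A [B [K h]]] := pl z (K1 p C z); exists A, B, K => y.
by rewrite (chain_right H0) ?(ltW Wz).
Qed.

Lemma below_u y : Omega C y -> below p C y -> V <= u C y <= W.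
Proof.
move=> oy [/andP[Vy yW] lc]; have C1 := C_gt1 H0.
have [_ /andP[uy _]] := u_spec C1 oy.
rewrite (le_trans uy (ltW yW)) andbT.
apply: (le_u_of_tangent_line C1) => //; last exact: ltW.
by apply/ltW/(lt_le_trans lc)/(chord_le_tangentV H0)/ltW.
Qed.

(** Controls the passage out of the region under the chord. On the lower boundary the difference of
    the two planes is a + b s + k e^s, nonnegative at V and W and nonpositive at c between them;
    hence k >= 0, and the difference is nonnegative outside [V, W]. Above [V, W] it is nonnegative
    on the chord, and it grows with y2. *)
Lemma aff_le_of_not_below A B K c y : Omega C y -> ~ below p C y ->
  aff A B K (V, expR V) <= powf p V -> aff A B K (W, expR W) < powf p W ->
  V < c < W -> powf p c <= aff A B K (c, expR c) ->
  aff A B K y <= chain p C W y.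
Proof.
move=> /andP[lo _] nb hV hW /andP[Vc cW] hc; have hp := adm_p H0.
have VW0 := VW H0.
have [A' [B' hb]] := bar_bitangent H0.
have chE (z : R * R) : chain p C W z = aff A' B' Kb z.
  rewrite (chain_mid H0) ?(ltW VW0)//.
  case: hb => _ _ _ []; rewrite /pgap /pgap1 /plane /aff => e0 e1.
  have -> : powf1 p W = B' + Kb * expR W by lra.
  by have -> : powf p W = A' + B' * W + Kb * expR W; lra.
have [ev ew] : pgap p A' B' Kb V = 0 /\ pgap p A' B' Kb W = 0.
  by case: hb => _ _ [ev _] [ew _].
have gc : 0 <= pgap p A' B' Kb c.
  by apply: (bitangent_gap_ge0 hp hb); apply/ltW/(lt_trans cW)/(W_lt_q H0).
rewrite chE -subr_ge0.
set a := A' - A; set b := B' - B; set k := Kb - K.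
have -> : aff A' B' Kb y - aff A B K y = a + b * y.1 + k * y.2 by rewrite /aff /a /b /k; lra.
have h1 : 0 <= a + b * V + k * expR V by move: hV ev; rewrite /aff /pgap/= /a /b /k; lra.
have h2 : 0 < a + b * W + k * expR W by move: hW ew; rewrite /aff /pgap/= /a /b /k; lra.
have h3 : a + b * c + k * expR c <= 0 by move: hc gc; rewrite /aff /pgap/= /a /b /k; lra.
have k0 : 0 <= k.
  rewrite leNgt; apply/negP => k0.
  have nk : 0 <= - k by lra.
  by have := @expaff_three R (- a) (- b) (- k) V c W Vc cW nk _ _; lra.
have ky := ler_wpM2l k0 lo.
have [yV|Vy] := leP y.1 V.
  apply: (@le_trans _ _ (a + b * y.1 + k * expR y.1)); last by lra.
  move: yV; rewrite le_eqVlt => /predU1P[->//|yV].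
  rewrite leNgt; apply/negP => hy.
  by have := expaff_threel yV Vc k0 hy h3; lra.
have [Wy|yW] := leP W y.1.
  apply: (@le_trans _ _ (a + b * y.1 + k * expR y.1)); last by lra.
  move: Wy; rewrite le_eqVlt => /predU1P[<-|Wy]; first exact: ltW.
  rewrite leNgt; apply/negP => hy.
  by have := expaff_three cW Wy k0 h3 hy; lra.
have cy : chord_line V W y.1 <= y.2.
  by rewrite leNgt; apply/negP => h; apply: nb; split=> //; rewrite Vy.
have {}ky := ler_wpM2l k0 cy.
apply: (@le_trans _ _ (a + b * y.1 + k * chord_line V W y.1)); last by lra.
rewrite (chord_lineE _ VW0); set th := _ / _.
have d0 : 0 < W - V by rewrite subr_gt0.
have thE : th * (W - V) = W - y.1 by rewrite /th mulfVK// gt_eqF.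
have th0 : 0 <= th by rewrite divr_ge0 ?subr_ge0 ?(ltW yW)// ltW.
have th1 : 0 <= 1 - th by rewrite subr_ge0 ler_pdivrMr// mul1r; lra.
have -> : y.1 = th * V + (1 - th) * W by lra.
have := mulr_ge0 th0 h1; have := mulr_ge0 th1 (ltW h2).
by lra.
Qed.

(** Moving the index from u(x) to u(y) is monotone except between u(x) and y1 - xi, where T_z
    touches the upper boundary before y1 and y may lie above it. That stretch has length at most d =
    y1 - x1, and the derivative there is at least - E d. *)
Lemma chain_near (x0 M : R) : exists2 E, 0 <= E & forall x y,
  Omega C x -> Omega C y -> x0 <= x.1 -> x.1 <= y.1 -> y.1 <= x.1 + 1 -> y.1 <= M ->
  chain p C (u C x) y <= chain p C (u C y) y + E * (y.1 - x.1) ^+ 2.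
Proof.
have hp := adm_p H0; have C1 := C_gt1 H0; have k0 := kappa_gt0 H0.
have X0 := xi_gt0 H0; have X1 := xi_lt1 H0.
pose Bd := `|x0| + `|M| + 1.
pose i : R := (1 - xi C)^-1.
have i0 : 0 < i by rewrite invr_gt0 subr_gt0.
(* kappa bounds the derivative together with g e^z <= p (p - 1) Bd^(p - 2) on the relevant range |z|
   <= Bd, and 4 d / (1 - xi) comes from the height of y over T_z. *)
pose E := 4 * kappa C * i * (p * (p - 1) * Bd `^ (p - 2)).
have pp : 0 < p * (p - 1) by rewrite mulr_gt0; lra.
have E0 : 0 <= E by rewrite /E !mulr_ge0 ?powR_ge0 ?(ltW k0) ?(ltW i0)//; lra.
exists E => // x y ox oy x0x xy yx1 yM.
have [_ /andP[ux xu]] := u_spec C1 ox; have [_ /andP[uy yu]] := u_spec C1 oy.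
have err0 : 0 <= E * (y.1 - x.1) ^+ 2 by rewrite mulr_ge0 ?sqr_ge0.
have [uyx|uxy] := leP (u C y) (u C x).
  apply: (@le_trans _ _ (chain p C (u C y) y)); last by lra.
  apply: (chain_above H0) => // z /andP[hz _].
  exact: (tangent_line_le_of_u C1).
have [z1u|uz1] := leP (y.1 - xi C) (u C x).
  apply: (@le_trans _ _ (chain p C (u C y) y)); last by lra.
  apply: (chain_below H0); first exact: ltW.
  by move=> z /andP[h1 h2]; apply: (le_tangent_line_of_u C1) => //; apply: le_trans h1.
set z1 := y.1 - xi C in uz1.
have z1uy : z1 <= u C y by rewrite /z1; lra.
have st1 : chain p C z1 y <= chain p C (u C y) y.
  apply: (chain_below H0) => // z /andP[h1 h2].
  exact: (le_tangent_line_of_u C1).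
pose d := y.1 - x.1; have d0 : 0 <= d by rewrite subr_ge0.
have Ed : 0 <= E * d by rewrite mulr_ge0.
have := @chain_slope _ p C H0 1 (E * d) y (u C x) z1 Ed (ltW uz1).
rewrite !mul1r => st2.
suff st3 z K : u C x <= z <= z1 -> 0 <= K <= powg p z ->
    0 <= 1 * (kappa C * (K - powg p z) * (y.2 - tangent_line C z y.1)) + E * d.
  have {}st2 := st2 st3.
  have : E * d * (z1 - u C x) <= E * d * d by rewrite ler_wpM2l// /d /z1; lra.
  by rewrite expr2 -/d; lra.
move=> /andP[h1 h2] /andP[K0 Kg]; rewrite mul1r.
have [neg|pos] := leP (y.2 - tangent_line C z y.1) 0.
  rewrite addr_ge0// mulr_le0// mulr_ge0_le0 ?(ltW k0)// subr_le0//.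
pose h := y.1 - z - xi C.
have h0 : 0 <= h by rewrite /h; move: h2; rewrite /z1; lra.
have hd : h <= d by rewrite /h /d; lra.
have hh1 : h <= 1 by rewrite /h; lra.
(* y is at most as high as the upper boundary, whose height over T_z at distance h past the tangency
   point is e^z (e^h - 1 - h) / (1 - xi); for h <= 1 this is at most 4 h e^z / (1 - xi). *)
have gap : y.2 - tangent_line C z y.1 <= expR z * i * (4 * d).
  apply: (@le_trans _ _ (expR z * i * (expR h - 1 - h))).
    have yC : y.2 <= C * expR y.1 by case/andP: oy.
    have -> : expR z * i * (expR h - 1 - h) = C * expR y.1 - tangent_line C z y.1.
      have -> : expR y.1 = expR z * expR (xi C) * expR h by rewrite -!expRD; congr expR; rewrite /h; lra.
      have -> : C * (expR z * expR (xi C) * expR h) = (C * expR (xi C)) * expR z * expR h by lra.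
      rewrite (C_expR_xi C1) tangent_lineE -/i /h.
      have : (1 - xi C) * i = 1 by rewrite mulfV// gt_eqF// subr_gt0.
      move=> e1; have : expR z * ((1 - xi C) * i) = expR z by rewrite e1 mulr1.
      by lra.
    by lra.
  rewrite ler_wpM2l//; first by rewrite mulr_ge0 ?expR_ge0 ?(ltW i0).
  have e4 : expR h <= 4.
    have : expR h <= expR 1 by rewrite ler_expR.
    by have := @expR1_le R; lra.
  have := expR_ge1Dx (- h).
  have ee : expR h * expR (- h) = 1 by rewrite -expRD subrr expR0.
  move/(ler_wpM2l (expR_ge0 h)); rewrite ee => e5.
  have : expR h * h <= 4 * h by rewrite ler_wpM2r.
  by lra.
have gz : powg p z * expR z <= p * (p - 1) * Bd `^ (p - 2).
  rewrite powg_expR /powf2 ler_pM2l//; apply: ge0_ler_powR; rewrite ?nnegrE; first by lra.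
  - exact: normr_ge0.
  - by rewrite /Bd !addr_ge0.
  rewrite ler_norml /Bd; apply/andP; split.
    by have := ler_norm (- x0); rewrite normrN; have := normr_ge0 M; lra.
  by have := ler_norm M; have := normr_ge0 x0; move: h2; rewrite /z1; lra.
have kg0 : 0 <= kappa C * (powg p z - K) by rewrite mulr_ge0 ?(ltW k0)// subr_ge0.
have s1 := ler_wpM2l kg0 gap.
have s2 : kappa C * (powg p z - K) * (expR z * i * (4 * d)) <=
    kappa C * powg p z * (expR z * i * (4 * d)).
  rewrite ler_wpM2r//; first by rewrite !mulr_ge0 ?expR_ge0 ?(ltW i0).
  by rewrite ler_pM2l// gerBl.
have c0 : 0 <= 4 * kappa C * i * d by rewrite !mulr_ge0 ?(ltW k0) ?(ltW i0).
have s3 := ler_wpM2l c0 gz.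
by rewrite /E; lra.
Qed.

Lemma cand_local (x0 M : R) : exists d0 E : R, [/\ 0 < d0, 0 <= E & forall x,
  Omega C x -> x0 <= x.1 -> exists A B K, [/\ aff A B K x = candidate p C x,
    forall s, s <= x.1 + d0 -> aff A B K (s, expR s) <= powf p s
  & forall y, Omega C y -> x.1 <= y.1 -> y.1 <= x.1 + d0 -> y.1 <= M ->
      aff A B K y <= candidate p C y + E * (y.1 - x.1) ^+ 2]].
Proof.
have hp := adm_p H0; have C1 := C_gt1 H0; have X0 := xi_gt0 H0; have X1 := xi_lt1 H0.
have VW0 := VW H0; have Wq := W_lt_q H0; have hs := hstar_gt C1.
have [E E0 near] := chain_near x0 M.
(* hstar - xi keeps s within hstar of u(x), p - 2 - W keeps s in the range of the two-point planes,
   and xi keeps tangent lines from W on in their falling branch at y1. *)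
pose d0 := Num.min (Num.min (xi C) (hstar C - xi C)) (p - 2 - W).
have d00 : 0 < d0 by rewrite /d0 !lt_min X0 !subr_gt0 hs.
have d1 : d0 <= xi C by rewrite /d0 !ge_min lexx.
have d2 : d0 <= hstar C - xi C by rewrite /d0 !ge_min lexx orbT.
have d3 : d0 <= p - 2 - W by rewrite /d0 !ge_min lexx orbT.
exists d0, E; split => // x ox x0x.
have below_le A B K y : Omega C y -> below p C y ->
    (forall s, s <= p - 2 -> aff A B K (s, expR s) <= powf p s) ->
    aff A B K y <= b4 p y.
  move=> oy by_ hA; have [v [w [t [/andP[t0 t1] -> -> [/andP[Vv vw] wW] _]]]] := b4_spec oy by_.
  have wq : w <= p - 2 by apply/ltW/(lt_trans wW).
  rewrite aff_mix lerD// ler_wpM2l ?subr_ge0// hA//; exact: le_trans wq.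
have midle s : s <= p - 2 -> chain p C W (s, expR s) <= powf p s.
  move=> sq; have [A [B hb]] := bar_bitangent H0.
  have := bitangent_gap_ge0 hp hb sq; rewrite (bitangentE _ hb).
  by rewrite (chain_mid H0) ?(ltW VW0)// plane_lower; lra.
have [[cx nbx]|[bx cx]] := cand_cases H0 ox.
  have [A [B [K hA]]] := chain_aff (u C x).
  have [_ /andP[ux xu]] := u_spec C1 ox.
  exists A, B, K; rewrite -hA cx; split => // [s sx|y oy xy yx yM].
    by rewrite -hA; apply: (chain_le_powf H0); lra.
  rewrite -hA; apply: le_trans (near x y ox oy x0x xy _ yM) _; first by lra.
  have [[-> _]|[by_ ->]] := cand_cases H0 oy; first exact: lexx.
  (* Under the chord the plane in question is the one of [V, W]; it lies below f on the lower
     boundary, and [b4] interpolates f linearly between two such points. *)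
  rewrite lerD2r; have /andP[Vu uW] := below_u oy by_.
  have [A' [B' [K' hA']]] := chain_aff W.
  have -> : chain p C (u C y) y = chain p C W y.
    by rewrite !(chain_mid H0)// ltW.
  by rewrite hA'; apply: below_le => // s sq; rewrite -hA'; exact: midle.
have [v [w [t [/andP[t0 t1] xe be [/andP[Vv vw] wW] [A [B [K [hA hv hw hW]]]]]]]] := b4_spec ox bx.
have [/andP[_ x1W] _] := bx.
exists A, B, K; split => [|s sx|y oy xy yx yM].
- by rewrite cx be xe aff_mix hv hw.
- by apply: hA; lra.
have err0 : 0 <= E * (y.1 - x.1) ^+ 2 by rewrite mulr_ge0 ?sqr_ge0.
have [[-> nby]|[by_ ->]] := cand_cases H0 oy; last first.
  by apply: le_trans (below_le A B K y oy by_ hA) _; rewrite lerDl.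
apply: (@le_trans _ _ (chain p C (u C y) y)); last by rewrite lerDl.
(* x is under the chord and y is not: the chord plane of x is compared with the plane of [V, W], and
   this one with the plane of u(y) along the chain. *)
apply: (@le_trans _ _ (chain p C W y)).
  apply: (@aff_le_of_not_below A B K w) => //.
  - by apply: hA; lra.
  - by rewrite (lt_le_trans Vv).
  - by rewrite hw lexx.
have [uW|Wu] := leP (u C y) W.
  apply: (chain_above H0) => // z /andP[hz _].
  exact: (tangent_line_le_of_u C1).
apply: (chain_below H0); first exact: ltW.
by move=> z /andP[h1 h2]; apply: (le_tangent_line_of_u C1) => //; lra.
Qed.

(** With Jensen's inequality on a level set S this bounds |S| b(x_S) by a multiple of the integral
    of |phi|^p over S. *)
Lemma cand_growth : exists c x0 : R, [/\ 0 <= c, 0 < x0 & forall x, Omega C x -> x0 <= x.1 ->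
  candidate p C x <= c * x.1 `^ p].
Proof.
have hp := adm_p H0; have C1 := C_gt1 H0; have X0 := xi_gt0 H0; have X1 := xi_lt1 H0.
have k0 := kappa_gt0 H0; have W0 := W_gt0 H0.
have ki0 : 0 < (kappa C)^-1 by rewrite invr_gt0.
have pp : 0 < p * (p - 1) by rewrite mulr_gt0; lra.
exists (1 + p + p * (p - 1) / kappa C), (W + 2); split; [|by lra|].
  by rewrite !addr_ge0 ?mulr_ge0 ?(ltW ki0)//; lra.
move=> x ox xW; have [ue /andP[ux xu]] := u_spec C1 ox.
have Wu : W <= u C x by lra.
have u1 : 1 <= u C x by lra.
have u0 : 0 < u C x by lra.
have x1 : 1 <= x.1 by lra.
have [[-> _]|[[/andP[_ ]]]] := cand_cases H0 ox; last by lra.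
rewrite (chain_right H0)// (plane_tangent H0 _ (esym ue)).
set z := u C x in ue ux xu Wu u1 u0 *.
have Kg := K1_le_g H0 Wu.
have mono r s : 0 <= r -> r <= p -> s = z `^ r -> s <= x.1 `^ p.
  move=> r0 rp ->; apply: (@le_trans _ _ (x.1 `^ r)); last exact: ler_powR.
  by apply: ge0_ler_powR; rewrite ?nnegrE//; lra.
have f0 : powf p z <= x.1 `^ p by apply: (mono p) => //; rewrite ?powf_pos//; lra.
have f1 : powf1 p z <= p * x.1 `^ p.
  rewrite (powf1_pos hp u0) ler_pM2l; last by lra.
  by apply: (mono (p - 1)) => //; lra.
have f2 : K1 p C z * expR z / kappa C <= p * (p - 1) / kappa C * x.1 `^ p.
  apply: (@le_trans _ _ (powg p z * expR z / kappa C)).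
    by rewrite ler_pM2r// ler_pM2r ?expR_gt0.
  rewrite powg_expR /powf2 (gtr0_norm u0).
  have h : z `^ (p - 2) <= x.1 `^ p by apply: (mono (p - 2)) => //; lra.
  have c0 : 0 <= p * (p - 1) / kappa C by rewrite mulr_ge0 ?(ltW ki0)// ltW.
  by have := ler_wpM2l c0 h; lra.
have xp : 0 <= x.1 `^ p by exact: powR_ge0.
have f10 : 0 <= powf1 p z.
  by rewrite (powf1_pos hp u0) mulr_ge0 ?powR_ge0//; lra.
have f20 : 0 <= K1 p C z * expR z / kappa C.
  by apply: mulr_ge0 (ltW ki0); apply: mulr_ge0 (expR_ge0 _); exact: K1_ge0.
have : (powf1 p z + K1 p C z * expR z / kappa C) * (x.1 - z) <=
  (powf1 p z + K1 p C z * expR z / kappa C) * 1.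
  by rewrite ler_wpM2l ?addr_ge0//; lra.
by lra.
Qed.

End LocalConvexity.

(** * Rising sun sets *)

Section Witness.
Context {R : realType}.

Lemma right_witness (P : set R) (c d : R) : c < d -> (\forall r \near c, P r) ->
  exists r, P r /\ c < r < d.
Proof.
move=> cd nP; have : \forall r \near c^'+, P r /\ c < r < d.
  near=> r; split; first by near: r; exact: cvg_within.
  have cr : c < r by near: r; exact: nbhs_right_gt.
  by rewrite cr /=; near: r; exact: nbhs_right_lt.
by move=> h; have [r hr] := @filter_ex _ _ (at_right_proper_filter c) _ h; exists r.
Unshelve. all: by end_near. Qed.

Lemma left_witness (P : set R) (c d : R) : c < d -> (\forall r \near d, P r) ->
  exists r, P r /\ c < r < d.
Proof.
move=> cd nP; have : \forall r \near d^'-, P r /\ c < r < d.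
  near=> r; split; first by near: r; exact: cvg_within.
  have rd : r < d by near: r; exact: nbhs_left_lt.
  by rewrite rd andbT; near: r; exact: nbhs_left_gt.
by move=> h; have [r hr] := @filter_ex _ _ (at_left_proper_filter d) _ h; exists r.
Unshelve. all: by end_near. Qed.

End Witness.

Section RisingSun.
Context {R : realType}.
Variables (Phi : R -> R) (a b : R).
Hypotheses (ab : a < b) (cPhi : {within `[a, b], continuous Phi}).
Hypotheses (Phia : Phi a = 0) (Phib : Phi b <= 0).

(* The second alternative refers to the left end point, where Phi vanishes. *)
Definition shade : set R := [set t | a < t < b /\
  exists s, t < s <= b /\ (Phi t < Phi s \/ 0 < Phi s)].

Lemma Phi_cont t : a < t < b -> {for t, continuous Phi}.
Proof.
move=> hab; have [h _ _] := (continuous_within_itvP Phi ab).1 cPhi.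
by apply: h; rewrite in_itv.
Qed.

Lemma shade_open : open shade.
Proof.
rewrite openE => t [/andP[at_ tb] [s [/andP[ts sb] h]]].
have nt : \forall r \near t, [/\ a < r, r < b & r < s].
  by near=> r; split; near: r; [exact: lt_nbhsr|exact: lt_nbhsl|exact: lt_nbhsl].
case: h => h; last first.
  apply: filterS nt => r [ar rb rs]; split; first by rewrite ar.
  by exists s; rewrite rs sb; split => //; right.
have tab : a < t < b by rewrite at_.
have n2 : \forall r \near t, Phi r < Phi s.
  by apply: (cvgr_lt _ (Phi_cont tab)).
near=> r.
have [ar rb rs] : [/\ a < r, r < b & r < s] by near: r.
split; first by rewrite ar.
exists s; rewrite rs sb; split => //; left.
by near: r.
Unshelve. all: by end_near. Qed.

Lemma not_shade_right d : a <= d -> d <= b -> ~ shade d -> 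
  Phi d <= 0 /\ (forall s, a < d -> d < s -> s <= b -> Phi s <= Phi d /\ Phi s <= 0).
Proof.
rewrite le_eqVlt => /predU1P[<- _ _|ad].
  by rewrite Phia; split => // s; rewrite ltxx.
rewrite le_eqVlt => /predU1P[-> _|db nE].
  by split => // s _ h1 h2; move: (lt_le_trans h1 h2); rewrite ltxx.
have H s : d < s -> s <= b -> Phi s <= Phi d /\ Phi s <= 0.
  move=> ds sb; rewrite !leNgt; split; apply/negP => h; apply: nE.
    by split; [rewrite ad|exists s; rewrite ds; split => //; left].
  by split; [rewrite ad|exists s; rewrite ds; split => //; right].
split=> [|s _]; last exact: H.
rewrite leNgt; apply/negP => Phid.
have n2 : \forall r \near d, 0 < Phi r.
  have dab : a < d < b by rewrite ad.
  by apply: (cvgr_gt _ (Phi_cont dab)).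
have [r [Phir /andP[dr rb]]] := right_witness db n2.
by have [_] := H r dr (ltW rb); rewrite leNgt Phir.
Unshelve. all: by end_near. Qed.

(** Both alternatives in [shade] imply min(Phi, 0) at t is at most its value at some later s.
    Maximizing this function, slightly tilted upwards to the right, shows that it is at most Phi d
    inside the component; if Phi d < Phi c, points just right of c contradict this. *)
Lemma shade_component c d : a <= c -> c < d -> d <= b ->
  (forall t, c < t < d -> shade t) -> ~ shade c -> ~ shade d -> Phi c = Phi d.
Proof.
move=> ac cd db inE nc nd.
have ad : a < d by exact: le_lt_trans cd.
have cb : c < b by exact: lt_le_trans db.
have [Phid0 Hd] := not_shade_right (ltW ad) db nd.
have [Phic0 Hc] := not_shade_right ac (ltW cb) nc.
have dc : Phi d <= Phi c.
  move: ac Hc; rewrite le_eqVlt => /predU1P[<- _|ac Hc]; first by rewrite Phia.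
  by have [] := Hc d ac cd db.
have key t : c < t < d -> Num.min (Phi t) 0 <= Phi d.
  move=> /andP[ct td]; rewrite leNgt; apply/negP => lt0.
  have Phid_lt : Phi d < 0 by apply: lt_le_trans lt0 _; rewrite ge_min lexx orbT.
  (* The tilt over [t, d] costs half of the assumed excess, so the maximum is not at d; being
     positive, the tilt makes a later point with an equal value contradict maximality. *)
  pose eta := (Num.min (Phi t) 0 - Phi d) / (2 * (d - t)).
  have dt0 : 0 < d - t by rewrite subr_gt0.
  have eta0 : 0 < eta by rewrite divr_gt0 ?subr_gt0// mulr_gt0.
  have etaE : eta * (d - t) = (Num.min (Phi t) 0 - Phi d) / 2.
    have : eta * (2 * (d - t)) = Num.min (Phi t) 0 - Phi d by rewrite /eta mulfVK// gt_eqF// mulr_gt0.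
    lra.
  pose h r := Num.min (Phi r) 0 + eta * r.
  have at_ : a <= t by apply: (le_trans ac); exact: ltW.
  have hc : {within `[t, d], continuous h}.
    have sub : `[t, d] `<=` `[a, b] by apply: subset_itv; rewrite bnd_simp.
    have cP : {within `[t, d], continuous Phi} by apply: continuous_subspaceW cPhi.
    move=> r; apply: cvgD.
      by apply: continuous_min; [exact: cP|exact: cst_continuous].
    by apply: cvgM; [exact: cvg_cst|apply: continuous_subspaceT => x; exact: cvg_id].
  have [t' + hmax] := EVT_max (ltW td) hc.
  rewrite in_itv/= => /andP[tt' t'd].
  have hM r : t <= r -> r <= d -> h r <= h t' by move=> h1 h2; apply: hmax; rewrite in_itv/= h1.
  have m1 : Phi d < Num.min (Phi t') 0.
    have := hM t (lexx t) (ltW td); rewrite /h.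
    have : eta * (t' - t) <= eta * (d - t) by rewrite ler_pM2l//; lra.
    rewrite etaE; move: lt0; set mt := Num.min _ _; set mt' := Num.min _ _; lra.
  have t'd' : t' < d.
    rewrite lt_neqAle t'd andbT; apply/eqP => e.
    by move: m1; rewrite e ltNge ge_min lexx.
  have [_ [s [/andP[t's sb] hs]]] : shade t' by apply: inE; rewrite (lt_le_trans ct)//.
  have ms : Num.min (Phi t') 0 <= Num.min (Phi s) 0.
    case: hs => hs; last by rewrite [leRHS]min_r ?(ltW hs)// ge_min lexx orbT.
    by rewrite le_min !ge_min (ltW hs) lexx orbT.
  have [sd|ds] := leP s d.
    have := hM s (ltW (le_lt_trans tt' t's)) sd; rewrite /h.
    have : eta * t' < eta * s by rewrite ltr_pM2l.
    by lra.
  have [h1 h2] := Hd s ad ds sb.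
  have : Num.min (Phi s) 0 <= Phi d by rewrite ge_min h1.
  by lra.
apply/eqP; rewrite eq_le dc andbT leNgt; apply/negP => dc'.
have Phid_lt : Phi d < 0 by exact: lt_le_trans dc' Phic0.
have rc : Phi r @[r --> c^'+] --> Phi c.
  have [h1 h2 _] := (continuous_within_itvP Phi ab).1 cPhi.
  move: ac; rewrite le_eqVlt => /predU1P[<-//|ac].
  by apply: cvg_at_right_filter; apply: Phi_cont; rewrite ac.
have [r [cr rd hr]] : exists r, [/\ c < r, r < d & Phi d < Phi r].
  have : \forall r \near c^'+, [/\ c < r, r < d & Phi d < Phi r].
    near=> r; split; first by near: r; exact: nbhs_right_gt.
      by near: r; exact: nbhs_right_lt.
    by near: r; apply: (cvgr_gt _ rc).
  by move=> /filter_ex[r hr]; exists r.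
have : Num.min (Phi r) 0 <= Phi d by apply: key; rewrite cr.
by rewrite ge_min !leNgt hr Phid_lt.
Unshelve. all: by end_near. Qed.

Lemma shade_itv (i : nat) :
  let K := open_disjoint_itv shade_open i in
  K = set0 \/ exists c d, [/\ a <= c, c < d, d <= b, K = `]c, d[%classic & Phi c = Phi d].
Proof.
move=> K; have [->|/set0P[t0 Kt0]] := eqVneq K set0; [by left|right].
have oK : open K := @open_disjoint_itv_open _ _ shade_open i.
have iK : is_interval K := @open_disjoint_itv_is_interval _ _ shade_open i.
have KE : K `<=` shade.
  by rewrite [X in _ `<=` X](open_disjoint_itv_bigcup shade_open) => t Kt; exists i.
have lb : lbound K a by move=> t /KE [/andP[/ltW]].
have ub : ubound K b by move=> t /KE [/andP[_ /ltW]].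
have hl : has_lbound K by exists a.
have hu : has_ubound K by exists b.
have KI : K = [set r | inf K < r < sup K].
  by rewrite -(interval_bounded_interior iK hl hu); apply/esym/interior_id.
have KI' : K = `]inf K, sup K[%classic.
  by rewrite {1}KI; apply/seteqP; split => x /=; rewrite in_itv.
set c := inf K in KI KI' *; set d := sup K in KI KI' *.
have /andP[ct td] : c < t0 < d by move: Kt0; rewrite KI.
have cd : c < d by exact: lt_trans td.
have ac : a <= c by apply: lb_le_inf => //; exists t0.
have db : d <= b by apply: ge_sup => //; exists t0.
have inK t : c < t < d -> K t by move=> h; rewrite KI.
(* An end point in the set would belong to a component, which is open and so meets K; it would be K
   itself, but K is open at its ends. *)
have notend e : e = c \/ e = d -> ~ shade e.
  move=> he; rewrite [X in ~ X _](open_disjoint_itv_bigcup shade_open) => -[j _ Kj].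
  have oj := @open_disjoint_itv_open _ _ shade_open j.
  have ij : j = i.
    apply: (@open_disjoint_itv_trivIset _ _ shade_open) => //.
    have nj : \forall r \near e, open_disjoint_itv shade_open j r by exact: open_nbhs_nbhs.
    have : exists r, open_disjoint_itv shade_open j r /\ c < r < d.
      by case: he nj => -> nj; [exact: right_witness|exact: left_witness].
    by move=> [r [h1 h2]]; exists r; split => //; exact: inK.
  move: Kj; rewrite ij -/K KI' /= in_itv/=.
  by case: he => ->; rewrite ltxx ?andbF.
exists c, d; split => //.
apply: shade_component => //; last 2 first.
- by apply: notend; left.
- by apply: notend; right.
by move=> t h; apply: KE; exact: inK.
Unshelve. all: by end_near. Qed.

End RisingSun.

(** * Level sets of one-sided averages *)

Section LevelSets.
Context {R : realType}.
Local Notation mu := (@lebesgue_measure R).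
Variables (a b C : R) (phi : R -> R).
Hypothesis ab : a < b.
Hypothesis iphi : mu.-integrable `]a, b[ (EFin \o phi).
Hypothesis iexp : mu.-integrable `]a, b[ (EFin \o (expR \o phi)).
Hypothesis char : forall c d, a <= c -> c < d -> d <= b ->
  \int[mu]_(t in `]c, d[) expR (phi t) <=
  C * expR ((\int[mu]_(t in `]c, d[) phi t) / (d - c)) * (d - c).

Definition meas (S : set R) : R := fine (mu S).

(** What level sets have in common with the whole interval taken at its own mean, so that the
    induction over levels can start there. *)
Definition admset (al : R) (S : set R) : Prop := [/\ measurable S, S `<=` `]a, b[,
  \int[mu]_(t in S) phi t = al * meas S,
  \int[mu]_(t in S) expR (phi t) <= C * expR al * meas S
  & {ae mu, forall t, `]a, b[%classic t -> ~ S t -> phi t <= al}].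

Let phi0 := phi \_ `]a, b[.
Let J t := \int[mu]_(s in `[a, t]) phi0 s.

Let iphi0 S : measurable S -> mu.-integrable S (EFin \o phi0).
Proof.
move=> mS; have : mu.-integrable setT (EFin \o phi0).
  rewrite /phi0 -restrict_EFin.
  by apply/integrable_restrict => //; rewrite setTI.
exact: integrableS.
Qed.

Let JE c d : a <= c -> c < d -> d <= b -> \int[mu]_(t in `]c, d[) phi t = J d - J c.
Proof.
move=> ac cd db.
rewrite /J (@Rintegral_itvB R phi0 (BLeft a) (BRight d) c) ?bnd_simp//; last 2 first.
- by apply: iphi0.
- exact: ltW.
rewrite -Rintegral_itv_bndo_bndc; last exact: iphi0.
apply: eq_Rintegral => t; rewrite inE/= in_itv/= => /andP[ct td].
by rewrite /phi0 patchE mem_set//= in_itv/= (le_lt_trans ac ct) (lt_le_trans td db).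
Qed.

Let J_cont : {within `[a, b], continuous J}.
Proof. by apply: parameterized_integral_continuous; [exact: ltW|exact: iphi0]. Qed.

Let J_a : J a = 0. Proof. by rewrite /J set_itv1 Rintegral_set1. Qed.

(* The points t for which the average of phi over some [t, s], or over some
   [a, s] with s > t, exceeds al; on each component the average of phi is al. *)
Definition level al := shade (fun t => J t - al * (t - a)) a b.

Let Phi_cont al : {within `[a, b], continuous (fun t => J t - al * (t - a))}.
Proof.
have h : {within `[a, b], continuous (fun t => al * (t - a))}.
  apply: continuous_subspaceT => x; apply: cvgM; first exact: cvg_cst.
  by apply: cvgB; [exact: cvg_id|exact: cvg_cst].
by move=> t; apply: cvgB; [exact: J_cont|exact: h].
Qed.

Lemma level_sub al be : al <= be -> level be `<=` level al.
Proof.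
move=> albe t [hab [s [hs h]]]; split => //; exists s; split => //.
have /andP[ts sb] := hs; have /andP[at_ tb] := hab.
have h1 : 0 <= (be - al) * (s - t) by rewrite mulr_ge0// subr_ge0// ltW.
have h2 : 0 <= (be - al) * (s - a) by rewrite mulr_ge0// subr_ge0// ltW// (lt_trans at_).
by case: h => h; [left|right]; lra.
Qed.

Section Level.
Variable al : R.
Hypothesis hal : J b <= al * (b - a).

Let Phi_a : J a - al * (a - a) = 0. Proof. by rewrite J_a; lra. Qed.
Let Phi_b : J b - al * (b - a) <= 0. Proof. by rewrite subr_le0. Qed.

Let oL : open (level al) := shade_open ab (@Phi_cont al).

Lemma measurable_level : measurable (level al).
Proof. exact: open_measurable. Qed.

Lemma level_subQ : level al `<=` `]a, b[.
Proof. by move=> t [h _]; rewrite /= in_itv. Qed.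

Let K i := open_disjoint_itv oL i.

Let K_spec i : K i = set0 \/ exists c d, [/\ a <= c, c < d, d <= b,
  K i = `]c, d[%classic & J d - J c = al * (d - c)].
Proof.
have [|[c [d [h1 h2 h3 h4 h5]]]] := shade_itv ab (@Phi_cont al) Phi_a Phi_b i; [by left|right].
by exists c, d; split => //; lra.
Qed.

Let levelE : level al = \bigcup_i K i := open_disjoint_itv_bigcup oL.

Let mK i : measurable (K i).
Proof. by apply: open_measurable; exact: open_disjoint_itv_open. Qed.

Let meas_itv c d : c < d -> fine (mu `]c, d[) = d - c.
Proof. by move=> cd; rewrite lebesgue_measure_itv/= lte_fin cd. Qed.

Let icst (c : R) (S : set (measurableTypeR R)) : measurable S -> S `<=` `]a, b[ -> mu.-integrable S (EFin \o cst c).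
Proof.
move=> mS SQ; apply: (@integrableS _ _ _ mu `[a, b]%classic) => //.
  by apply: subset_trans SQ _; exact: subset_itv_oo_cc.
by apply: continuous_itv_integrable => x; exact: cvg_cst.
Qed.

Let iS (f : R -> R) (S : set (measurableTypeR R)) : mu.-integrable `]a, b[ (EFin \o f) ->
  measurable S -> S `<=` `]a, b[ -> mu.-integrable S (EFin \o f).
Proof. by move=> i_f mS SQ; apply: (@integrableS _ _ _ mu `]a, b[%classic). Qed.

Let intE (S : set (measurableTypeR R)) (f : R -> R) : measurable S -> mu.-integrable S (EFin \o f) ->
  (\int[mu]_(t in S) (f t)%:E = (\int[mu]_(t in S) f t)%:E)%E.
Proof. by move=> mS i_f; rewrite /Rintegral fineK//; exact: integrable_fin_num. Qed.

Let iB (f : R -> R) (c : R) (S : set (measurableTypeR R)) : mu.-integrable `]a, b[ (EFin \o f) ->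
  measurable S -> S `<=` `]a, b[ -> mu.-integrable S (EFin \o (fun t => f t - c)).
Proof.
move=> i_f mS SQ; have := integrableB mS (iS i_f mS SQ) (icst c mS SQ).
by apply: eq_integrable.
Qed.

Let level_bigcup (f : R -> R) : mu.-integrable `]a, b[ (EFin \o f) ->
  (\int[mu]_(t in level al) (f t)%:E = \sum_(i <oo) \int[mu]_(t in K i) (f t)%:E)%E.
Proof.
move=> i_f; rewrite levelE integral_bigcup//.
  exact: (@open_disjoint_itv_trivIset _ _ oL).
by apply: (iS i_f); rewrite -levelE; [exact: measurable_level|exact: level_subQ].
Qed.

Let cstE (S : set (measurableTypeR R)) (c : R) : measurable S ->
  c * meas S = \int[mu]_(t in S) (cst c) t.
Proof. by move=> mS; rewrite Rintegral_cst. Qed.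

Lemma level_phi : \int[mu]_(t in level al) phi t = al * meas (level al).
Proof.
have mL := measurable_level; have sL := level_subQ.
have mQ : measurable (`]a, b[%classic : set R) by [].
apply/eqP; rewrite -subr_eq0 (cstE al mL).
rewrite -RintegralB//; [|exact: iS|exact: icst].
apply/eqP; rewrite /Rintegral (level_bigcup (iB al iphi mQ _))//.
rewrite eseries0// => i _ _.
have [->|[c [d [ac cd db -> e]]]] := K_spec i; first by rewrite integral_set0.
have sub : `]c, d[ `<=` `]a, b[ by apply: subset_itv; rewrite bnd_simp.
have mI : measurable (`]c, d[%classic : set R) by [].
rewrite (intE mI (iB al iphi mI sub)); congr EFin.
rewrite RintegralB//; [|exact: iS|exact: icst].
by rewrite Rintegral_cst// meas_itv// JE// e subrr.
Qed.

(** The components all have mean al, so the bounds given by [char] share the factor C e^al and add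
    up. *)
Lemma level_exp : \int[mu]_(t in level al) expR (phi t) <= C * expR al * meas (level al).
Proof.
have mL := measurable_level; have sL := level_subQ.
have mQ : measurable (`]a, b[%classic : set R) by [].
rewrite -subr_le0 (cstE (C * expR al) mL).
rewrite -RintegralB//; [|exact: iS|exact: icst].
rewrite -lee_fin -(intE mL (iB (C * expR al) iexp mL sL)).
rewrite (level_bigcup (iB (C * expR al) iexp mQ _))//.
have np i : (\int[mu]_(t in K i) (expR (phi t) - C * expR al)%:E <= 0)%E.
  have [->|[c [d [ac cd db -> e]]]] := K_spec i; first by rewrite integral_set0.
  have sub : `]c, d[ `<=` `]a, b[ by apply: subset_itv; rewrite bnd_simp.
  have mI : measurable (`]c, d[%classic : set R) by [].
  rewrite (intE mI (iB (C * expR al) iexp mI sub)) lee_fin.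
  rewrite RintegralB//; [|exact: iS|exact: icst].
  rewrite Rintegral_cst// meas_itv// subr_le0.
  have := char ac cd db; rewrite JE// e mulfK// gt_eqF// subr_gt0//.
by apply: npeseries_le0 => i _ _; exact: np.
Qed.

(** Lebesgue differentiation: where the derivative of J is phi t > al, some average over [t, s]
    exceeds al. *)
Lemma level_ae : {ae mu, forall t, `]a, b[%classic t -> ~ level al t -> phi t <= al}.
Proof.
have loc : locally_integrable setT phi0.
  by apply: integrable_locally.
have /= := @FTC1 R phi0 (BLeft a) (fun y => iphi0 (measurable_itv _)) loc.
apply: filterS; first exact: (ae_filter_ringOfSetsType mu).
move=> t /= H; rewrite in_itv/= => /andP[at_ tb] nt.
have [|dJ eJ] := H _; first by rewrite lte_fin.
rewrite leNgt; apply/negP => lt_phi.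
have phi0t : phi0 t = phi t by rewrite /phi0 patchE mem_set//= in_itv/= at_.
move: eJ; rewrite phi0t derive1E => eJ.
have cJ : h^-1 *: (J (h *: (1 : R) + t) - J t) @[h --> (0 : R)^'] --> phi t.
  by rewrite -eJ; exact: dJ.
have n1 : \forall h \near (0 : R)^', al < h^-1 *: (J (h *: (1 : R) + t) - J t).
  exact: (cvgr_gt _ cJ).
have bt0 : 0 < b - t by rewrite subr_gt0.
have [h [+ /andP[h0 hb]]] := @right_witness R (fun h => h != 0 -> al < h^-1 *: (J (h *: (1 : R) + t) - J t)) 0 (b - t) bt0 n1.
rewrite gt_eqF// => /(_ isT); rewrite /GRing.scale/= mulr1 -ltr_pdivrMl ?invr_gt0// invrK => hJ.
apply: nt; split; first by rewrite at_.
by exists (h + t); split; [apply/andP; split; lra|left; lra].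
Qed.

Lemma level_adm : admset al (level al).
Proof.
split; [exact: measurable_level|exact: level_subQ|exact: level_phi|exact: level_exp|exact: level_ae].
Qed.

End Level.

Lemma level_admset al : \int[mu]_(t in `]a, b[) phi t <= al * (b - a) -> admset al (level al).
Proof. by rewrite JE// J_a subr0 => /level_adm. Qed.

End LevelSets.

(** * The lower bound *)

Section IntegralToolbox.
Context {R : realType}.
Local Notation mu := (@lebesgue_measure R).
Implicit Types (S : set (measurableTypeR R)) (g h : R -> R).

Lemma Rintegral_ae_ge0 S g : measurable S -> mu.-integrable S (EFin \o g) ->
  {ae mu, forall t, S t -> 0 <= g t} -> 0 <= \int[mu]_(t in S) g t.
Proof.
move=> mS ig h; rewrite /Rintegral.
rewrite (@ae_eq_integral _ _ _ mu S (EFin \o (fun t => `|g t|)) (EFin \o g))//.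
- by apply: fine_ge0; apply: integral_ge0 => t _; rewrite /= lee_fin.
- exact: measurable_int ig.
- apply/measurable_EFinP; apply: measurableT_comp => //.
  by apply/measurable_EFinP; exact: measurable_int ig.
- move: h; apply: filterS.
  by move=> t h St; rewrite /= ger0_norm// h.
Qed.

Lemma Rintegral_setD S S' g : measurable S -> measurable S' -> S' `<=` S ->
  mu.-integrable S (EFin \o g) ->
  \int[mu]_(t in S) g t = \int[mu]_(t in S') g t + \int[mu]_(t in S `\` S') g t.
Proof.
move=> mS mS' sub ig.
have e : S = S' `|` (S `\` S') by rewrite setDUK.
rewrite {1}e Rintegral_setU//; first exact: measurableD.
  by rewrite -e.
by apply/disj_setPS => t [S't [_ nS't]]; exact: nS't S't.
Qed.

Lemma Rintegral_null S g : measurable S -> fine (mu S) = 0 -> mu S != +oo%E ->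
  mu.-integrable S (EFin \o g) -> \int[mu]_(t in S) g t = 0.
Proof.
move=> mS m0 moo ig; rewrite /Rintegral.
have mu0 : mu S = 0%E.
  by rewrite -[mu S]fineK ?m0// ge0_fin_numE// lt_neqAle moo leey.
by rewrite null_set_integral//; exact: measurable_int ig.
Qed.

End IntegralToolbox.

Section LowerBound.
Context {R : realType}.
#[local] Opaque xi.
Local Notation mu := (@lebesgue_measure R).
Variables (a b C : R) (phi : R -> R) (f : R -> R) (B : R * R -> R).
Hypothesis f_ge0 : forall s, 0 <= f s.
Hypothesis ab : a < b.
Hypothesis iphi : mu.-integrable `]a, b[ (EFin \o phi).
Hypothesis iexp : mu.-integrable `]a, b[ (EFin \o (expR \o phi)).
Hypothesis ipow : mu.-integrable `]a, b[ (EFin \o (f \o phi)).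
Hypothesis char : forall c d, a <= c -> c < d -> d <= b ->
  \int[mu]_(t in `]c, d[) expR (phi t) <=
  C * expR ((\int[mu]_(t in `]c, d[) phi t) / (d - c)) * (d - c).
Implicit Types (S : set (measurableTypeR R)) (al be : R).

Local Notation Q := (`]a, b[%classic : set (measurableTypeR R)).

Let mQ : measurable Q. Proof. by []. Qed.

Let iS S (h : R -> R) : mu.-integrable Q (EFin \o h) ->
  measurable S -> S `<=` Q -> mu.-integrable S (EFin \o h).
Proof. by move=> i_f mS SQ; apply: (@integrableS _ _ _ mu Q). Qed.

Let icst (c : R) : mu.-integrable Q (EFin \o cst c).
Proof.
apply: (@integrableS _ _ _ mu (`[a, b]%classic : set (measurableTypeR R))) => //.
  exact: subset_itv_oo_cc.
by apply: continuous_itv_integrable => x; exact: cvg_cst.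
Qed.

Let muQ S : S `<=` Q -> measurable S -> (mu S <= (b - a)%:E)%E.
Proof.
move=> SQ mS; apply: (@le_trans _ _ (mu Q)).
  by apply: le_measure; rewrite ?inE.
by rewrite lebesgue_measure_itv/= lte_fin ab.
Qed.

Let mu_fin S : S `<=` Q -> measurable S -> mu S \is a fin_num.
Proof.
move=> SQ mS; rewrite ge0_fin_numE//.
by apply: le_lt_trans (muQ SQ mS) _; rewrite ltry.
Qed.

Let meas_ge0 S : 0 <= meas S.
Proof. by rewrite /meas fine_ge0. Qed.

Let meas_le S S' : S' `<=` S -> measurable S -> measurable S' -> S `<=` Q ->
  meas S' <= meas S.
Proof.
move=> sub mS mS' SQ; rewrite /meas fine_le//.
- by apply: mu_fin => //; exact: subset_trans SQ.
- exact: mu_fin.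
- by apply: le_measure; rewrite ?inE.
Qed.

Let meas_leQ S : S `<=` Q -> measurable S -> meas S <= b - a.
Proof.
move=> SQ mS; have := muQ SQ mS.
by rewrite /meas -lee_fin fineK//; exact: mu_fin.
Qed.

Let cstE S (c : R) : measurable S -> \int[mu]_(t in S) (cst c) t = c * meas S.
Proof. by move=> mS; rewrite Rintegral_cst. Qed.

Definition affphi A A1 K t := A + A1 * phi t + K * expR (phi t).

Let iaff A A1 K : mu.-integrable Q (EFin \o affphi A A1 K).
Proof.
have h1 := integrableD mQ (icst A) (integrableZl mQ A1 iphi).
have h2 := integrableD mQ h1 (integrableZl mQ K iexp).
by apply: eq_integrable h2.
Qed.

Let int_aff A A1 K S : measurable S -> S `<=` Q ->
  \int[mu]_(t in S) affphi A A1 K t =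
  A * meas S + A1 * \int[mu]_(t in S) phi t + K * \int[mu]_(t in S) expR (phi t).
Proof.
move=> mS SQ; rewrite /affphi.
have i1 := iS iphi mS SQ; have i2 := iS iexp mS SQ; have i0 := iS (icst A) mS SQ.
have j1 : mu.-integrable S (EFin \o (fun t => A1 * phi t)).
  by apply: eq_integrable (integrableZl mS A1 i1).
have j2 : mu.-integrable S (EFin \o (fun t => K * expR (phi t))).
  by apply: eq_integrable (integrableZl mS K i2).
have j0 : mu.-integrable S (EFin \o (fun t => A + A1 * phi t)).
  by apply: eq_integrable (integrableD mS i0 j1).
rewrite RintegralD// RintegralD// (RintegralZl A1 mS i1) (RintegralZl K mS i2).
by rewrite -(cstE A mS).
Qed.

Definition ptS al S : R * R := (al, (\int[mu]_(t in S) expR (phi t)) / meas S).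

(* Bellman function at the averages over S plus the cost already paid off S:
   this does not decrease when al grows and S is the level set of al. *)
Definition valS al S : R :=
  meas S * B (ptS al S) + \int[mu]_(t in Q `\` S) f (phi t).

Let adm al S := admset a b C phi al S.

Let exp_lower al S : adm al S -> expR al * meas S <= \int[mu]_(t in S) expR (phi t).
Proof.
case=> mS SQ e1 _ _.
have : \int[mu]_(t in S) affphi (expR al * (1 - al)) (expR al) 0 t <= \int[mu]_(t in S) expR (phi t).
  apply: le_Rintegral => //; [exact: iS|exact: iS|].
  by move=> t _; rewrite /affphi; have := expR_ge_tangent al (phi t); lra.
by rewrite int_aff// e1; lra.
Qed.

Lemma ptS_Omega al S : adm al S -> 0 < meas S -> Omega C (ptS al S).
Proof.
move=> h m0; have := exp_lower h; case: h => _ _ _ h _ h'.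
by rewrite /Omega /ptS/= ler_pdivlMr// ler_pdivrMr// h'.
Qed.

Let compl_split S S' : measurable S -> measurable S' -> S `<=` Q -> S' `<=` S ->
  \int[mu]_(t in Q `\` S') f (phi t) =
  \int[mu]_(t in Q `\` S) f (phi t) + \int[mu]_(t in S `\` S') f (phi t).
Proof.
move=> mS mS' SQ sub; have S'Q := subset_trans sub SQ.
have iP : mu.-integrable Q (EFin \o (fun t => f (phi t))) by [].
have h1 := Rintegral_setD mQ mS SQ iP.
have h2 := Rintegral_setD mQ mS' S'Q iP.
have h3 := Rintegral_setD mS mS' sub (iS iP mS SQ).
by lra.
Qed.

(** The plane of x_S integrates over S to exactly |S| b(x_S), because it is affine in the averages.
    Its integral is split: on S minus S' it is below f since phi <= be there, and on S' it is taken
    at x_S', where it exceeds b by at most the quadratic error. *)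
Lemma val_step al be S S' d0 E : adm al S -> adm be S' -> S' `<=` S ->
  al <= be -> be <= al + d0 -> 0 <= E ->
  (forall x, Omega C x -> x.1 = al -> exists A A1 K, [/\ aff A A1 K x = B x,
    forall s, s <= al + d0 -> aff A A1 K (s, expR s) <= f s
  & forall y, Omega C y -> y.1 = be -> aff A A1 K y <= B y + E * (be - al) ^+ 2]) ->
  valS al S <= valS be S' + E * (b - a) * (be - al) ^+ 2.
Proof.
move=> hS hS' sub albe bed E0 loc.
have [mS SQ e1 e2 ae1] := hS; have [mS' S'Q e1' e2' ae1'] := hS'.
have err0 : 0 <= E * (b - a) * (be - al) ^+ 2.
  by rewrite mulr_ge0 ?sqr_ge0// mulr_ge0// subr_ge0 ltW.
have mD : measurable (S `\` S') by exact: measurableD.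
have DQ : S `\` S' `<=` Q by move=> t [/SQ].
have pow0 : 0 <= \int[mu]_(t in S `\` S') f (phi t).
  by apply: Rintegral_ge0 => t _; exact: f_ge0.
rewrite /valS (compl_split mS mS' SQ sub).
have [mS0|mS0] := eqVneq (meas S) 0.
  have -> : meas S' = 0.
    by apply/eqP; rewrite eq_le meas_ge0 andbT -mS0; exact: meas_le.
  rewrite mS0 !mul0r.
  by rewrite !add0r -addrA lerDl; exact: addr_ge0 pow0 err0.
have m0 : 0 < meas S by rewrite lt_neqAle eq_sym mS0 meas_ge0.
have [A [A1 [K [hx hlow hy]]]] := loc (ptS al S) (ptS_Omega hS m0) erefl.
have step1 : meas S * B (ptS al S) = \int[mu]_(t in S) affphi A A1 K t.
  rewrite -hx int_aff// e1 /aff /ptS /=.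
  have : meas S * (meas S)^-1 = 1 by rewrite mulfV.
  set I := \int[mu]_(t in S) _; set m := meas S; move=> mm.
  have : K * I * (m * m^-1) = K * I by rewrite mm mulr1.
  by lra.
have step2 := Rintegral_setD mS mS' sub (iS (iaff A A1 K) mS SQ).
have step3 : \int[mu]_(t in S `\` S') affphi A A1 K t <= \int[mu]_(t in S `\` S') f (phi t).
  have ip : mu.-integrable (S `\` S') (EFin \o (fun t => f (phi t))) by apply: iS.
  have ia : mu.-integrable (S `\` S') (EFin \o affphi A A1 K) by apply: iS.
  rewrite -subr_ge0 -RintegralB//; apply: Rintegral_ae_ge0 => //.
    by apply: eq_integrable (integrableB mD ip ia).
  move: ae1'; apply: filterS; first exact: (ae_filter_ringOfSetsType mu).
  move=> t h [St nS't]; rewrite subr_ge0.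
  have ht : phi t <= be by apply: h => //; exact: SQ.
  by have := hlow (phi t); rewrite /aff /affphi/=; apply; exact: le_trans ht bed.
have step4 : \int[mu]_(t in S') affphi A A1 K t <=
    meas S' * B (ptS be S') + E * (b - a) * (be - al) ^+ 2.
  have [mS'0|mS'0] := eqVneq (meas S') 0.
    have moo : mu S' != +oo%E.
      by have := mu_fin S'Q mS'; rewrite fin_numE => /andP[].
    rewrite (Rintegral_null mS' mS'0 moo (iS (iaff A A1 K) mS' S'Q)).
    by rewrite mS'0 mul0r add0r.
  have m'0 : 0 < meas S' by rewrite lt_neqAle eq_sym mS'0 meas_ge0.
  have h := hy (ptS be S') (ptS_Omega hS' m'0) erefl.
  have -> : \int[mu]_(t in S') affphi A A1 K t = meas S' * aff A A1 K (ptS be S').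
    rewrite int_aff// e1' /aff /ptS /=.
    have : meas S' * (meas S')^-1 = 1 by rewrite mulfV.
    set I := \int[mu]_(t in S') _; set m := meas S'; move=> mm.
    have : K * I * (m * m^-1) = K * I by rewrite mm mulr1.
    by lra.
  have h2 := ler_wpM2l (meas_ge0 S') h.
  have h3 : meas S' * (E * (be - al) ^+ 2) <= (b - a) * (E * (be - al) ^+ 2).
    by rewrite ler_wpM2r ?meas_leQ// mulr_ge0// sqr_ge0.
  by lra.
move: step1 step2 step3 step4.
move: (meas S * _) (meas S' * _) (E * (b - a) * _) => X Y Z.
move: (\int[mu]_(t in S) affphi _ _ _ t) (\int[mu]_(t in S') affphi _ _ _ t).
move: (\int[mu]_(t in S `\` S') affphi _ _ _ t) (\int[mu]_(t in S `\` S') f _).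
move: (\int[mu]_(t in Q `\` S) f _) => I1 I2 I3 I4 I5 -> -> h1 h2.
by rewrite [X in _ <= X](_ : _ = I1 + (Y + Z + I3)); [rewrite addrC lerD2l lerD|]; lra.
Qed.

Let x1 := (\int[mu]_(t in Q) phi t) / (b - a).

Let ba0 : 0 < b - a. Proof. by rewrite subr_gt0. Qed.

Let measQ : meas Q = b - a.
Proof. by rewrite /meas lebesgue_measure_itv/= lte_fin ab. Qed.

Let adm_Q : adm x1 Q.
Proof.
split => //.
- by rewrite measQ /x1 mulfVK// gt_eqF.
- by rewrite measQ; exact: char.
- by apply: aeW => t Qt nQ; case: nQ.
Qed.

Let adm_level al : x1 <= al -> adm al (level a b phi al).
Proof.
move=> h; apply: (level_admset ab iphi iexp char).
by move: h; rewrite /x1 ler_pdivrMr.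
Qed.

Lemma val_chain M d0 E : x1 < M -> 0 < d0 -> 0 <= E ->
  (forall x, Omega C x -> x1 <= x.1 -> exists A A1 K, [/\ aff A A1 K x = B x,
    forall s, s <= x.1 + d0 -> aff A A1 K (s, expR s) <= f s
  & forall y, Omega C y -> x.1 <= y.1 -> y.1 <= x.1 + d0 -> y.1 <= M ->
      aff A A1 K y <= B y + E * (y.1 - x.1) ^+ 2]) ->
  valS x1 Q <= valS M (level a b phi M).
Proof.
move=> xM d00 E0 loc.
pose L := M - x1; have L0 : 0 < L by rewrite subr_gt0.
have chain n (d : R) : 0 < d -> d <= d0 -> x1 + n.+1%:R * d <= M ->
    valS x1 Q <= valS (x1 + n.+1%:R * d) (level a b phi (x1 + n.+1%:R * d))
      + n.+1%:R * (E * (b - a) * d ^+ 2).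
  move=> dp dd0; elim: n => [|n IH] hM.
    have h1 : x1 <= x1 + 1 * d by lra.
    have := @val_step x1 (x1 + 1 * d) Q (level a b phi (x1 + 1 * d)) d0 E adm_Q (adm_level h1) _ h1 _ E0 _.
    have -> : x1 + 1 * d - x1 = d by lra.
    move=> H; rewrite mul1r in H *; rewrite mul1r; apply: H.
    - exact: level_subQ.
    - by lra.
    - move=> x ox ex; have [|A [A1 [K [g1 g2 g3]]]] := loc x ox; first by rewrite ex.
      exists A, A1, K; split => //; first by rewrite -ex.
      move=> y oy ey; have := g3 y oy; rewrite ex ey.
      have -> : x1 + d - x1 = d by lra.
      by apply; lra.
  have nn : n.+2%:R * d = n.+1%:R * d + d by rewrite -(natr1 n.+1); lra.
  set al := x1 + n.+1%:R * d; have be_al : x1 + n.+2%:R * d = al + d by rewrite nn /al; lra.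
  have nd0 : 0 <= n.+1%:R * d by rewrite mulr_ge0// ltW.
  have xal : x1 <= al by rewrite /al; lra.
  apply: le_trans (IH _) _; first by move: hM; rewrite be_al -/al; lra.
  rewrite -/al be_al.
  have h1 : al <= al + d by lra.
  have h2 : x1 <= al + d by lra.
  have := @val_step al (al + d) (level a b phi al) (level a b phi (al + d)) d0 E
    (adm_level xal) (adm_level h2) _ h1 _ E0 _.
  have -> : al + d - al = d by lra.
  have -> : n.+2%:R * (E * (b - a) * d ^+ 2) = n.+1%:R * (E * (b - a) * d ^+ 2) + E * (b - a) * d ^+ 2.
    by rewrite -(natr1 n.+1); lra.
  move=> H; suff : valS al (level a b phi al) <= valS (al + d) (level a b phi (al + d)) + E * (b - a) * d ^+ 2 by lra.
  apply: H.
  - exact: level_sub.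
  - by lra.
  - move=> x ox ex; have [|A [A1 [K [g1 g2 g3]]]] := loc x ox; first by rewrite ex.
    exists A, A1, K; split => //; first by rewrite -ex.
    move=> y oy ey; have := g3 y oy; rewrite ex ey.
    have -> : al + d - al = d by lra.
    by apply; move: hM; rewrite be_al; lra.
apply/ler_addgt0Pr => e e0.
(* With N steps of length d = L / N the errors sum to E (b - a) L^2 / N. The two terms of X ensure d
   <= d0 and a total error of at most e. *)
pose X := L / d0 + E * (b - a) * L ^+ 2 / e.
have X0 : 0 <= E * (b - a) * L ^+ 2 / e.
  apply: divr_ge0 (ltW e0); apply: mulr_ge0 (sqr_ge0 _).
  exact: mulr_ge0 E0 (ltW ba0).
have X1 : 0 <= L / d0 by rewrite divr_ge0 ?(ltW L0)// ltW.
have := archi_boundP (addr_ge0 X1 X0); set N := Num.Def.archi_bound _ => hN.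
have N1 : X < N.+1%:R by apply: lt_trans hN _; rewrite ltr_nat.
have Np : 0 < N.+1%:R :> R by rewrite ltr0n.
pose d := L / N.+1%:R.
have dN : N.+1%:R * d = L by rewrite /d mulrC mulfVK// gt_eqF.
have dp : 0 < d by rewrite divr_gt0.
have dd0 : d <= d0.
  rewrite /d ler_pdivrMr// -ler_pdivrMl// mulrC.
  by apply/ltW; apply: le_lt_trans N1; rewrite /X lerDl.
have eM : x1 + N.+1%:R * d = M by rewrite dN /L; lra.
have := chain N d dp dd0; rewrite eM lexx => /(_ isT) H; apply: le_trans H _.
rewrite lerD2l.
have -> : N.+1%:R * (E * (b - a) * d ^+ 2) = E * (b - a) * L * d.
  by rewrite -[in RHS]dN; lra.
have N2 : E * (b - a) * L ^+ 2 / e <= N.+1%:R.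
  by apply/ltW; apply: le_lt_trans N1; rewrite /X lerDr.
rewrite ler_pdivrMr// in N2.
rewrite /d (_ : E * (b - a) * L * (L / N.+1%:R) = E * (b - a) * L ^+ 2 / N.+1%:R); last by rewrite expr2 !mulrA.
by rewrite ler_pdivrMr// [leRHS]mulrC.
Qed.

(** Jensen's inequality on S through one supporting line of f. *)
Lemma adm_tangent al S A A1 : adm al S -> (forall s, A + A1 * s <= f s) ->
  (A + A1 * al) * meas S <= \int[mu]_(t in S) f (phi t).
Proof.
case=> mS SQ e1 _ _ h.
have : \int[mu]_(t in S) affphi A A1 0 t <= \int[mu]_(t in S) f (phi t).
  apply: le_Rintegral => //; [exact: iS|exact: iS|].
  by move=> t _; rewrite /affphi; have := h (phi t); lra.
by rewrite int_aff// e1; lra.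
Qed.

Let itail n := level a b phi n%:R.

Let itail_adm n : x1 <= n%:R -> adm n%:R (itail n).
Proof. exact: adm_level. Qed.

Let itail_cap : exists N : nat, forall n, (N <= n)%N -> x1 <= n%:R.
Proof.
have := archi_boundP (normr_ge0 x1); set N := Num.Def.archi_bound _ => hN.
exists N => n Nn; apply: le_trans (ler_norm _) _; apply: ltW.
by apply: lt_le_trans hN _; rewrite ler_nat.
Qed.

(** Markov's inequality n |S_n| <= int |phi| makes the intersection of the decreasing level sets
    null, and monotone convergence on the complements does the rest. *)
Lemma level_tail e n0 : 0 < e ->
  exists2 n : nat, (n0 <= n)%N & \int[mu]_(t in level a b phi n%:R) f (phi t) < e.
Proof.
move=> e0; have [N hN] := itail_cap.
pose S n : set (measurableTypeR R) := itail (n + N); have admS n : adm (n + N)%:R (S n).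
  by apply: itail_adm; apply: hN; rewrite leq_addl.
have mS n : measurable (S n) by case: (admS n).
have SQ n : S n `<=` Q by case: (admS n).
have nS n m : (n <= m)%N -> S m `<=` S n.
  by move=> nm; apply: level_sub => //; rewrite ler_nat leq_add2r.
pose F n : set (measurableTypeR R) := Q `\` S n.
have mF n : measurable (F n) by exact: measurableD.
have ndF : nondecreasing_seq F.
  by move=> n m nm; apply/subsetPset; apply: setDS; exact: nS.
have ipf : mu.-integrable Q (EFin \o (fun t => f (phi t))) by [].
have Fcup : \bigcup_i F i = Q `\` \bigcap_i S i.
  apply/seteqP; split => t; first by case=> i _ [Qt nS_t]; split => // /(_ i I).
  by case=> Qt /existsNP[i /not_implyP[_ nSt]]; exists i.
have mcap : measurable (\bigcap_i S i) by apply: bigcapT_measurable.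
have capQ : \bigcap_i S i `<=` Q by move=> t /(_ 0 I); exact: SQ.
have cap0 : meas (\bigcap_i S i) = 0.
  apply/eqP; rewrite eq_le meas_ge0 andbT.
  apply/ler_addgt0Pr => d d0; rewrite add0r.
  pose A := \int[mu]_(t in Q) `|phi t|.
  have hA n : n%:R * meas (S n) <= A.
    have [m1 q1 e1 _ _] := admS n.
    have : (n + N)%:R * meas (S n) <= A.
      have hh := @le_normr_Rintegral _ (measurableTypeR R) R mu (S n) phi m1 (iS iphi m1 q1).
      have hh0 := ler_norm (\int[mu]_(t in S n) phi t).
      rewrite -e1; apply: (le_trans hh0); apply: (le_trans hh).
      have iabs : mu.-integrable Q (EFin \o (fun t => `|phi t|)).
        by have := integrable_norm iphi.
      rewrite /A (Rintegral_setD mQ m1 q1 iabs) lerDl.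
      by apply: Rintegral_ge0.
    by move=> hm; apply: le_trans hm; rewrite ler_wpM2r// ler_nat leq_addr.
  have A0 : 0 <= A by apply: Rintegral_ge0.
  have := archi_boundP (divr_ge0 A0 (ltW d0)); set n := Num.Def.archi_bound _ => hn.
  apply: (@le_trans _ _ (meas (S n))); first by apply: meas_le => // t; apply.
  rewrite leNgt; apply/negP => lt_d.
  have n0' : 0 < n%:R :> R by apply: le_lt_trans hn; exact: divr_ge0 A0 (ltW d0).
  have := hA n; rewrite leNgt => /negP; apply.
  by move: hn; rewrite ltr_pdivrMr// => /lt_trans; apply; rewrite ltr_pM2l.
have moo : mu (\bigcap_i S i) != +oo%E.
  by have := mu_fin capQ mcap; rewrite fin_numE => /andP[].
have Iall : \int[mu]_(t in \bigcup_i F i) f (phi t) = \int[mu]_(t in Q) f (phi t).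
  rewrite Fcup (Rintegral_setD mQ mcap capQ ipf).
  by rewrite (Rintegral_null mcap cap0 moo (iS ipf mcap capQ)) add0r.
have FQ n : F n `<=` Q by move=> t [].
have UQ : \bigcup_i F i `<=` Q by rewrite Fcup => t [].
have mU : measurable (\bigcup_i F i) by exact: bigcup_measurable.
have cv : (\int[mu]_(t in F i) (f (phi t))%:E)%E @[i --> \oo] -->
    (\int[mu]_(t in Q) f (phi t))%:E.
  rewrite -Iall /Rintegral fineK; last first.
    by apply: integrable_fin_num => //; exact: iS.
  apply: (@ge0_nondecreasing_set_cvg_integral _ _ R F (EFin \o (f \o phi)) mu ndF mF).
    by move=> i; exact: measurable_int (iS ipf (mF i) (FQ i)).
  by move=> i t _; rewrite /= lee_fin.
have cvR : (fine \o (fun i => \int[mu]_(t in F i) (f (phi t))%:E)%E) i @[i --> \oo] -->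
    \int[mu]_(t in Q) f (phi t) by apply: fine_cvg.
have lt_e : \int[mu]_(t in Q) f (phi t) - e < \int[mu]_(t in Q) f (phi t) by lra.
have := cvgr_gt _ cvR _ lt_e.
case=> N' _ hN'; pose m := maxn n0 N'.
exists (m + N)%N; first by rewrite (leq_trans (leq_maxl _ _) (leq_addr _ _)).
have := hN' m; rewrite /= leq_maxr => /(_ isT).
have h := Rintegral_setD mQ (mS m) (SQ m) ipf; rewrite h.
set X := \int[mu]_(t in S m) _; set Y := \int[mu]_(t in _) _.
have -> : fine (\int[mu]_(t in F m) (f (phi t))%:E) = Y by [].
by move: X Y => X Y; lra.
Qed.

Lemma lower_bound :
  (forall M, exists d0 E : R, [/\ 0 < d0, 0 <= E &
    forall x, Omega C x -> x1 <= x.1 -> exists A A1 K, [/\ aff A A1 K x = B x,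
      forall s, s <= x.1 + d0 -> aff A A1 K (s, expR s) <= f s
    & forall y, Omega C y -> x.1 <= y.1 -> y.1 <= x.1 + d0 -> y.1 <= M ->
        aff A A1 K y <= B y + E * (y.1 - x.1) ^+ 2]]) ->
  (exists c x0, 0 <= c /\ forall M, x0 <= M -> exists A A1,
    (forall s, A + A1 * s <= f s) /\
    forall x, Omega C x -> x.1 = M -> B x <= c * (A + A1 * M)) ->
  (b - a) * B (x1, (\int[mu]_(t in Q) expR (phi t)) / (b - a)) <=
  \int[mu]_(t in Q) f (phi t).
Proof.
move=> loc [c [x0 [c0 growth]]].
have vQ : valS x1 Q = (b - a) * B (x1, (\int[mu]_(t in Q) expR (phi t)) / (b - a)).
  by rewrite /valS /ptS measQ setDv Rintegral_set0 addr0.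
rewrite -vQ; apply/ler_addgt0Pr => e e0.
(* The tail integral will be made smaller than e / (c + 1); the 1 covers c = 0. *)
have c1 : 0 < c + 1 by lra.
have [n1 hn1] : exists n1 : nat, forall n : nat, (n1 <= n)%N -> x0 <= n%:R /\ x1 < n%:R.
  have := archi_boundP (addr_ge0 (normr_ge0 x0) (normr_ge0 x1)).
  set n1 := Num.Def.archi_bound _ => h; exists n1 => n le_n.
  have h' : n1%:R <= n%:R :> R by rewrite ler_nat.
  have := ler_norm x0; have := ler_norm x1.
  have := normr_ge0 x0; have := normr_ge0 x1.
  by split; lra.
have [n n1n small] := level_tail n1 (divr_gt0 e0 c1).
have [x0n x1n] := hn1 n n1n.
have [d0 [E [d00 E0 hloc]]] := loc n%:R.
apply: le_trans (val_chain x1n d00 E0 hloc) _.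
have admn := adm_level (ltW x1n).
have [A [A1 [tan hB]]] := growth _ x0n.
have h1 := adm_tangent admn tan.
have [mS SQ _ _ _] := admn.
have ipf : mu.-integrable Q (EFin \o (fun t => f (phi t))) by [].
have h2 := Rintegral_setD mQ mS SQ ipf.
rewrite /valS h2.
have h3 : meas (level a b phi n%:R) * B (ptS n%:R (level a b phi n%:R)) <=
    c * \int[mu]_(t in level a b phi n%:R) f (phi t).
  have [->|m0] := eqVneq (meas (level a b phi n%:R)) 0.
    by rewrite mul0r mulr_ge0//; apply: Rintegral_ge0.
  have m1 : 0 < meas (level a b phi n%:R) by rewrite lt_neqAle eq_sym m0 meas_ge0.
  have := hB _ (ptS_Omega admn m1) erefl.
  move=> /(ler_wpM2l (ltW m1)) /le_trans; apply.
  by rewrite mulrCA ler_wpM2l// mulrC.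
move: small; rewrite ltr_pdivlMr//.
have : 0 <= \int[mu]_(t in level a b phi n%:R) f (phi t) by apply: Rintegral_ge0.
move: h3; set X := _ * B _; set Y := \int[mu]_(t in level _ _ _ _) _.
by move: (\int[mu]_(t in _ `\` _) _) => Z; lra.
Qed.

End LowerBound.

(** * Averages and the A_infty condition in terms of real integrals *)

Section Averages.
Context {R : realType}.
#[local] Opaque xi candidate C0.
Local Notation mu := (@lebesgue_measure R).
Implicit Types (c d : R) (f phi : R -> R).

Lemma integrable_sub (S S' : set (measurableTypeR R)) (g : R -> \bar R) :
  mu.-integrable S g -> measurable S -> measurable S' -> S' `<=` S ->
  mu.-integrable S' g.
Proof. by move=> ig mS mS' sub; apply: (@integrableS _ _ _ mu S). Qed.

Lemma avgE c d f : c < d -> mu.-integrable `[c, d] (EFin \o f) ->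
  avg c d f = ((\int[mu]_(t in `]c, d[) f t) / (d - c))%:E.
Proof.
move=> cd i_f.
have i_o : mu.-integrable `]c, d[ (EFin \o f).
  by apply: (integrable_sub i_f) => //; exact: subset_itv_oo_cc.
have i_oc : mu.-integrable `]c, d] (EFin \o f).
  by apply: (integrable_sub i_f) => //; apply: subset_itv; rewrite bnd_simp.
rewrite /avg Rintegral_itv_bndo_bndc// Rintegral_itv_obnd_cbnd//.
by rewrite mulrC EFinM /Rintegral fineK//; exact: integrable_fin_num.
Qed.

Lemma Ainfty_char_leP a b C phi : a < b ->
  mu.-integrable `[a, b] (EFin \o phi) ->
  mu.-integrable `[a, b] (EFin \o (expR \o phi)) ->
  (Ainfty_char a b (expR \o phi) <= C%:E)%E <->
  forall c d, a <= c -> c < d -> d <= b ->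
  \int[mu]_(t in `]c, d[) expR (phi t) <=
  C * expR ((\int[mu]_(t in `]c, d[) phi t) / (d - c)) * (d - c).
Proof.
move=> ab ip ie.
have E c d : a <= c -> c < d -> d <= b ->
    (avg c d (expR \o phi) * expeR (- avg c d (fun t => ln (expR (phi t)))))%E =
    ((\int[mu]_(t in `]c, d[) expR (phi t)) / (d - c) *
      expR (- ((\int[mu]_(t in `]c, d[) phi t) / (d - c))))%:E.
  move=> ac cd db.
  have sub : `[c, d] `<=` `[a, b] by apply: subset_itv; rewrite bnd_simp.
  have -> : (fun t => ln (expR (phi t))) = phi by apply/funext => t; rewrite expRK.
  have ip2 := integrable_sub ip (measurable_itv _) (measurable_itv _) sub.
  have ie2 := integrable_sub ie (measurable_itv _) (measurable_itv _) sub.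
  rewrite (avgE cd ip2) (avgE cd ie2).
  by rewrite /= EFinM.
have eqv c d : c < d -> ((\int[mu]_(t in `]c, d[) expR (phi t)) / (d - c) *
      expR (- ((\int[mu]_(t in `]c, d[) phi t) / (d - c))) <= C) =
  (\int[mu]_(t in `]c, d[) expR (phi t) <=
  C * expR ((\int[mu]_(t in `]c, d[) phi t) / (d - c)) * (d - c)).
  move=> cd; have dc : 0 < d - c by rewrite subr_gt0.
  by rewrite expRN ler_pdivrMr ?expR_gt0// ler_pdivrMr.
split=> [h c d ac cd db|h].
  rewrite -eqv// -lee_fin -E//; apply: le_trans h; apply: ereal_sup_ubound.
  by exists c, d.
apply: ge_ereal_sup => _ [c [d [ac cd db ->]]].
by rewrite [leLHS]E// lee_fin eqv// h.
Qed.

Lemma powf_convex (p M s : R) : 2 < p ->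
  powf p M + powf1 p M * (s - M) <= powf p s.
Proof.
move=> hp.
have inc t t' : t <= t' -> powf1 p t <= powf1 p t'.
  move=> tt; apply: (@mono_le R (powf1 p) (powf2 p)) => // y _.
    exact: is_derive_powf1.
  exact: powf2_ge0.
have D (y : R) : is_derive y 1 (fun t => powf p t - powf1 p M * (t - M)) (powf1 p y - powf1 p M).
  apply: (is_derive_eq (isD_add (is_derive_powf hp y) (isD_opp (isD_mul (isD_cst _ _)
    (isD_add (isD_id _) (isD_cst _ _)))))); lra.
have D' (y : R) : is_derive y 1 (fun t => - (powf p t - powf1 p M * (t - M))) (- (powf1 p y - powf1 p M)).
  exact: isD_opp (D y).
have [Ms|sM] := leP M s.
  have : powf p M - powf1 p M * (M - M) <= powf p s - powf1 p M * (s - M).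
    apply: (mono_le Ms) => // y /andP[/ltW My _]; by rewrite subr_ge0 inc.
  by rewrite subrr; lra.
have : - (powf p s - powf1 p M * (s - M)) <= - (powf p M - powf1 p M * (M - M)).
  apply: (mono_le (ltW sM)) => // y /andP[_ /ltW yM]; by rewrite opprB subr_ge0 inc.
by rewrite subrr; lra.
Qed.

Lemma test_function_lower p C a b x phi : admissible p C -> a < b ->
  test_functions x C a b phi ->
  ((candidate p C x)%:E <= avg a b (fun t => (`|phi t| `^ p)%R))%E.
Proof.
move=> H0 ab [ip a1 a2 [_ ie _] ch]; have hp := adm_p H0.
have ba0 : 0 < b - a by rewrite subr_gt0.
have mphi : measurable_fun `[a, b] phi.
  by apply/measurable_EFinP; exact: measurable_int ip.
have mpow : measurable_fun `[a, b] (EFin \o (fun t => `|phi t| `^ p)).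
  apply/measurable_EFinP; apply: (@measurableT_comp _ _ _ _ _ _ (@powR R ^~ p)).
    exact: measurable_powR.
  exact: measurableT_comp.
(* If |phi|^p is not integrable its average is +oo and the bound is trivial. *)
have [fin|] := boolP (\int[mu]_(t in `[a, b]) (powf p (phi t))%:E < +oo)%E; last first.
  rewrite -leNgt leye_eq => /eqP h; rewrite /avg h gt0_muley ?leey//.
  by rewrite lte_fin invr_gt0.
have ipow : mu.-integrable `[a, b] (EFin \o (fun t => `|phi t| `^ p)).
  apply/integrableP; split => //; apply: le_lt_trans fin.
  rewrite [X in (X <= _)%E](_ : _ = \int[mu]_(t in `[a, b]) (powf p (phi t))%:E)%E//.
  apply: eq_integral => t _.
  by rewrite /= ger0_norm// powf_ge0.
have sub : `]a, b[ `<=` `[a, b] by exact: subset_itv_oo_cc.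
have char := (Ainfty_char_leP C ab ip ie).1 ch.
rewrite (avgE ab ipow) lee_fin ler_pdivlMr// mulrC.
move: a1 a2; rewrite (avgE ab ip) (avgE ab ie) => -[e1] -[e2].
have ip' : mu.-integrable `]a, b[ (EFin \o phi) by exact: (integrable_sub ip).
have ie' : mu.-integrable `]a, b[ (EFin \o (expR \o phi)) by exact: (integrable_sub ie).
have ipow' : mu.-integrable `]a, b[ (EFin \o (powf p \o phi)) by exact: (integrable_sub ipow).
have := @lower_bound R a b C phi (powf p) (candidate p C) (powf_ge0 p) ab ip' ie' ipow' char.
rewrite e1 [X in (_, X)]e2 -surjective_pairing; apply.
- by move=> M; exact: cand_local.
- have [c [x0 [c0 x00 h]]] := cand_growth H0.
  exists c, x0; split => // M x0M; exists (powf p M - powf1 p M * M), (powf1 p M); split.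
    by move=> s; have := powf_convex M s hp; lra.
  move=> y oy ey; rewrite subrK powf_pos; last by apply: le_trans x0M; exact: ltW.
  by rewrite -ey; apply: h => //; rewrite ey.
Qed.

End Averages.

(** * Integrals of piecewise smooth functions *)

Section PiecewiseIntegrals.
Context {R : realType}.
Local Notation mu := (@lebesgue_measure R).
Implicit Types (S T : set (measurableTypeR R)) (a b c d t : R) (f g F G : R -> R).

Lemma integrable_setU S T (g : R -> \bar R) : measurable S -> measurable T ->
  [disjoint S & T] -> mu.-integrable S g -> mu.-integrable T g ->
  mu.-integrable (S `|` T) g.
Proof.
move=> mS mT dST iS iT.
have mg : measurable_fun (S `|` T) g.
  by apply/measurable_funU => //; split; [exact: measurable_int iS|exact: measurable_int iT].
apply/integrableP; split => //.
have mag : measurable_fun (S `|` T) (fun x => `|g x|)%E by exact: measurableT_comp.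
have -> : (\int[mu]_(x in S `|` T) `|g x| = \int[mu]_(x in S) `|g x| + \int[mu]_(x in T) `|g x|)%E.
  by apply: ge0_integral_setU.
by apply: lte_add_pinfty; [case/integrableP: iS|case/integrableP: iT].
Qed.

Lemma itv_oc_split a t b : a <= t -> t <= b ->
  `]a, b]%classic = (`]a, t]%classic `|` `]t, b]%classic : set (measurableTypeR R)).
Proof. by move=> at_ tb; rewrite -itv_bndbnd_setU ?bnd_simp. Qed.

Lemma itv_oc_disj a t b : [disjoint (`]a, t]%classic : set (measurableTypeR R)) & `]t, b]%classic].
Proof.
apply/disj_setPS => x []; rewrite /= !in_itv/= => /andP[_ xt] /andP[tx _].
by move: (lt_le_trans tx xt); rewrite ltxx.
Qed.

Lemma integrable_cc_of_oc a b f : a <= b ->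
  mu.-integrable `]a, b] (EFin \o f) -> mu.-integrable `[a, b] (EFin \o f).
Proof.
move=> ab i_f.
rewrite -(@setU1itv _ _ (BRight b) a false) ?bnd_simp//.
apply: integrable_setU => //.
- apply/disj_setPS => x [/= ->]; by rewrite /= in_itv/= ltxx.
- apply/integrableP; split; first exact: measurable_fun_set1.
  by rewrite integral_set1.
Qed.

Lemma Rintegral_oc_split a t b f : a <= t -> t <= b ->
  mu.-integrable `]a, b] (EFin \o f) ->
  \int[mu]_(x in `]a, b]) f x = \int[mu]_(x in `]a, t]) f x + \int[mu]_(x in `]t, b]) f x.
Proof.
move=> at_ tb i_f.
rewrite (itv_oc_split at_ tb) Rintegral_setU//; first by rewrite -itv_oc_split.
exact: itv_oc_disj.
Qed.

Section SmoothPiece.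
Variables (a b : R) (f F : R -> R).
Hypothesis ab : a <= b.
Hypothesis cf : forall t, a <= t <= b -> {for t, continuous f}.
Hypothesis dF : forall t : R, a <= t <= b -> is_derive t 1 F (f t).

Let within_cont c : a <= c -> c <= b -> {within `[a, c], continuous f}.
Proof.
move=> ac cb; apply: continuous_in_subspaceT => x /[1!inE]/=; rewrite in_itv/= => /andP[ax xc].
by apply: cf; rewrite ax (le_trans xc).
Qed.

Lemma smooth_integrable : mu.-integrable `[a, b] (EFin \o f).
Proof.
apply: continuous_compact_integrable; first exact: segment_compact.
exact: within_cont.
Qed.

Lemma smooth_integral c : a <= c -> c <= b -> \int[mu]_(x in `]a, c]) f x = F c - F a.
Proof.
move=> ac cb.
have i_f : mu.-integrable `]a, c] (EFin \o f).
  apply: (integrable_sub smooth_integrable) => //.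
  by apply: subset_itv; rewrite bnd_simp.
rewrite Rintegral_itv_obnd_cbnd//.
move: ac; rewrite le_eqVlt => /predU1P[<-|ac].
  by rewrite set_itv1 Rintegral_set1 subrr.
have dF' t : a <= t -> t <= c -> is_derive t (1 : R) F (f t).
  by move=> at_ tc; apply: dF; rewrite at_ (le_trans tc).
rewrite /Rintegral (@continuous_FTC2 _ f F) //.
- exact: within_cont (ltW ac) cb.
- split => [x||].
  + by rewrite in_itv/= => /andP[/ltW ax /ltW xc]; have [] := dF' x ax xc.
  + exact/cvg_at_right_filter/(isD_cont (dF' _ (lexx _) (ltW ac))).
  + exact/cvg_at_left_filter/(isD_cont (dF' _ (ltW ac) (lexx _))).
- move=> x; rewrite in_itv/= => /andP[/ltW ax /ltW xc].
  by rewrite derive1E; have [_] := dF' x ax xc.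
Qed.

End SmoothPiece.

Definition ext t f g s := if s <= t then f s else g s : R.

Section Append.
Variables (a t b : R) (f g G : R -> R).
Hypothesis at_ : a <= t.
Hypothesis tb : t <= b.
Hypothesis i_f : mu.-integrable `]a, t] (EFin \o f).
Hypothesis cg : forall s, t <= s <= b -> {for s, continuous g}.
Hypothesis dG : forall s : R, t <= s <= b -> is_derive s 1 G (g s).

Lemma ext_integrable : mu.-integrable `]a, b] (EFin \o ext t f g).
Proof.
rewrite (itv_oc_split at_ tb); apply: integrable_setU => //.
- exact: itv_oc_disj.
- apply: eq_integrable i_f => // x; rewrite inE/= in_itv/= => /andP[_ xt].
  by rewrite /ext xt.
- have : mu.-integrable `]t, b] (EFin \o g).
    apply: (integrable_sub (smooth_integrable tb cg)) => //.
    by apply: subset_itv; rewrite bnd_simp.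
  apply: eq_integrable => // x; rewrite inE/= in_itv/= => /andP[xt _].
  by rewrite /ext leNgt xt.
Qed.

Lemma ext_integral_left c : c <= t ->
  \int[mu]_(s in `]a, c]) ext t f g s = \int[mu]_(s in `]a, c]) f s.
Proof.
move=> ct; apply: eq_Rintegral => s; rewrite inE/= in_itv/= => /andP[_ sc].
by rewrite /ext (le_trans sc ct).
Qed.

Lemma ext_integral_right c : t <= c -> c <= b ->
  \int[mu]_(s in `]a, c]) ext t f g s = \int[mu]_(s in `]a, t]) f s + (G c - G t).
Proof.
move=> tc cb.
have i_e : mu.-integrable `]a, c] (EFin \o ext t f g).
  by apply: (integrable_sub ext_integrable) => //; apply: subset_itv; rewrite bnd_simp.
rewrite (Rintegral_oc_split at_ tc i_e) (ext_integral_left (lexx t)); congr (_ + _).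
rewrite -(smooth_integral tb cg dG tc cb).
apply: eq_Rintegral => s; rewrite inE/= in_itv/= => /andP[ts _].
by rewrite /ext leNgt ts.
Qed.

End Append.

Section ImproperStart.
Variables (a b : R) (f F : R -> R).
Hypothesis ab : a < b.
Hypothesis f_ge0 : forall t, a < t <= b -> 0 <= f t.
Hypothesis F_ge0 : forall t, a < t <= b -> 0 <= F t.
Hypothesis cf : forall t, a < t <= b -> {for t, continuous f}.
Hypothesis dF : forall t : R, a < t <= b -> is_derive t 1 F (f t).

(** Geometric approach to the singular end a: along these points the logarithmic pieces are affine
    in n. *)
Let pt c (n : nat) := a + (c - a) * expR (- n%:R).

Let pt_gt c n : a < c -> a < pt c n.
Proof. by move=> ac; rewrite /pt ltrDl mulr_gt0 ?subr_gt0// expR_gt0. Qed.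

Let pt_le c n : a < c -> pt c n <= c.
Proof.
by move=> ac; rewrite /pt -lerBrDl ger_pMr ?subr_gt0// -expR0 ler_expR oppr_le0.
Qed.

Let Fset c n : set (measurableTypeR R) := `[pt c n, c]%classic.

Let Fset_nd c : a < c -> nondecreasing_seq (Fset c).
Proof.
move=> ac n m nm; apply/subsetPset; apply: subset_itv; rewrite bnd_simp//.
by rewrite /pt lerD2l ler_pM2l ?subr_gt0// ler_expR lerN2 ler_nat.
Qed.

Let Fset_cup c : a < c -> \bigcup_n Fset c n = `]a, c]%classic.
Proof.
move=> ac; apply/seteqP; split => [t [n _]|t].
  rewrite /Fset /= !in_itv/= => /andP[h ->]; rewrite andbT.
  exact: lt_le_trans (pt_gt n ac) h.
rewrite /= in_itv/= => /andP[at_ tc].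
have ca0 : 0 < c - a by rewrite subr_gt0.
have ta0 : 0 < t - a by rewrite subr_gt0.
have r0 : 0 < (t - a) / (c - a) by rewrite divr_gt0.
have := archi_boundP (normr_ge0 (- ln ((t - a) / (c - a)))).
set n := Num.Def.archi_bound _ => hn; exists n => //.
rewrite /Fset /= in_itv/= tc andbT /pt -lerBrDl mulrC -ler_pdivlMr//.
rewrite -[leRHS]lnK ?posrE// ler_expR lerNl; apply: ltW.
by apply: le_lt_trans hn; exact: ler_norm.
Qed.

Let Fset_int c n : a < c -> c <= b ->
  (\int[mu]_(t in Fset c n) (f t)%:E = (F c - F (pt c n))%:E)%E.
Proof.
move=> ac cb; have pa := pt_gt n ac; have pc := pt_le n ac.
have inI t : pt c n <= t <= c -> a < t <= b.
  by move=> /andP[h1 h2]; rewrite (lt_le_trans pa h1) (le_trans h2 cb).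
have cf' t : pt c n <= t <= c -> {for t, continuous f} by move=> /inI; exact: cf.
have dF' (t : R) : pt c n <= t <= c -> is_derive t 1 F (f t) by move=> /inI; exact: dF.
have i_f := smooth_integrable pc cf'.
have <- := smooth_integral pc cf' dF' pc (lexx _).
rewrite Rintegral_itv_obnd_cbnd; last first.
  by apply: (integrable_sub i_f) => //; apply: subset_itv; rewrite bnd_simp.
by rewrite /Rintegral fineK//; exact: integrable_fin_num.
Qed.

Let start_cvg c : a < c -> c <= b ->
  (fun n => (F c - F (pt c n))%:E) @ \oo --> (\int[mu]_(t in `]a, c]) (f t)%:E)%E.
Proof.
move=> ac cb; rewrite -(Fset_cup ac).
have -> : (fun n => (F c - F (pt c n))%:E) = (fun n => \int[mu]_(t in Fset c n) (f t)%:E)%E.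
  by apply/funext => n; rewrite Fset_int.
have pa n := pt_gt n ac; have pc n := pt_le n ac.
have inI n t : pt c n <= t <= c -> a < t <= b.
  by move=> /andP[h1 h2]; rewrite (lt_le_trans (pa n) h1) (le_trans h2 cb).
apply: (@ge0_nondecreasing_set_cvg_integral _ _ R (Fset c) (EFin \o f) mu (Fset_nd ac)).
- by move=> n; exact: measurable_itv.
- move=> n; apply: (measurable_int mu); apply: smooth_integrable => // t /inI.
  exact: cf.
- move=> n t; rewrite /Fset/= in_itv/= => /inI /f_ge0.
  by rewrite lee_fin.
Qed.

Let start_le c : a < c -> c <= b -> (\int[mu]_(t in `]a, c]) (f t)%:E <= (F c)%:E)%E.
Proof.
move=> ac cb; have cv := start_cvg ac cb.
rewrite -(cvg_lim _ cv)//; apply: lime_le; first by apply/cvg_ex; eexists; exact: cv.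
apply: nearW => n; rewrite lee_fin gerBl; apply: F_ge0.
by rewrite (pt_gt n ac) (le_trans (pt_le n ac) cb).
Qed.

Lemma start_integrable : mu.-integrable `]a, b] (EFin \o f).
Proof.
apply/integrableP; split.
  rewrite -(Fset_cup ab).
  apply/measurable_fun_bigcup => [n|n]; first exact: measurable_itv.
  apply: (measurable_int mu); apply: smooth_integrable => [|t /andP[h1 h2]]; first exact: pt_le.
  by apply: cf; rewrite (lt_le_trans (pt_gt n ab) h1).
rewrite [X in (X < _)%E](_ : _ = \int[mu]_(t in `]a, b]) (f t)%:E)%E.
  by apply: le_lt_trans (start_le ab (lexx _)) _; rewrite ltry.
apply: eq_integral => t; rewrite inE/= in_itv/= => tab.
by rewrite ger0_norm// f_ge0.
Qed.

Let intE c : a < c -> c <= b ->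
  (\int[mu]_(t in `]a, c]) (f t)%:E = (\int[mu]_(t in `]a, c]) f t)%:E)%E.
Proof.
move=> ac cb; rewrite /Rintegral fineK//; apply: integrable_fin_num => //.
by apply: (integrable_sub start_integrable) => //; apply: subset_itv; rewrite bnd_simp.
Qed.

(** Nonnegativity of F near a suffices for an upper bound, so no limit of F is required; this is how
    the integral of |phi|^p is treated. *)
Lemma start_integral_le c : a < c -> c <= b -> \int[mu]_(t in `]a, c]) f t <= F c.
Proof. by move=> ac cb; rewrite -lee_fin -intE// start_le. Qed.

Lemma start_integral c : a < c -> c <= b ->
  F (a + (c - a) * expR (- n%:R)) @[n --> \oo] --> 0 ->
  \int[mu]_(t in `]a, c]) f t = F c.
Proof.
move=> ac cb F0; apply: EFin_inj; rewrite -intE//.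
have h : (fun n => (F c - F (pt c n))%:E) @ \oo --> (F c)%:E.
  apply: cvg_EFin; first by apply: nearW.
  rewrite -[X in _ --> X]subr0; apply: cvgB; first exact: cvg_cst.
  exact: F0.
by apply: cvg_unique (start_cvg ac cb) h.
Qed.

End ImproperStart.

End PiecewiseIntegrals.

(** * Optimal test functions *)

Section Paths.
Context {R : realType}.
#[local] Opaque xi candidate C0 Gamma wbar vF D kappa.
Local Notation mu := (@lebesgue_measure R).
Variables p C a : R.
Hypothesis H0 : admissible p C.
Implicit Types (b c d s t z v w : R) (phi g : R -> R).

Let hp : 2 < p. Proof. exact: adm_p H0. Qed.
Let C1 : 1 < C. Proof. exact: C_gt1 H0. Qed.
Let X0 : 0 < xi C. Proof. exact: xi_gt0 H0. Qed.
Let X1 : 0 < 1 - xi C. Proof. exact: xi_compl_gt0 H0. Qed.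

(* tau (T_z(p1 / tau) - p2 / tau) for the tangent line T_z, in a form that is linear in
   (tau, p1, p2). If it does not decrease from c to d along the running integrals,
   the averages over [c, d] lie below T_z, hence below the upper boundary. *)
Definition lin z (tau p1 p2 : R) := expR z * (tau + (p1 - z * tau) / (1 - xi C)) - p2.

Definition linP (P1 P2 : R -> R) z c := lin z (c - a) (P1 c) (P2 c).

(** A test function under construction on ]a, t], with its running integrals. The cost is recorded
    only from above, as the opposite bound is [test_function_lower]; the index z in the last field
    may depend on the subinterval. *)
Record path t phi (P1 P2 : R -> R) (y : R) : Prop := Path {
  path_le : a <= t;
  path_i1 : mu.-integrable `]a, t] (EFin \o phi);
  path_i2 : mu.-integrable `]a, t] (EFin \o (expR \o phi));
  path_i3 : mu.-integrable `]a, t] (EFin \o (powf p \o phi));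
  path_1 : forall c, a <= c -> c <= t -> \int[mu]_(s in `]a, c]) phi s = P1 c;
  path_2 : forall c, a <= c -> c <= t -> \int[mu]_(s in `]a, c]) expR (phi s) = P2 c;
  path_3 : \int[mu]_(s in `]a, t]) powf p (phi s) <= y;
  path_lin : forall c d, a <= c -> c < d -> d <= t ->
    exists z, linP P1 P2 z c <= linP P1 P2 z d }.

Lemma lin_cst z tau p1 p2 v de :
  lin z (tau + de) (p1 + v * de) (p2 + expR v * de) =
  lin z tau p1 p2 + de * (tangent_line C z v - expR v).
Proof. by rewrite /lin tangent_lineE//; lra. Qed.

Lemma lin_tangent z tau x1 x2 : lin z tau (tau * x1) (tau * x2) = tau * (tangent_line C z x1 - x2).
Proof. by rewrite /lin tangent_lineE//; lra. Qed.

Lemma upper_xi s : C * expR (s + xi C) = expR s / (1 - xi C).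
Proof. by rewrite expRD mulrCA C_expR_xi. Qed.

Lemma lin_top z s tau : 0 <= tau ->
  lin z tau (tau * (s + xi C)) (tau * (expR s / (1 - xi C))) <= 0.
Proof.
move=> t0; rewrite lin_tangent mulr_ge0_le0// subr_le0 -upper_xi.
exact: tangent_line_le_upper.
Qed.

Lemma lin_top_eq s tau : lin s tau (tau * (s + xi C)) (tau * (expR s / (1 - xi C))) = 0.
Proof. by rewrite lin_tangent tangent_line_at_top// upper_xi subrr mulr0. Qed.

Lemma lin_char z tau tau' p1 p1' p2 p2' : tau < tau' ->
  lin z tau p1 p2 <= lin z tau' p1' p2' ->
  p2' - p2 <= C * expR ((p1' - p1) / (tau' - tau)) * (tau' - tau).
Proof.
move=> tt; have d0 : 0 < tau' - tau by rewrite subr_gt0.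
have -> : lin z tau' p1' p2' = lin z tau p1 p2 +
    (tau' - tau) * tangent_line C z ((p1' - p1) / (tau' - tau)) - (p2' - p2).
  have e : (tau' - tau) * ((p1' - p1) / (tau' - tau)) = p1' - p1.
    by rewrite mulrC mulfVK// gt_eqF.
  rewrite tangent_lineE//; move: e; set q := _ / (tau' - tau).
  by rewrite /lin; move: (1 - xi C)^-1 (expR z) => k E e; nra.
have := ler_wpM2r (ltW d0) (tangent_line_le_upper C1 z ((p1' - p1) / (tau' - tau))).
by rewrite [(tau' - tau) * _]mulrC; lra.
Qed.

Lemma ext_left t f g c : c <= t -> ext t f g c = f c :> R.
Proof. by rewrite /ext => ->. Qed.

Lemma ext_right t f g c : g t = f t -> t <= c -> ext t f g c = g c :> R.
Proof.
move=> e; rewrite /ext le_eqVlt => /predU1P[<-|tc]; first by rewrite lexx e.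
by rewrite leNgt tc.
Qed.

Section PathAppend.
Variables (t b : R) (phi P1 P2 g G1 G2 G3 : R -> R) (y : R).
Hypothesis Pt : path t phi P1 P2 y.
Hypothesis tb : t <= b.
Hypothesis d1 : forall s : R, t <= s <= b -> is_derive s 1 G1 (g s).
Hypothesis d2 : forall s : R, t <= s <= b -> is_derive s 1 G2 (expR (g s)).
Hypothesis d3 : forall s : R, t <= s <= b -> is_derive s 1 G3 (powf p (g s)).
Hypothesis cg : forall s, t <= s <= b -> {for s, continuous g}.
Hypothesis e1 : G1 t = P1 t.
Hypothesis e2 : G2 t = P2 t.
Hypothesis lin1 : forall c d, a <= c -> c <= t -> t < d -> d <= b ->
  exists z, linP P1 P2 z c <= linP G1 G2 z d.
Hypothesis lin2 : forall c d, t <= c -> c < d -> d <= b ->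
  exists z, linP G1 G2 z c <= linP G1 G2 z d.

Let cexp s : t <= s <= b -> {for s, continuous (expR \o g)}.
Proof. by move=> /cg h; apply: continuous_comp h _; exact: continuous_expR. Qed.

Let cpow s : t <= s <= b -> {for s, continuous (powf p \o g)}.
Proof.
move=> /cg h; apply: continuous_comp h _.
exact: isD_cont (is_derive_powf hp _).
Qed.

Let comp_ext (h : R -> R) : h \o ext t phi g = ext t (h \o phi) (h \o g).
Proof. by apply/funext => s; rewrite /ext/=; case: ifP. Qed.

Lemma path_append :
  path b (ext t phi g) (ext t P1 G1) (ext t P2 G2) (y + (G3 b - G3 t)).
Proof.
have at_ := path_le Pt; have ab := le_trans at_ tb.
have E2 : expR \o ext t phi g = ext t (expR \o phi) (expR \o g) := comp_ext expR.
have E3 : powf p \o ext t phi g = ext t (powf p \o phi) (powf p \o g) := comp_ext (powf p).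
split => //.
- exact: ext_integrable at_ tb (path_i1 Pt) cg.
- by rewrite E2; exact: ext_integrable at_ tb (path_i2 Pt) cexp.
- by rewrite E3; exact: ext_integrable at_ tb (path_i3 Pt) cpow.
- move=> c ac cb; have [ct|/ltW tc] := leP c t.
    by rewrite ext_integral_left// ext_left// (path_1 Pt).
  rewrite (ext_integral_right at_ tb (path_i1 Pt) cg d1 tc cb) ext_right//.
  by rewrite (path_1 Pt)// e1; lra.
- move=> c ac cb; rewrite -[LHS]/(\int[mu]_(s in `]a, c]) (expR \o ext t phi g) s) E2.
  have [ct|/ltW tc] := leP c t.
    by rewrite ext_integral_left// ext_left// (path_2 Pt).
  rewrite (ext_integral_right at_ tb (path_i2 Pt) cexp d2 tc cb) ext_right//.
  by rewrite (path_2 Pt)// e2; lra.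
- rewrite -[leLHS]/(\int[mu]_(s in `]a, b]) (powf p \o ext t phi g) s) E3.
  rewrite (ext_integral_right at_ tb (path_i3 Pt) cpow d3 tb (lexx _)).
  by rewrite lerD2r; exact: path_3 Pt.
- have linL c z : c <= t -> linP (ext t P1 G1) (ext t P2 G2) z c = linP P1 P2 z c.
    by move=> ct; rewrite /linP !ext_left.
  have linR c z : t <= c -> linP (ext t P1 G1) (ext t P2 G2) z c = linP G1 G2 z c.
    by move=> tc; rewrite /linP !ext_right.
  move=> c d ac cd db; have [dt|td] := leP d t.
    have [z hz] := path_lin Pt ac cd dt; exists z.
    by rewrite !linL// (le_trans (ltW cd)).
  have [ct|/ltW tc] := leP c t.
    by have [z hz] := lin1 ac ct td db; exists z; rewrite linL// linR// ltW.
  by have [z hz] := lin2 tc cd db; exists z; rewrite !linR// (le_trans tc)// ltW.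
Qed.

End PathAppend.

Lemma path_append_cst t b v phi P1 P2 y : path t phi P1 P2 y -> t <= b ->
  (forall c d, a <= c -> c <= t -> t < d -> d <= b ->
    exists z, linP P1 P2 z c <=
      linP P1 P2 z t + (d - t) * (tangent_line C z v - expR v)) ->
  exists phi' Q1 Q2, [/\ path b phi' Q1 Q2 (y + powf p v * (b - t)),
    forall c, c <= t -> Q1 c = P1 c /\ Q2 c = P2 c,
    forall c z, t <= c -> linP Q1 Q2 z c =
      linP P1 P2 z t + (c - t) * (tangent_line C z v - expR v)
   & forall c, t <= c -> Q1 c = P1 t + v * (c - t) /\ Q2 c = P2 t + expR v * (c - t)].
Proof.
move=> Pt tb h.
pose G K Z s := K + Z * (s - t) : R.
have dG K Z (s : R) : is_derive s 1 (G K Z) Z.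
  apply: (is_derive_eq (isD_add (isD_cst _ _) (isD_mul (isD_cst _ _)
    (isD_add (isD_id _) (isD_cst _ _))))); lra.
have Gt K Z : G K Z t = K by rewrite /G subrr mulr0 addr0.
have linG z c : linP (G (P1 t) v) (G (P2 t) (expR v)) z c =
    linP P1 P2 z t + (c - t) * (tangent_line C z v - expR v).
  by rewrite /linP -lin_cst /G; congr lin; lra.
have := @path_append t b phi P1 P2 (fun=> v) (G (P1 t) v) (G (P2 t) (expR v))
  (G 0 (powf p v)) y Pt tb.
move=> /(_ _ _ _ _ (Gt _ _) (Gt _ _)) H.
exists (ext t phi (fun=> v)), (ext t P1 (G (P1 t) v)), (ext t P2 (G (P2 t) (expR v))).
split.
- have -> : powf p v * (b - t) = G 0 (powf p v) b - G 0 (powf p v) t.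
    by rewrite Gt /G; lra.
  apply: H => //; first by move=> s _; exact: cvg_cst.
    move=> c d ac ct td db; have [z hz] := h c d ac ct td db; exists z.
    by rewrite linG.
  (* T_v passes through (v, e^v), so [lin] at v does not change along this piece. *)
  move=> c d tc cd db; exists v.
  by rewrite !linG tangent_line_id// subrr !mulr0.
- by move=> c ct; rewrite !ext_left.
- by move=> c z tc; rewrite -linG /linP !ext_right.
- by move=> c tc; rewrite !ext_right.
Qed.

End Paths.

(** * Logarithmic pieces *)

Section LogPieces.
Context {R : realType}.
#[local] Opaque xi candidate C0 Gamma wbar vF D kappa K1 K3.
Local Notation mu := (@lebesgue_measure R).
Variables p C a : R.
Hypothesis H0 : admissible p C.
Implicit Types (b c d s t z v w : R) (phi g : R -> R).

Let hp : 2 < p. Proof. exact: adm_p H0. Qed.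
Let C1 : 1 < C. Proof. exact: C_gt1 H0. Qed.
Let X0 : 0 < xi C. Proof. exact: xi_gt0 H0. Qed.
Let X1 : 0 < 1 - xi C. Proof. exact: xi_compl_gt0 H0. Qed.

(* Along [lg] the averages over [a, s] move on the upper boundary, at abscissa
   lg + xi; [lg1], [lg2], [lg3] are the running integrals of lg, exp lg, |lg|^p. *)
Definition lg v T s := v - xi C * ln ((s - a) / T).
Definition lg1 v T s := (s - a) * (lg v T s + xi C).
Definition lg2 v T s := (s - a) * (expR (lg v T s) / (1 - xi C)).
Definition mslope (K : R -> R) s := powf1 p s + K s * expR s / kappa C.
Definition lg3 K v T s := (s - a) * (powf p (lg v T s) + xi C * mslope K (lg v T s)).

Lemma lg_at v T s : 0 < T -> s = a + T -> lg v T s = v.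
Proof.
move=> T0 ->; rewrite /lg (_ : a + T - a = T); last by lra.
by rewrite divff ?gt_eqF// ln1 mulr0 subr0.
Qed.

Section Derivatives.
Variables v T : R.
Hypothesis T0 : 0 < T.

Lemma is_derive_lg s : a < s -> is_derive s 1 (lg v T) (- (xi C / (s - a))).
Proof.
move=> as_; have sa0 : 0 < s - a by rewrite subr_gt0.
have q0 : 0 < (s - a) / T by rewrite divr_gt0.
have dl : is_derive (s : R) 1 (fun t : R => (t - a) / T) T^-1.
  apply: (is_derive_eq (isD_mul (isD_add (isD_id _) (isD_cst _ _)) (isD_cst _ _))); lra.
have := isD_add (isD_cst v s) (isD_opp (isD_mul (isD_cst (xi C) s)
  (@isD_comp R (@ln R) (fun t : R => (t - a) / T) s _ _ (is_derive1_ln q0) dl))).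
have e : ((s - a) / T)^-1 * T^-1 = (s - a)^-1.
  by rewrite invfM invrK mulfK// gt_eqF.
by rewrite e => h; apply: (is_derive_eq h); lra.
Qed.

Lemma is_derive_lg1 s : a < s -> is_derive s 1 (lg1 v T) (lg v T s).
Proof.
move=> as_; have sa0 : 0 < s - a by rewrite subr_gt0.
apply: (is_derive_eq (isD_mul (isD_add (isD_id _) (isD_cst _ _))
  (isD_add (is_derive_lg as_) (isD_cst _ _)))).
have e : (s - a) * (xi C / (s - a)) = xi C by rewrite mulrC mulfVK// gt_eqF.
by lra.
Qed.

Lemma is_derive_lg2 s : a < s -> is_derive s 1 (lg2 v T) (expR (lg v T s)).
Proof.
move=> as_; have sa0 : 0 < s - a by rewrite subr_gt0.
apply: (is_derive_eq (isD_mul (isD_add (isD_id _) (isD_cst _ _))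
  (isD_mul (isD_expR (is_derive_lg as_)) (isD_cst _ _)))).
have e : (s - a) * (xi C / (s - a)) = xi C by rewrite mulrC mulfVK// gt_eqF.
have e2 : (1 - xi C) * (1 - xi C)^-1 = 1 by rewrite divff// gt_eqF.
move: e e2; move: (expR _) (1 - xi C)^-1 (xi C / (s - a)) => E k q e e2.
by have := congr1 ( *%R^~ (E * k)) e; have := congr1 ( *%R E) e2; rewrite /=; lra.
Qed.

(** [lg3] is s - a times the value of the plane with coefficient K at the tangency point; the
    equation for K is what makes it a primitive of f along [lg]. *)
Lemma is_derive_lg3 K s : a < s ->
  (forall z : R, is_derive z 1 K (kappa C * (K z - powg p z))) ->
  is_derive s 1 (lg3 K v T) (powf p (lg v T s)).
Proof.
move=> as_ dK; have sa0 : 0 < s - a by rewrite subr_gt0.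
have k0 : 0 < kappa C := kappa_gt0 H0.
have dl := is_derive_lg as_.
have dm : is_derive (lg v T s) 1 (mslope K) (K (lg v T s) * expR (lg v T s) * (1 + (kappa C)^-1)).
  apply: (is_derive_eq (isD_add (is_derive_powf1 hp _)
    (isD_mul (isD_mul (dK _) (isD_expR (isD_id _))) (isD_cst _ _)))).
  have e : kappa C * (kappa C)^-1 = 1 by rewrite divff// gt_eqF.
  rewrite -(powg_expR p (lg v T s)).
  move: e; move: (K _) (expR _) (powg _ _) (kappa C)^-1 (kappa C) => Kz E g ki k e.
  have := congr1 ( *%R^~ (Kz * E)) e; have := congr1 ( *%R^~ (g * E)) e.
  by rewrite /=; lra.
apply: (is_derive_eq (isD_mul (isD_add (isD_id _) (isD_cst _ _))
  (isD_add (isD_comp (is_derive_powf hp _) dl)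
    (isD_mul (isD_cst _ _) (isD_comp dm dl))))).
have e : (s - a) * (xi C / (s - a)) = xi C by rewrite mulrC mulfVK// gt_eqF.
have e2 : xi C * (1 + (kappa C)^-1) = (kappa C)^-1.
  have e3 : kappa C * (kappa C)^-1 = 1 by rewrite divff// gt_eqF.
  have e4 : xi C * (kappa C + 1) = 1 by rewrite -inv_xi// divff// gt_eqF.
  move: e3 e4; move: (xi C) (kappa C) (kappa C)^-1 => x k ki e3 e4.
  by have := congr1 ( *%R^~ x) e3; have := congr1 ( *%R^~ ki) e4; rewrite /=; lra.
rewrite /mslope; move: e e2; move: (xi C / (s - a)) (kappa C)^-1 (xi C) (s - a) => q ki x tau.
move: (powf p _) (powf1 p _) (K _) (expR _) => f0 f1 k E e e2.
have := congr1 ( *%R^~ f1) e; have := congr1 ( *%R^~ (x * k * E * (1 + ki))) e.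
by have := congr1 ( *%R^~ (x * k * E)) e2; rewrite /=; lra.
Qed.

Lemma lg_continuous s : a < s -> {for s, continuous (lg v T)}.
Proof. by move=> as_; exact: isD_cont (is_derive_lg as_). Qed.

Lemma lg_decr c d : a < c -> c <= d -> lg v T d <= lg v T c.
Proof.
move=> ac cd; rewrite /lg lerD2l lerN2 ler_pM2l// ler_ln ?posrE ?divr_gt0 ?subr_gt0//.
  by rewrite ler_pM2r ?invr_gt0// lerD2r.
exact: lt_le_trans cd.
Qed.

End Derivatives.

Lemma linP_lg_le z v T c : a <= c -> linP C a (lg1 v T) (lg2 v T) z c <= 0.
Proof. by move=> ac; apply: (lin_top H0); rewrite subr_ge0. Qed.

Lemma linP_lg_eq v T c : linP C a (lg1 v T) (lg2 v T) (lg v T c) c = 0.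
Proof. exact: (lin_top_eq H0). Qed.

(** For a subinterval ending at d in the new piece, the index lg(d) works: [lin] vanishes at d
    because the average is the tangency point of that line. As lg(d) <= v, the hypothesis needs a
    nonpositive [lin] before t only for z <= v. *)
Lemma path_append_log t b phi P1 P2 y v K : path p C a t phi P1 P2 y -> a < t -> t <= b ->
  (forall z : R, is_derive z 1 K (kappa C * (K z - powg p z))) ->
  P1 t = (t - a) * (v + xi C) -> P2 t = (t - a) * (expR v / (1 - xi C)) ->
  (forall z c, z <= v -> a <= c -> c <= t -> linP C a P1 P2 z c <= 0) ->
  exists phi' Q1 Q2,
   [/\ path p C a b phi' Q1 Q2 (y + (lg3 K v (t - a) b - lg3 K v (t - a) t)),
    forall z c, z <= v -> a <= c -> c <= b -> linP C a Q1 Q2 z c <= 0,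
    Q1 b = lg1 v (t - a) b & Q2 b = lg2 v (t - a) b].
Proof.
move=> Pt at_ tb dK e1 e2 h; pose T := t - a.
have T0 : 0 < T by rewrite subr_gt0.
have lgt : lg v T t = v by apply: lg_at => //; rewrite /T; lra.
have e1' : lg1 v T t = P1 t by rewrite e1 /lg1 lgt.
have e2' : lg2 v T t = P2 t by rewrite e2 /lg2 lgt.
have atb s : t <= s <= b -> a < s by move=> /andP[ts _]; exact: lt_le_trans ts.
exists (ext t phi (lg v T)), (ext t P1 (lg1 v T)), (ext t P2 (lg2 v T)); split.
- apply: (@path_append R p C a H0 t b phi P1 P2 (lg v T) (lg1 v T) (lg2 v T) (lg3 K v T) y Pt tb _ _ _ _ e1' e2').
  + by move=> s /atb; exact: is_derive_lg1.
  + by move=> s /atb; exact: is_derive_lg2.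
  + by move=> s /atb as_; exact: is_derive_lg3.
  + by move=> s /atb; exact: lg_continuous.
  + move=> c d ac ct td db; exists (lg v T d); rewrite linP_lg_eq.
    by apply: h => //; rewrite -[leRHS]lgt; apply: lg_decr => //; exact: ltW.
  + move=> c d tc cd db; exists (lg v T d); rewrite linP_lg_eq.
    by apply: linP_lg_le; apply: le_trans tc; exact: ltW.
- move=> z c zv ac cb; have [ct|/ltW tc] := leP c t.
    by rewrite /linP !ext_left// h.
  by rewrite /linP !ext_right// linP_lg_le.
- by rewrite ext_right.
- by rewrite ext_right.
Qed.

Lemma path_nil : path p C a a (cst 0) (cst 0) (cst 0) 0.
Proof.
have e : `]a, a]%classic = set0 :> set (measurableTypeR R) by rewrite set_itvoc0.
have i0 (g : R -> \bar R) : mu.-integrable `]a, a] g.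
  rewrite e; apply/integrableP; split; first exact: measurable_fun_set0.
  by rewrite integral_set0.
split=> //.
- by move=> c ac ca; rewrite (_ : c = a) ?e ?Rintegral_set0//; apply/eqP; rewrite eq_le ca.
- by move=> c ac ca; rewrite (_ : c = a) ?e ?Rintegral_set0//; apply/eqP; rewrite eq_le ca.
- by rewrite e Rintegral_set0.
- by move=> c d ac cd da; have := le_lt_trans ac (lt_le_trans cd da); rewrite ltxx.
Qed.

(** The unbounded initial piece: lg tends to +oo at a, and the running averages arrive along the
    upper boundary from infinity. With w > 0 all integrands and primitives are nonnegative, as
    improper integration from a requires. *)
Lemma path_top t w : a <= t -> (a < t -> 0 < w) ->
  exists phi P1 P2,
   [/\ path p C a t phi P1 P2 ((t - a) * (powf p w + xi C * mslope (K1 p C) w)),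
    forall z c, a <= c -> c <= t -> linP C a P1 P2 z c <= 0,
    P1 t = (t - a) * (w + xi C) & P2 t = (t - a) * (expR w / (1 - xi C))].
Proof.
rewrite le_eqVlt => /predU1P[<- _|at_ /(_ at_) w0].
  exists (cst 0), (cst 0), (cst 0); rewrite subrr !mul0r; split => //; first exact: path_nil.
  move=> z c ac ca; have -> : c = a by apply/eqP; rewrite eq_le ca.
  by rewrite /linP /lin subrr/= mulr0 subrr mul0r addr0 mulr0 subrr.
pose T := t - a; have T0 : 0 < T by rewrite subr_gt0.
have lgt : lg w T t = w by apply: lg_at => //; rewrite /T; lra.
have lgw s : a < s -> s <= t -> w <= lg w T s.
  by move=> as_ st; rewrite -[leLHS]lgt; apply: lg_decr.
have lgp s : a < s <= t -> 0 < lg w T s.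
  by move=> /andP[as_ st]; apply: lt_le_trans w0 _; exact: lgw.
have k0 : 0 < kappa C := kappa_gt0 H0.
have sa s : a < s <= t -> 0 < s - a by move=> /andP[? _]; rewrite subr_gt0.
have f1 s : a < s <= t -> 0 <= lg w T s by move=> /lgp/ltW.
have F1 s : a < s <= t -> 0 <= lg1 w T s.
  move=> h; apply: mulr_ge0; first exact/ltW/sa.
  by apply: addr_ge0; [exact: f1|exact: ltW].
have f2 s : a < s <= t -> 0 <= (expR \o lg w T) s by move=> _; exact: expR_ge0.
have F2 s : a < s <= t -> 0 <= lg2 w T s.
  move=> h; apply: mulr_ge0; first exact/ltW/sa.
  by apply: divr_ge0; [exact: expR_ge0|exact: ltW].
have f3 s : a < s <= t -> 0 <= (powf p \o lg w T) s by move=> _; exact: powf_ge0.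
have F3 s : a < s <= t -> 0 <= lg3 (K1 p C) w T s.
  move=> h; have h1 := lgp s h; rewrite /lg3 mulr_ge0 ?(ltW (sa _ h))//.
  rewrite addr_ge0 ?powf_ge0// mulr_ge0 ?(ltW X0)// /mslope addr_ge0//.
    by rewrite powf1_pos// mulr_ge0 ?powR_ge0//; move: hp; lra.
  by rewrite divr_ge0 ?(ltW k0)// mulr_ge0 ?expR_ge0// K1_ge0.
have c1 s : a < s <= t -> {for s, continuous (lg w T)}.
  by move=> /andP[h _]; exact: lg_continuous.
have c2 s : a < s <= t -> {for s, continuous (expR \o lg w T)}.
  by move=> /c1 h; apply: continuous_comp h _; exact: continuous_expR.
have c3 s : a < s <= t -> {for s, continuous (powf p \o lg w T)}.
  by move=> /c1 h; apply: continuous_comp h _; exact: isD_cont (is_derive_powf hp _).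
have d1 (s : R) : a < s <= t -> is_derive s 1 (lg1 w T) (lg w T s).
  by move=> /andP[h _]; exact: is_derive_lg1.
have d2 (s : R) : a < s <= t -> is_derive s 1 (lg2 w T) ((expR \o lg w T) s).
  by move=> /andP[h _]; exact: is_derive_lg2.
have d3 (s : R) : a < s <= t -> is_derive s 1 (lg3 (K1 p C) w T) ((powf p \o lg w T) s).
  move=> /andP[h _]; apply: is_derive_lg3 => // z; exact: is_derive_K1.
(* Along the points of [pt], lg grows by xi per step while s - a shrinks by the factor e^-1, so
   [lg2] is geometric with ratio e^-(1 - xi). *)
have lim2 c : a < c -> lg2 w T (a + (c - a) * expR (- n%:R)) @[n --> \oo] --> 0.
  move=> ac; pose q := expR (- (1 - xi C)).
  have -> : (fun n : nat => lg2 w T (a + (c - a) * expR (- n%:R))) = geometric (lg2 w T c) q.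
    apply/funext => n; rewrite /geometric/= /q -expRM_natl /lg2 /lg.
    have ca0 : 0 < c - a by rewrite subr_gt0.
    rewrite (_ : a + (c - a) * expR (- n%:R) - a = (c - a) * expR (- n%:R)); last by lra.
    rewrite (_ : (c - a) * expR (- n%:R) / T = (c - a) / T * expR (- n%:R)); last by lra.
    rewrite lnM ?posrE ?expR_gt0 ?divr_gt0// expRK.
    rewrite (_ : w - _ = (w - xi C * ln ((c - a) / T)) + xi C * n%:R); last by lra.
    rewrite (_ : n%:R * - (1 - xi C) = - n%:R + xi C * n%:R); last by lra.
    rewrite (expRD (w - _)) (expRD (- n%:R)).
    by move: (expR (w - _)) (expR (- _)) (expR (_ * _)) (1 - xi C)^-1 => e1 e2 e3 e4; lra.
  apply: cvg_geometric; rewrite ger0_norm ?expR_ge0//.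
  by rewrite -[ltRHS]expR0 ltr_expR oppr_lt0.
(* y <= e^y bounds [lg1] by a constant multiple of [lg2]. *)
have lim1 c : a < c -> c <= t -> lg1 w T (a + (c - a) * expR (- n%:R)) @[n --> \oo] --> 0.
  move=> ac ct; pose M := (1 - xi C) * expR (xi C).
  apply: (@squeeze_cvgr _ _ _ _ (fun=> 0)
    (fun n : nat => M * lg2 w T (a + (c - a) * expR (- n%:R)))); last 2 first.
  - exact: cvg_cst.
  - by rewrite -(mulr0 M); apply: cvgM; [exact: cvg_cst|exact: lim2].
  apply: nearW => n; set s := a + _.
  have hs : a < s <= t.
    rewrite /s ltrDl mulr_gt0 ?subr_gt0 ?expR_gt0//= (le_trans _ ct)//.
    by rewrite -lerBrDl ger_pMr ?subr_gt0// -expR0 ler_expR oppr_le0.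
  rewrite F1//= /lg1 /lg2.
  rewrite (_ : M * _ = (s - a) * (expR (lg w T s) * expR (xi C) * ((1 - xi C) / (1 - xi C)))).
    rewrite divff ?gt_eqF// mulr1 -expRD ler_pM2l ?sa//.
    by apply: le_trans (expR_ge1Dx _); lra.
  by rewrite /M; lra.
exists (lg w T), (lg1 w T), (lg2 w T); split.
- have zero c (F f : R -> R) : ~~ (a < c) -> a <= c ->
    \int[mu]_(s in `]a, c]) f s = (c - a) * F c.
    move=> h ac; have -> : c = a by apply/eqP; rewrite eq_le ac leNgt h.
    by rewrite set_itvoc0 Rintegral_set0 subrr mul0r.
  split.
  + exact: ltW.
  + exact: start_integrable at_ f1 F1 c1 d1.
  + exact: start_integrable at_ f2 F2 c2 d2.
  + exact: start_integrable at_ f3 F3 c3 d3.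
  + move=> c ac ct; have [ac'|nac] := boolP (a < c).
      exact: (start_integral at_ f1 F1 c1 d1 ac' ct (lim1 _ ac' ct)).
    exact: (zero c (fun c => lg w T c + xi C) _ nac ac).
  + move=> c ac ct; have [ac'|nac] := boolP (a < c).
      exact: (start_integral at_ f2 F2 c2 d2 ac' ct (lim2 _ ac')).
    exact: (zero c (fun c => expR (lg w T c) / (1 - xi C)) _ nac ac).
  + have := start_integral_le at_ f3 F3 c3 d3 at_ (lexx _).
    by rewrite /lg3 lgt.
  + move=> c d ac cd dt; exists (lg w T d); rewrite linP_lg_eq.
    exact: linP_lg_le.
- by move=> z c ac ct; exact: linP_lg_le.
- by rewrite /lg1 lgt.
- by rewrite /lg2 lgt.
Qed.

End LogPieces.

(** * From paths to test functions; the basic three-piece path *)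

Section TestFunctions.
Context {R : realType}.
#[local] Opaque xi candidate C0 Gamma wbar vF D kappa K1 K3.
Local Notation mu := (@lebesgue_measure R).
Variables p C a : R.
Hypothesis H0 : admissible p C.
Implicit Types (b c d s t z v w : R) (phi g : R -> R).

Let hp : 2 < p. Proof. exact: adm_p H0. Qed.
Let C1 : 1 < C. Proof. exact: C_gt1 H0. Qed.
Let X0 : 0 < xi C. Proof. exact: xi_gt0 H0. Qed.
Let X1 : 0 < 1 - xi C. Proof. exact: xi_compl_gt0 H0. Qed.

Lemma path_test b phi P1 P2 y (x : R * R) : a < b -> path p C a b phi P1 P2 y ->
  P1 b = (b - a) * x.1 -> P2 b = (b - a) * x.2 ->
  test_functions x C a b phi /\
  (avg a b (fun t => (`|phi t| `^ p)%R) <= (y / (b - a))%:E)%E.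
Proof.
move=> ab Pb e1 e2; have ba0 : 0 < b - a by rewrite subr_gt0.
have oo_oc c d (f : R -> R) : mu.-integrable `]c, d] (EFin \o f) ->
    \int[mu]_(s in `]c, d[) f s = \int[mu]_(s in `]c, d]) f s.
  move=> i_f; apply: Rintegral_itv_bndo_bndc; apply: (integrable_sub i_f) => //.
  by apply: subset_itv; rewrite bnd_simp.
have i1 := integrable_cc_of_oc (ltW ab) (path_i1 Pb).
have i2 := integrable_cc_of_oc (ltW ab) (path_i2 Pb).
have i3 := integrable_cc_of_oc (ltW ab) (path_i3 Pb).
have avgP f I : mu.-integrable `[a, b] (EFin \o f) ->
    mu.-integrable `]a, b] (EFin \o f) ->
    \int[mu]_(s in `]a, b]) f s = I -> avg a b f = (I / (b - a))%:E.
  by move=> i_f i_f' <-; rewrite avgE// oo_oc.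
split; last first.
  rewrite (avgP (powf p \o phi) _ i3 (path_i3 Pb) erefl) lee_fin.
  by rewrite ler_pM2r ?invr_gt0//; exact: path_3 Pb.
have diff (f P : R -> R) c d : mu.-integrable `]a, b] (EFin \o f) ->
    (forall c, a <= c -> c <= b -> \int[mu]_(s in `]a, c]) f s = P c) ->
    a <= c -> c < d -> d <= b -> \int[mu]_(s in `]c, d[) f s = P d - P c.
  move=> i_f hP ac cd db; have sub u v : a <= u -> v <= b -> mu.-integrable `]u, v] (EFin \o f).
    move=> au vb; apply: (integrable_sub i_f) => //; apply: subset_itv; by rewrite bnd_simp.
  rewrite oo_oc; last exact: sub.
  have ad : a <= d by apply: le_trans ac (ltW cd).
  have cb : c <= b by apply: le_trans (ltW cd) db.
  have := Rintegral_oc_split ac (ltW cd) (sub a d (lexx _) db).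
  by rewrite !hP//; lra.
split => //.
- rewrite (avgP phi _ i1 (path_i1 Pb) (path_1 Pb (ltW ab) (lexx b))) e1.
  by rewrite mulrC mulKf// gt_eqF.
- rewrite (avgP (expR \o phi) _ i2 (path_i2 Pb) (path_2 Pb (ltW ab) (lexx b))) e2.
  by rewrite mulrC mulKf// gt_eqF.
- split => //; first by apply: aeW => t _; exact: expR_gt0.
  rewrite (_ : (fun t => _) = phi)//; apply/funext => t; exact: expRK.
- apply/(Ainfty_char_leP C ab i1 i2) => c d ac cd db.
  rewrite (diff phi P1 c d (path_i1 Pb) (path_1 Pb) ac cd db).
  rewrite (diff (expR \o phi) P2 c d (path_i2 Pb) (path_2 Pb) ac cd db).
  have [z hz] := path_lin Pb ac cd db.
  have cda : c - a < d - a by lra.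
  have := lin_char H0 cda hz.
  by rewrite (_ : d - a - (c - a) = d - c)//; lra.
Qed.

(** A logarithmic piece ending at w, then the constants w and v; equal division points drop a piece.
    For subintervals from the logarithmic piece into the last one the index z works: [lin] is
    nonpositive at the start, nonnegative at b, and nonincreasing along v <= z. From the constant w
    into v the index v works, since w <= v + hstar. The last clause prepares a further logarithmic
    piece starting at v. *)
Lemma path_two t1 t2 b v w z :
  a <= t1 -> t1 <= t2 -> t2 <= b -> (a < t1 -> 0 < w) -> v <= w -> w <= v + hstar C ->
  v <= z ->
  let Z1 := (t1 - a) * (w + xi C) + w * (t2 - t1) + v * (b - t2) in
  let Z2 := (t1 - a) * (expR w / (1 - xi C)) + expR w * (t2 - t1) + expR v * (b - t2) in
  0 <= lin C z (b - a) Z1 Z2 ->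
  exists phi P1 P2, [/\ path p C a b phi P1 P2
      ((t1 - a) * (powf p w + xi C * mslope p C (K1 p C) w)
       + powf p w * (t2 - t1) + powf p v * (b - t2)),
    P1 b = Z1, P2 b = Z2
  & Z1 = (b - a) * (v + xi C) -> lin C v (b - a) Z1 Z2 <= 0 -> w <= v + xi C ->
    forall s c, s <= v -> a <= c -> c <= b -> linP C a P1 P2 s c <= 0].
Proof.
move=> at1 t12 t2b w0 vw wv vz Z1 Z2 hz.
have [phi0 [P1 [P2 [pa0 L0 e1 e2]]]] := path_top H0 at1 w0.
have linw : linP C a P1 P2 w t1 = 0 by rewrite /linP e1 e2 (lin_top_eq H0).
have [|phi1 [Q1 [Q2 [pa1 B1' B2 B3]]]] := @path_append_cst R p C a H0 t1 t2 w phi0 P1 P2 _ pa0 t12.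
  move=> c d ac ct td db; exists w.
  by rewrite linw tangent_line_id// subrr mulr0 addr0 L0.
have B1 c z' : c <= t1 -> linP C a Q1 Q2 z' c = linP C a P1 P2 z' c.
  by move=> ct; rewrite /linP; have [-> ->] := B1' c ct.
have [Q1t Q2t] := B3 t2 t12.
have linz s : lin C s (b - a) Z1 Z2 = linP C a Q1 Q2 s t2 + (b - t2) * (tangent_line C s v - expR v).
  rewrite /linP -lin_cst Q1t Q2t e1 e2 /Z1 /Z2.
  by congr lin; lra.
have slope_w : 0 <= tangent_line C v w - expR w by rewrite subr_ge0 lower_le_tangent_line.
have slope_v : tangent_line C z v - expR v <= 0 by rewrite subr_le0 tangent_line_le_lower.
have Tv : tangent_line C v v - expR v = 0 by rewrite tangent_line_id// subrr.
have Qv c : t1 <= c -> c <= t2 -> linP C a Q1 Q2 v c <= linP C a Q1 Q2 v t2.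
  by move=> tc ct; rewrite !B2// lerD2l ler_wpM2r// lerD2r.
have [|phi2 [S1 [S2 [pa2 D1' D2 D3]]]] := @path_append_cst R p C a H0 t2 b v phi1 Q1 Q2 _ pa1 t2b.
  move=> c d ac ct td db; have [ct1|/ltW t1c] := leP c t1.
    exists z; rewrite (B1 _ _ ct1); apply: le_trans (L0 _ _ ac ct1) _.
    apply: (le_trans hz); rewrite linz lerD2l.
    by apply: ler_wnM2r => //; rewrite lerD2r.
  by exists v; rewrite Tv mulr0 addr0 Qv.
have D1 c z' : c <= t2 -> linP C a S1 S2 z' c = linP C a Q1 Q2 z' c.
  by move=> ct; rewrite /linP; have [-> ->] := D1' c ct.
have [S1b S2b] := D3 b t2b.
have eZ1 : S1 b = Z1 by rewrite S1b Q1t e1.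
have eZ2 : S2 b = Z2 by rewrite S2b Q2t e2.
exists phi2, S1, S2; split => //.
move=> z1 linv wxi s c sv ac cb.
have [ct1|t1c] := leP c t1.
  by rewrite D1 ?B1 ?L0// (le_trans ct1).
have ac' : 0 < c - a by rewrite subr_gt0 (le_lt_trans at1).
have linvc : linP C a S1 S2 v c <= 0.
  apply: le_trans linv; rewrite linz Tv mulr0 addr0.
  have [ct2|/ltW t2c] := leP c t2; first by rewrite D1// Qv// ltW.
  by rewrite D2// Tv mulr0 addr0.
(* The mean over ]a, c] is at least v + xi: the final mean is v + xi and the values after c are w <=
   v + xi or v. To the right of v + xi, T_s lies below T_v for s <= v. *)
have hS : (v + xi C) * (c - a) <= S1 c.
  have S1bE : S1 b = (b - a) * (v + xi C) by rewrite eZ1.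
  have [ct2|/ltW t2c] := leP c t2; last first.
    have [+ _] := D3 c t2c; have h2 : 0 <= xi C * (b - c) by rewrite mulr_ge0 ?subr_ge0 ?(ltW X0).
    by move: S1b; rewrite S1bE; lra.
  have [Q1c _] := B3 c (ltW t1c).
  have [-> _] := D1' c ct2.
  have h2 : 0 <= xi C * (b - t2) by rewrite mulr_ge0 ?subr_ge0 ?(ltW X0).
  have h3 : 0 <= (v + xi C - w) * (t2 - c) by rewrite mulr_ge0 ?subr_ge0.
  by move: S1b; rewrite S1bE Q1c Q1t; lra.
apply: le_trans linvc; rewrite /linP.
have hom z' : lin C z' (c - a) (S1 c) (S2 c) =
    (c - a) * tangent_line C z' (S1 c / (c - a)) - S2 c.
  rewrite -[LHS]/(lin C z' (c - a) (S1 c) (S2 c)).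
  have e : S1 c = (c - a) * (S1 c / (c - a)) by rewrite mulrC mulfVK// gt_eqF.
  have e' : S2 c = (c - a) * (S2 c / (c - a)) by rewrite mulrC mulfVK// gt_eqF.
  by rewrite {1}e {1}e' lin_tangent mulrBr -e'.
rewrite !hom lerD2r ler_pM2l//; apply: tangent_line_incr => //.
by rewrite lerBrDr ler_pdivlMr.
Qed.

End TestFunctions.

(** * Paths that attain the candidate *)

Section Attained.
Context {R : realType}.
#[local] Opaque xi candidate C0 Gamma wbar vF D kappa K1 K3.
Variables p C a : R.
Hypothesis H0 : admissible p C.
Implicit Types (b c d s t z v w : R) (phi : R -> R) (x : R * R).
Local Notation V := (vbar p C).
Local Notation W := (wbar p C).
Local Notation Kb := (D p (wbar p C)).
Local Notation mslope := (mslope p C).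

Let hp : 2 < p. Proof. exact: adm_p H0. Qed.
Let C1 : 1 < C. Proof. exact: C_gt1 H0. Qed.
Let X0 : 0 < xi C. Proof. exact: xi_gt0 H0. Qed.
Let X1 : 0 < 1 - xi C. Proof. exact: xi_compl_gt0 H0. Qed.
Let VW0 : V < W. Proof. exact: VW H0. Qed.

Lemma W_V_le_xi : W <= V + xi C.
Proof.
have := vbar_root H0; rewrite /F_root => -[/andP[h _] _].
have W3 : W < 1 / 3.
  have /andP[_ h1] := wbar_bounds H0; have := wmax_third hp; lra.
have x0 : 2 / 3 <= xi C.
  have h24 := inv_one_sub_xi_gt H0.
  have k1 : (1 - xi C) * (1 - xi C)^-1 = 1 by rewrite divff// gt_eqF.
  have : 0 < (1 - xi C) * ((1 - xi C)^-1 - 24) by rewrite mulr_gt0// subr_gt0.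
  by lra.
by lra.
Qed.

Lemma W_V_le_hstar : W <= V + hstar C.
Proof. by have := W_V_le_xi; have := hstar_gt C1; lra. Qed.

Definition attained b x (y : R) := exists phi P1 P2, [/\ path p C a b phi P1 P2 y,
  P1 b = (b - a) * x.1 & P2 b = (b - a) * x.2].

Lemma plane_tangent_value z K x : x.2 = tangent_line C z x.1 ->
  plane p z (K z) x = powf p z + mslope K z * (x.1 - z).
Proof. by move=> h; rewrite (plane_tangent H0). Qed.

Lemma attained_right b x : a <= b -> Omega C x -> W <= u C x ->
  attained b x ((b - a) * chain p C (u C x) x).
Proof.
move=> ab ox Wu; have [Tx /andP[ux xu]] := u_spec C1 ox.
rewrite chain_right// plane_tangent_value//; move: Tx ux xu Wu.
move: (u C x) => z Tx ux xu Wz.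
(* The ratio in which x divides the segment of T_z from (z, e^z) to the tangency point, used as the
   share of the logarithmic piece. *)
pose th := (x.1 - z) / xi C.
have thx : th * xi C = x.1 - z by rewrite mulfVK// gt_eqF.
have th0 : 0 <= th by rewrite divr_ge0 ?subr_ge0// ltW.
have th1 : th <= 1 by rewrite ler_pdivrMr// mul1r; lra.
have L0 : 0 <= b - a by rewrite subr_ge0.
have tL0 : 0 <= th * (b - a) by rewrite mulr_ge0.
have tL1 : 0 <= (1 - th) * (b - a) by rewrite mulr_ge0// subr_ge0.
pose t1 := a + th * (b - a).
have at1 : a <= t1 by rewrite /t1; lra.
have t1b : t1 <= b by rewrite /t1; lra.
have z0 : 0 < z by apply: lt_le_trans Wz; exact: W_gt0 H0.
have zh : z <= z + hstar C by have := hstar_gt C1; lra.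
have e1 : (t1 - a) * (z + xi C) + z * (t1 - t1) + z * (b - t1) = (b - a) * x.1.
  by have := congr1 ( *%R (b - a)) thx; rewrite /t1/=; lra.
have e2 : (t1 - a) * (expR z / (1 - xi C)) + expR z * (t1 - t1) + expR z * (b - t1) =
    (b - a) * x.2.
  rewrite -Tx tangent_lineE.
  have k1 : (1 - xi C) * (1 - xi C)^-1 = 1 by rewrite divff// gt_eqF.
  rewrite -thx /t1; move: k1; move: (1 - xi C)^-1 (expR z) => k E k1.
  by have := congr1 ( *%R (th * (b - a) * E)) k1; rewrite /=; lra.
have [|phi [P1 [P2 [pa f1 f2 _]]]] :=
    path_two H0 at1 (lexx t1) t1b (fun _ => z0) (lexx z) zh (lexx z).
  by rewrite e1 e2 lin_tangent Tx subrr mulr0.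
exists phi, P1, P2; rewrite f1 f2; split => //.
rewrite (_ : (b - a) * _ = (t1 - a) * (powf p z + xi C * mslope (K1 p C) z) +
  powf p z * (t1 - t1) + powf p z * (b - t1))//.
by have := congr1 ( *%R ((b - a) * mslope (K1 p C) z)) thx; rewrite /t1/=; lra.
Qed.

Lemma attained_mix b v w t : a <= b -> 0 <= t <= 1 -> V < v -> v <= w -> w < W ->
  attained b (mix t v w) ((b - a) * ((1 - t) * powf p v + t * powf p w)).
Proof.
move=> ab /andP[t0 t1] Vv vw wW.
have L0 : 0 <= b - a by rewrite subr_ge0.
have tL0 : 0 <= t * (b - a) by rewrite mulr_ge0.
have tL1 : 0 <= (1 - t) * (b - a) by rewrite mulr_ge0// subr_ge0.
pose t2 := a + t * (b - a).
have at2 : a <= t2 by rewrite /t2; lra.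
have t2b : t2 <= b by rewrite /t2; lra.
have wh : w <= v + hstar C by have := W_V_le_hstar; lra.
have e1 : (a - a) * (w + xi C) + w * (t2 - a) + v * (b - t2) = (b - a) * (mix t v w).1.
  by rewrite /mix /t2/=; lra.
have e2 : (a - a) * (expR w / (1 - xi C)) + expR w * (t2 - a) + expR v * (b - t2) =
    (b - a) * (mix t v w).2.
  by rewrite /mix /t2/=; lra.
have aa : a < a -> 0 < w by rewrite ltxx.
have [|phi [P1 [P2 [pa f1 f2 _]]]] :=
    path_two H0 (lexx a) at2 t2b aa vw wh (lexx v).
  rewrite e1 e2 lin_tangent mulr_ge0// /mix/= tangent_lineE.
  have h := lower_le_tangent_line C1 vw wh; move: h; rewrite tangent_lineE => h.
  by have := ler_wpM2l t0 h; lra.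
exists phi, P1, P2; rewrite f1 f2; split => //.
rewrite (_ : (b - a) * _ = (a - a) * (powf p w + xi C * mslope (K1 p C) w) +
  powf p w * (t2 - a) + powf p v * (b - t2))//.
by rewrite /t2; lra.
Qed.

(* With x2 above the chord and above the tangent line at W, x is a barycentric
   combination of the points of abscissa V and W on the lower boundary and of
   the tangency point (W + xi, C e^(W+xi)); the weights are read off the two
   lines through (W, e^W). *)
Lemma barycentric x : Omega C x -> V <= u C x -> u C x <= W -> ~ below p C x ->
  exists al be ga, [/\ 0 <= al, 0 <= be, 0 <= ga, al + be + ga = 1 &
    x.1 = al * (W + xi C) + be * W + ga * V /\
    x.2 = al * (expR W / (1 - xi C)) + be * expR W + ga * expR V].
Proof.
move=> ox Vu uW nb; have [Tx /andP[ux xu]] := u_spec C1 ox.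
have rk := r_lt_k H0.
pose k0 := k C W; pose r0 := r V W.
have WV : 0 < W - V by rewrite subr_gt0.
have kr : 0 < k0 - r0 by rewrite subr_gt0.
have eVW : expR W - expR V = r0 * (W - V).
  by rewrite /r0 /r mulfVK// gt_eqF.
have eU : expR W / (1 - xi C) = expR W + k0 * xi C.
  have k1 : (1 - xi C) * (1 - xi C)^-1 = 1 by rewrite divff// gt_eqF.
  rewrite /k0 /k; move: k1; move: (1 - xi C)^-1 (expR W) => k E k1.
  by have := congr1 ( *%R E) k1; rewrite /=; lra.
pose X := x.1 - W; pose Y := x.2 - expR W.
have hU : 0 <= Y - r0 * X.
  have hh : chord_line V W x.1 <= x.2.
    have /andP[lo _] := ox.
    have [xV|Vx] := leP x.1 V.
      apply: le_trans lo; have [->|ne] := eqVneq x.1 V; first by rewrite chord_linel.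
      by apply/ltW/chord_line_lt_lower => //; rewrite lt_neqAle ne xV.
    have [Wx|xW] := leP W x.1.
      apply: le_trans lo; have [->|ne] := eqVneq x.1 W; first by rewrite chord_liner.
      apply/ltW/chord_line_lt_lower => //.
      by rewrite [W < _]lt_neqAle eq_sym ne Wx orbT.
    by rewrite leNgt; apply/negP => lt_x; apply: nb; split => //; rewrite Vx.
  by move: hh; rewrite /chord_line -/r0 /X /Y; lra.
have hV : 0 <= Y - k0 * X.
  have := tangent_line_le_of_u C1 ox uW.
  by rewrite /tangent_line -/k0 /X /Y; lra.
have dU : 0 < (k0 - r0) * xi C by rewrite mulr_gt0.
have dV : 0 < (k0 - r0) * (W - V) by rewrite mulr_gt0.
pose al := (Y - r0 * X) / ((k0 - r0) * xi C).
pose ga := (Y - k0 * X) / ((k0 - r0) * (W - V)).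
have al0 : 0 <= al by rewrite divr_ge0// ltW.
have ga0 : 0 <= ga by rewrite divr_ge0// ltW.
have eal : al * ((k0 - r0) * xi C) = Y - r0 * X by rewrite mulfVK// gt_eqF.
have ega : ga * ((k0 - r0) * (W - V)) = Y - k0 * X by rewrite mulfVK// gt_eqF.
have eX : X = al * xi C - ga * (W - V).
  apply: (@mulfI _ (k0 - r0)); first by rewrite gt_eqF.
  by move: eal ega; move: (W - V) => d; lra.
have eY : Y = al * k0 * xi C - ga * r0 * (W - V).
  by move: eal; rewrite eX; move: (W - V) => d; lra.
have x1E : x.1 = al * (W + xi C) + (1 - al - ga) * W + ga * V.
  by move: eX; rewrite /X; lra.
have x2E : x.2 = al * (expR W / (1 - xi C)) + (1 - al - ga) * expR W + ga * expR V.
  by move: eY eVW; rewrite /Y eU => eY eVW; have := congr1 ( *%R ga) eVW; rewrite /=; lra.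
exists al, (1 - al - ga), ga; split => //; last by lra.
(* The middle weight is nonnegative when x is below the line from (V, e^V) to the tangency point at
   W + xi, whose slope is m. Up to V + xi this holds because x is below T_V; afterwards the convex
   upper boundary is below its own chord, whose ends are on or below the line. *)
pose m := (expR W + k0 * xi C - expR V) / (W + xi C - V).
have dd : 0 < W + xi C - V by lra.
have em : m * (W + xi C - V) = expR W + k0 * xi C - expR V by rewrite mulfVK// gt_eqF.
have mr : 0 < (m - r0) * (W - V).
  rewrite mulr_gt0// subr_gt0 /m ltr_pdivlMr//.
  by move: dU; lra.
have E_ge0 : 0 <= expR V + m * (x.1 - V) - x.2.
  have Vx : V <= x.1 by lra.
  have topW : expR V + m * (W + xi C - V) = C * expR (W + xi C).
    by rewrite em (upper_xi H0) eU; lra.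
  have km : k C V <= m.
    rewrite /m ler_pdivlMr//; have := tangent_line_le_upper C1 V (W + xi C).
    by rewrite /tangent_line -topW em; lra.
  have [xV|Vxi] := leP x.1 (V + xi C).
    have h : x.2 <= tangent_line C V x.1.
      by apply: (le_tangent_line_of_u C1) => //; lra.
    have h2 : 0 <= (m - k C V) * (x.1 - V) by rewrite mulr_ge0 ?subr_ge0.
    by move: h; rewrite /tangent_line; lra.
  have /andP[_ up] := ox.
  pose la := (x.1 - (V + xi C)) / (W - V).
  have ela : la * (W - V) = x.1 - (V + xi C) by rewrite mulfVK// gt_eqF.
  have la0 : 0 <= la by rewrite divr_ge0 ?subr_ge0 ?ltW.
  have la1 : la <= 1 by rewrite ler_pdivrMr//; lra.
  have xla : x.1 = la * (W + xi C) + (1 - la) * (V + xi C) by lra.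
  have cv : expR x.1 <= la * expR (W + xi C) + (1 - la) * expR (V + xi C).
    by rewrite {1}xla expR_conv// la0.
  have tangency_V : C * expR (V + xi C) <= expR V + m * xi C.
    rewrite -(tangent_line_at_top C1 V) /tangent_line.
    have h2 : 0 <= (m - k C V) * xi C by rewrite mulr_ge0 ?subr_ge0 ?(ltW X0).
    by lra.
  have C0' : 0 <= C by exact: ltW (lt_trans ltr01 C1).
  have cv2 := ler_wpM2l C0' cv.
  have cv3 := congr1 ( *%R la) topW; rewrite /= in cv3.
  have la1' : 0 <= 1 - la by rewrite subr_ge0.
  have cv4 := ler_wpM2l la1' tangency_V.
  have := congr1 ( *%R m) ela; rewrite /=; lra.
have eE : expR V + m * (x.1 - V) - x.2 = (1 - al - ga) * ((m - r0) * (W - V)).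
  rewrite x1E x2E eU; have := congr1 ( *%R al) em; have := congr1 ( *%R (1 - al - ga)) eVW.
  by rewrite /=; lra.
by move: E_ge0; rewrite eE pmulr_lge0.
Qed.

(** The weights of [barycentric] are the relative lengths of the three pieces. On this region the
    candidate is one plane, so its value is the same combination of the costs of the pieces. *)
Lemma attained_mid_path t x : a <= t -> Omega C x -> V <= u C x -> u C x <= W ->
  ~ below p C x ->
  exists phi P1 P2, [/\ path p C a t phi P1 P2 ((t - a) * chain p C (u C x) x),
    P1 t = (t - a) * x.1, P2 t = (t - a) * x.2
  & x.1 = V + xi C -> x.2 = tangent_line C V x.1 ->
    forall s c, s <= V -> a <= c -> c <= t -> linP C a P1 P2 s c <= 0].
Proof.
move=> at_ ox Vu uW nb; have [Tx _] := u_spec C1 ox.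
have [al [be [ga [al0 be0 ga0 sum1 [x1E x2E]]]]] := barycentric ox Vu uW nb.
have L0 : 0 <= t - a by rewrite subr_ge0.
have aL := mulr_ge0 al0 L0; have bL := mulr_ge0 be0 L0; have gL := mulr_ge0 ga0 L0.
have sumL : al * (t - a) + be * (t - a) + ga * (t - a) = t - a.
  by rewrite -!mulrDl sum1 mul1r.
pose t1 := a + al * (t - a); pose t2 := t1 + be * (t - a).
have at1 : a <= t1 by rewrite /t1; lra.
have t12 : t1 <= t2 by rewrite /t2; lra.
have t2b : t2 <= t by rewrite /t2 /t1; lra.
have d1 : t1 - a = al * (t - a) by rewrite /t1; lra.
have d2 : t2 - t1 = be * (t - a) by rewrite /t2; lra.
have d3 : t - t2 = ga * (t - a) by rewrite /t2 /t1; lra.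
have e1 : (t1 - a) * (W + xi C) + W * (t2 - t1) + V * (t - t2) = (t - a) * x.1.
  by rewrite d1 d2 d3 x1E; lra.
have e2 : (t1 - a) * (expR W / (1 - xi C)) + expR W * (t2 - t1) + expR V * (t - t2) =
    (t - a) * x.2.
  by rewrite d1 d2 d3 x2E; lra.
have [|phi [P1 [P2 [pa f1 f2 low]]]] :=
    path_two H0 at1 t12 t2b (fun _ => W_gt0 H0) (ltW VW0) W_V_le_hstar Vu.
  by rewrite e1 e2 lin_tangent Tx subrr mulr0.
exists phi, P1, P2; rewrite f1 f2; split => //; last first.
  move=> xV xT; apply: low; [by rewrite e1 xV| |exact: W_V_le_xi].
  by rewrite e1 e2 lin_tangent -xT subrr mulr0.
rewrite chain_mid// (_ : (t - a) * _ = (t1 - a) * (powf p W + xi C * mslope (K1 p C) W) +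
  powf p W * (t2 - t1) + powf p V * (t - t2))//.
rewrite d1 d2 d3.
have pV := plane_VW H0 (V, expR V).
rewrite {1}/plane/= subrr mulr0 !addr0 mulr1 subrr mulr0 addr0 in pV.
have TU : (W + xi C, expR W / (1 - xi C)).2 = tangent_line C W (W + xi C, expR W / (1 - xi C)).1.
  by rewrite /= tangent_line_at_top// (upper_xi H0).
have pU := plane_tangent_value (K1 p C) TU.
rewrite K1_W//= in pU.
have pX : plane p W Kb x = al * plane p W Kb (W + xi C, expR W / (1 - xi C)) +
    be * powf p W + ga * plane p W Kb (V, expR V).
  have beE : be = 1 - al - ga by lra.
  rewrite /plane x1E x2E beE/=.
  by move: (expR W) (expR V) (powf p W) (powf1 p W) Kb (1 - xi C)^-1 => e4 e5 e6 e7 e8 e9; lra.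
rewrite pX -pV pU.
have -> : W + xi C - W = xi C by lra.
by move: (mslope _ _) => ms; lra.
Qed.

Definition tangency_V : R * R := (V + xi C, expR V / (1 - xi C)).

Lemma tangency_V_spec : [/\ Omega C tangency_V, u C tangency_V = V, ~ below p C tangency_V
  & tangency_V.2 = tangent_line C V tangency_V.1].
Proof.
have T : tangency_V.2 = tangent_line C V tangency_V.1.
  by rewrite /tangency_V/= tangent_line_at_top// (upper_xi H0).
have top : tangency_V.2 = C * expR tangency_V.1 by rewrite /tangency_V/= (upper_xi H0).
have o : Omega C tangency_V.
  suff : expR tangency_V.1 <= tangency_V.2 <= C * expR tangency_V.1 by [].
  by rewrite top lexx andbT ler_peMl ?expR_ge0// ltW.
split => //.
- apply/eqP; rewrite eq_le; apply/andP; split.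
    by apply: (u_le_of_tangent_line C1 o); rewrite ?T.
  by apply: (le_u_of_tangent_line C1 o); rewrite ?T//= lerDl ltW.
- case=> _; rewrite T ltNge => /negP; apply.
  by apply: (chord_le_tangentV H0); rewrite /= lerDl ltW.
Qed.

(** The path reaches the tangency point of T_V by [attained_mid_path], follows the upper boundary
    leftwards by a second logarithmic piece, now with [K3], and leaves it along T_z by the constant
    z. When x lies on the lower boundary the constant z alone is used. *)
Lemma attained_left b x : a < b -> Omega C x -> u C x <= V ->
  attained b x ((b - a) * chain p C (u C x) x).
Proof.
move=> ab ox uV; have [Tx /andP[ux xu]] := u_spec C1 ox.
rewrite chain_left// plane_tangent_value//; move: Tx ux xu uV.
move: (u C x) => z Tx ux xu zV.
pose th := (x.1 - z) / xi C.
have thx : th * xi C = x.1 - z by rewrite mulfVK// gt_eqF.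
have th0 : 0 <= th by rewrite divr_ge0 ?subr_ge0// ltW.
have th1 : th <= 1 by rewrite ler_pdivrMr// mul1r; lra.
have L0 : 0 < b - a by rewrite subr_gt0.
have tL1 : 0 <= (1 - th) * (b - a) by rewrite mulr_ge0 ?subr_ge0// ltW.
have zh : z <= z + hstar C by have := hstar_gt C1; lra.
move: th0; rewrite le_eqVlt => /predU1P[th_eq0|th0].
  have x1z : x.1 = z by move: thx; rewrite -th_eq0 mul0r; lra.
  have x2z : x.2 = expR z by rewrite -Tx x1z tangent_line_id.
  have e1 : (a - a) * (z + xi C) + z * (a - a) + z * (b - a) = (b - a) * x.1.
    by rewrite x1z; lra.
  have e2 : (a - a) * (expR z / (1 - xi C)) + expR z * (a - a) + expR z * (b - a) = (b - a) * x.2.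
    by rewrite x2z; lra.
  have aa : a < a -> 0 < z by rewrite ltxx.
  have [|phi [P1 [P2 [pa f1 f2 _]]]] :=
      path_two H0 (lexx a) (lexx a) (ltW ab) aa (lexx z) zh (lexx z).
    by rewrite e1 e2 lin_tangent Tx subrr mulr0.
  exists phi, P1, P2; rewrite f1 f2; split => //.
  rewrite (_ : (b - a) * _ = (a - a) * (powf p z + xi C * mslope (K1 p C) z) +
    powf p z * (a - a) + powf p z * (b - a))//.
  by rewrite x1z; lra.
have tL0 : 0 < th * (b - a) by rewrite mulr_gt0.
pose t4 := a + th * (b - a).
(* Chosen so that the second logarithmic piece, which starts with value V at a + T, has value z at
   t4. *)
pose T := (t4 - a) * expR (- ((V - z) / xi C)).
pose t3 := a + T.
have t4a : t4 - a = th * (b - a) by rewrite /t4; lra.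
have T0 : 0 < T by rewrite mulr_gt0 ?expR_gt0// t4a.
have t3a : t3 - a = T by rewrite /t3; lra.
have Vz0 : 0 <= (V - z) / xi C by rewrite divr_ge0 ?subr_ge0// ltW.
have at3 : a < t3 by rewrite /t3; lra.
have t34 : t3 <= t4.
  suff : T <= t4 - a by rewrite /t3; lra.
  by rewrite /T ger_pMr ?t4a// -expR0 ler_expR oppr_le0.
have t4b : t4 <= b by rewrite /t4; lra.
have [oT uT nT TT] := tangency_V_spec.
have [||phi1 [P1 [P2 [pa1 f1 f2 low]]]] := attained_mid_path (ltW at3) oT _ _ nT.
- by rewrite uT.
- by rewrite uT ltW.
have {}low := low erefl TT.
have lgz : lg C a V T t4 = z.
  rewrite /lg /T; have -> : (t4 - a) / ((t4 - a) * expR (- ((V - z) / xi C))) = expR ((V - z) / xi C).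
    rewrite expRN invfM invrK mulrA divff ?mul1r// gt_eqF// t4a.
    exact: tL0.
  by rewrite expRK mulrC mulfVK ?gt_eqF//; lra.
have lgV : lg C a V T t3 = V by apply: lg_at.
have [phi2 [Q1 [Q2 [pa2 low2 g1 g2]]]] :=
  path_append_log H0 pa1 at3 t34 (is_derive_K3 H0) f1 f2 (fun s c => low s c).
rewrite t3a in pa2 g1 g2.
have Q1t : Q1 t4 = (t4 - a) * (z + xi C) by rewrite g1 /lg1 lgz.
have Q2t : Q2 t4 = (t4 - a) * (expR z / (1 - xi C)) by rewrite g2 /lg2 lgz.
have linz : linP C a Q1 Q2 z t4 = 0 by rewrite /linP Q1t Q2t (lin_top_eq H0).
have [|phi3 [S1 [S2 [pa3 _ _ D3]]]] := @path_append_cst R p C a H0 t4 b z phi2 Q1 Q2 _ pa2 t4b.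
  move=> c d ac ct td db; exists z.
  by rewrite linz tangent_line_id// subrr mulr0 addr0 low2.
have [S1b S2b] := D3 b t4b.
exists phi3, S1, S2; split.
- rewrite (_ : (b - a) * _ = T * chain p C (u C tangency_V) tangency_V +
    (lg3 p C a (K3 p C) V T t4 - lg3 p C a (K3 p C) V T t3) + powf p z * (b - t4)); first by [].
  rewrite uT chain_left// plane_tangent_value// /lg3 lgz lgV t3a.
  have -> : tangency_V.1 - V = xi C by rewrite /tangency_V/=; lra.
  have := congr1 ( *%R ((b - a) * mslope (K3 p C) z)) thx; rewrite /t4/=.
  by move: (mslope _ z) (mslope _ V) (powf p z) (powf p V) => m1 m2 q1 q2; lra.
- rewrite S1b Q1t; have := congr1 ( *%R (b - a)) thx; rewrite /t4/=; lra.
- rewrite S2b Q2t -Tx tangent_lineE.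
  have k1 : (1 - xi C) * (1 - xi C)^-1 = 1 by rewrite divff// gt_eqF.
  rewrite -thx /t4; move: k1; move: (1 - xi C)^-1 (expR z) => k E k1.
  by have := congr1 ( *%R (th * (b - a) * E)) k1; rewrite /=; lra.
Qed.

Lemma candidate_attained b x : a < b -> Omega C x ->
  attained b x ((b - a) * candidate p C x).
Proof.
move=> ab ox; have [[-> nb]|[bx ->]] := cand_cases H0 ox.
  have [uV|Vu] := leP (u C x) V; first exact: attained_left.
  have [uW|Wu] := leP (u C x) W; last by apply: attained_right => //; exact: ltW.
  have [phi [P1 [P2 [h1 h2 h3 _]]]] := attained_mid_path (ltW ab) ox (ltW Vu) uW nb.
  by exists phi, P1, P2.
have [v [w [t [t01 -> -> [/andP[Vv vw] wW] _]]]] := b4_spec H0 ox bx.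
by apply: attained_mix => //; exact: ltW.
Qed.

End Attained.

#[local] Opaque xi candidate C0 Gamma wbar vF D kappa K1 K3.

Theorem theorem3p1 (R : realType) (p C : R) (hp : 2 < p) (hC : C0 p < C)
    (a b : R) (hab : a < b) (x : R * R) (hx : Omega C x) :
  lower_bellman p C a b x = (candidate p C x)%:E.
Proof.
have H0 : admissible p C by [].
have ba0 : b - a != 0 by rewrite subr_eq0 gt_eqF.
apply/eqP; rewrite eq_le; apply/andP; split; last first.
  by apply: le_ereal_inf_tmp => _ [phi tphi <-]; exact: test_function_lower.
have [phi [P1 [P2 [pa e1 e2]]]] := candidate_attained H0 hab hx.
have [tphi le] := path_test H0 hab pa e1 e2.
move: le; rewrite [(b - a) * _]mulrC mulfK// => le.
by apply: le_trans le; apply: ereal_inf_lbound; exists phi.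
Qed.
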